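(* Let $n\ge1$, $a>1$, $0<s\le 1/2$ and $b\le 2s/(a-s)$. Let $(t_k)_{k=1}^\infty$ be a sequence of real numbers with $1>t_1>t_2>t_3>\dots>0$ and $\lim_{k\to\infty}t_k=0$, and set $$A_j=\{t_k : 2^{-j-1}<t_k\le 2^{-j}\},\qquad j=1,2,3,\dots.$$ Assume that there is a constant $C$ such that $\#A_j\le C2^{bj}$ for $j=1,2,3,\dots$, and that $f\in H_s(\mathbb{R}^n)$. Then $$\lim_{k\to\infty}S_{t_k}f(x)=f(x)$$ for almost every $x\in\mathbb{R}^n$.
   Context: $\#A$ denotes the number of elements of a set $A$. The Fourier transform is $\hat f(\xi)=\int_{\mathbb{R}^n}e^{-i\xi\cdot x}f(x)\,dx$. For $f\in L^2(\mathbb{R}^n)$ and $a>0$, $S_tf(x)=(2\pi)^{-n}\int_{\mathbb{R}^n}e^{i\xi\cdot x}e^{it|\xi|^a}\hat f(\xi)\,d\xi$, i.e. $S_tf$ is the $L^2$ function with Fourier transform $e^{it|\xi|^a}\hat f(\xi)$. The Sobolev space is $H_s=\{f\in\mathscr{S}' : \|f\|_{H_s}<\infty\}$ with $\|f\|_{H_s}=\left(\int_{\mathbb{R}^n}(1+|\xi|^2)^s|\hat f(\xi)|^2\,d\xi\right)^{1/2}$. *)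

(* Defs.v *)
From HB Require Import structures.
From mathcomp Require Import all_boot all_order all_algebra.
From mathcomp Require Import all_classical all_reals all_analysis.
From mathcomp Require Import complex.

Set Implicit Arguments.
Unset Strict Implicit.
Unset Printing Implicit Defensive.

Import Order.TTheory GRing.Theory Num.Theory.
Import numFieldNormedType.Exports.

Local Open Scope classical_set_scope.
Local Open Scope ring_scope.
Local Open Scope complex_scope.

(** The real-valued modulus; `|z| itself lies in [R[i]]. *)
Local Notation normc := ComplexField.Normc.normc.

(** R^n with the Borel sigma-algebra (generated by the coordinates). *)
Notation Rn R n := (n.-tuple (measurableTypeR R)).

Section lebesgue_step.
Context {R : realType} {n : nat}.

Definition cons_pair (p : measurableTypeR R * Rn R n) : Rn R n.+1 :=
  [the Rn R n.+1 of p.1 :: p.2].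

Lemma measurable_cons_pair : measurable_fun setT cons_pair.
Proof. exact: (measurable_cons measurable_fst measurable_snd). Qed.

Lemma measurable_preimage_cons_pair (A : set (Rn R n.+1)) :
  measurable A -> measurable (cons_pair @^-1` A).
Proof.
by move=> mA; rewrite -[X in measurable X]setTI; exact: measurable_cons_pair.
Qed.

Variable mu : {sigma_finite_measure set (Rn R n) -> \bar R}.

Definition lebesgue_cons : set (Rn R n.+1) -> \bar R :=
  pushforward (lebesgue_measure \x mu)%E cons_pair.

Let lebesgue_cons0 : (lebesgue_cons set0 = 0)%E.
Proof. by rewrite /lebesgue_cons /pushforward preimage_set0 measure0. Qed.

Let lebesgue_cons_ge0 A : (0 <= lebesgue_cons A)%E.
Proof. by rewrite /lebesgue_cons /pushforward; exact: measure_ge0. Qed.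

Let lebesgue_cons_sigma_additive : semi_sigma_additive lebesgue_cons.
Proof.
move=> F mF tF mUF; rewrite /lebesgue_cons /pushforward preimage_bigcup.
apply: measure_semi_sigma_additive.
- by move=> k; exact: measurable_preimage_cons_pair.
- apply/trivIsetP => /= i j _ _ ij; rewrite -preimage_setI.
  by move/trivIsetP : tF => /(_ _ _ _ _ ij) ->//; rewrite preimage_set0.
- by rewrite -preimage_bigcup; exact: measurable_preimage_cons_pair.
Qed.

HB.instance Definition _ := isMeasure.Build _ _ _
  lebesgue_cons lebesgue_cons0 lebesgue_cons_ge0 lebesgue_cons_sigma_additive.

Let lebesgue_cons_sigma_finite : sigma_finite setT lebesgue_cons.
Proof.
pose unc (x : Rn R n.+1) : measurableTypeR R * Rn R n :=
  (thead x, [tuple of behead x]).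
have mh : measurable_fun setT (fun x : Rn R n.+1 => thead x).
  exact: measurable_tnth.
have munc : measurable_fun setT unc.
  apply: (@measurable_fun_pair _ _ _ _ _ _ (fun x : Rn R n.+1 => thead x)) => //.
  exact: measurable_behead.
have /sigma_finiteP[F [TF ndF Foo]] := sigma_finiteT (@lebesgue_measure R).
have /sigma_finiteP[G [TG ndG Goo]] := sigma_finiteT mu.
exists (fun k => unc @^-1` (F k `*` G k)).
  rewrite -preimage_bigcup; apply/esym; rewrite -subTset => x _.
  have [k _ Fk] : (\bigcup_i F i) (unc x).1 by rewrite -TF.
  have [l _ Gl] : (\bigcup_i G i) (unc x).2 by rewrite -TG.
  exists (maxn k l) => //; split.
  - by move: Fk; exact/subsetPset/ndF/leq_maxl.
  - by move: Gl; exact/subsetPset/ndG/leq_maxr.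
move=> k; have [mF Fk] := Foo k; have [mG Gk] := Goo k; split.
  by rewrite -[X in measurable X]setTI; apply: munc => //; exact: measurableX.
rewrite /lebesgue_cons /pushforward -comp_preimage.
rewrite (_ : unc \o cons_pair = id); last first.
  apply/funext => -[a x] /=; rewrite /unc /cons_pair /=.
  by congr pair; exact/val_inj.
by rewrite preimage_id product_measure1E// lte_mul_pinfty// ge0_fin_numE.
Qed.

HB.instance Definition _ := Measure_isSigmaFinite.Build _ _ _
  lebesgue_cons lebesgue_cons_sigma_finite.

End lebesgue_step.

(** Lebesgue measure on R^n, as the n-fold product of Lebesgue measure on R
    (and the unit mass on the one-point space R^0). *)
Fixpoint lebesgueRn (R : realType) (n : nat) :
    {sigma_finite_measure set (Rn R n) -> \bar R} :=
  match n return {sigma_finite_measure set (Rn R n) -> \bar R} with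
  | 0%N => \d_([tuple] : Rn R 0)
  | m.+1 => lebesgue_cons (lebesgueRn R m)
  end.

Section euclidean.
Context {R : realType} {n : nat}.
Implicit Types x y xi : Rn R n.

Definition dotRn x y : R := \sum_(i < n) (tnth x i : R) * (tnth y i : R).

Definition normRn x : R := Num.sqrt (dotRn x x).

(** The point x + h e_i, with e_i the i-th basis vector. *)
Definition shiftRn (i : 'I_n) x (h : R) : Rn R n :=
  [tuple (tnth x j : R) + (j == i)%:R * h | j < n].

End euclidean.

Section complex_functions.
Context {R : realType} {n : nat}.
Implicit Types (f g phi u : Rn R n -> R[i]) (x xi : Rn R n).

Definition expi (theta : R) : R[i] := cos theta +i* sin theta.

Definition measurableC f : Prop :=
  measurable_fun setT (fun x => complex.Re (f x)) /\
  measurable_fun setT (fun x => complex.Im (f x)).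

(** Only meaningful for integrable [f]. *)
Definition integralC f : R[i] :=
  (\int[lebesgueRn R n]_x complex.Re (f x)) +i*
  (\int[lebesgueRn R n]_x complex.Im (f x)).

Definition inL2 f : Prop :=
  measurableC f /\
  (\int[lebesgueRn R n]_x (normc (f x) ^+ 2)%:E < +oo)%E.

Definition fourier phi : Rn R n -> R[i] :=
  fun xi => integralC (fun x => expi (- dotRn xi x) * phi x).

Definition partial_derivable (i : 'I_n) phi x : Prop :=
  derivable (fun h : R => complex.Re (phi (shiftRn i x h))) 0 1 /\
  derivable (fun h : R => complex.Im (phi (shiftRn i x h))) 0 1.

Definition partial (i : 'I_n) phi : Rn R n -> R[i] := fun x =>
  derive1 (fun h : R => complex.Re (phi (shiftRn i x h))) 0 +i*
  derive1 (fun h : R => complex.Im (phi (shiftRn i x h))) 0.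

(** [partials [:: i1; ...; ik] phi] is d_{i1} ... d_{ik} phi. *)
Definition partials (l : seq 'I_n) phi : Rn R n -> R[i] :=
  foldr partial phi l.

(** Schwartz functions.  Continuity of the iterated partial derivatives need
    not be required: each of them has bounded first-order partial derivatives,
    hence is Lipschitz. *)
Definition schwartz phi : Prop :=
  forall l : seq 'I_n,
    (forall i x, partial_derivable i (partials l phi) x) /\
    (forall N : nat, exists M : R, forall x,
       (1 + normRn x) ^+ N * normc (partials l phi x) <= M).

(** [M] bounds the [N]-th Schwartz seminorm of [phi]. *)
Definition schwartz_bound (N : nat) phi (M : R) : Prop :=
  forall l : seq 'I_n, (size l <= N)%N ->
    forall x, (1 + normRn x) ^+ N * normc (partials l phi x) <= M.

(** A tempered distribution is a functional whose restriction to the Schwartz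
    functions is linear and continuous; its other values are irrelevant. *)
Definition tempered (T : (Rn R n -> R[i]) -> R[i]) : Prop :=
  (forall (c : R[i]) phi psi, schwartz phi -> schwartz psi ->
     T (fun x => c * phi x + psi x) = c * T phi + T psi) /\
  (exists (N : nat) (K : R), forall phi M, schwartz phi ->
     schwartz_bound N phi M -> normc (T phi) <= K * M).

Definition regular f : (Rn R n -> R[i]) -> R[i] :=
  fun phi => integralC (fun x => f x * phi x).

(** The Fourier transform of the tempered distribution [T], given by
    [phi |-> T (fourier phi)], is the function [g]. *)
Definition has_fourier (T : (Rn R n -> R[i]) -> R[i]) g : Prop :=
  forall phi, schwartz phi -> T (fourier phi) = regular g phi.

(** [T] belongs to the Sobolev space H_s; finiteness of the weighted integral
    is finiteness of the squared H_s norm. *)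
Definition sobolev (s : R) (T : (Rn R n -> R[i]) -> R[i]) : Prop :=
  tempered T /\
  exists g, [/\ measurableC g, has_fourier T g &
    (\int[lebesgueRn R n]_xi
       ((1 + normRn xi ^+ 2) `^ s * normc (g xi) ^+ 2)%:E < +oo)%E].

(** [u] is a representative of S_t f, the element of L^2 whose Fourier transform
    is [exp (i t |xi|^a)] times that of [f].  Elements of L^2 are handled through
    everywhere-defined representatives; on L^2 the Fourier transform in the
    sense of tempered distributions is the Plancherel one, so [g] exists and is
    unique almost everywhere. *)
Definition is_S (a t : R) f u : Prop :=
  inL2 u /\
  exists g, [/\ inL2 g, has_fourier (regular f) g &
    has_fourier (regular u) (fun xi => expi (t * normRn xi `^ a) * g xi)].

End complex_functions.

(** The set A_j. *)
Definition dyadic_block {R : realType} (t : nat -> R) (j : nat) : set R :=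
  [set x | range t x /\ 2 `^ (- j%:R - 1) < x <= 2 `^ (- j%:R)].

(* Main.v *)
(** Put kappa = 2s/a and let two times t_k, t_l belong to the same cell when they
    lie in the same block (2^(-j-1), 2^(-j)] and in the same interval of length
    2^(-j(1+kappa)); let p(k) be the first index in the cell of k.  Since
    |e^(iu) - e^(iv)|^2 <= min(4, (u-v)^2), Plancherel bounds
      sum_k |S_{t_k} f - S_{t_p(k)} f|^2 + sum_{p(k)=k} |S_{t_k} f - f|^2  (in L^2)
    by the integral of W |f^|^2, where W(xi) sums min(4, ((t_k - t_p(k)) |xi|^a)^2)
    over all k and min(4, (t_k |xi|^a)^2) over the representatives.  Block j has
    O(2^(j kappa)) cells, and O(2^(j kappa (1+kappa))) elements because
    b <= 2s/(a-s) <= kappa (1+kappa), which is where s <= 1/2 enters.  Geometric sums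
    give W(xi) = O(|xi|^(a kappa)) = O((1+|xi|^2)^s).  Hence almost everywhere both
    series of squares converge, their terms tend to 0, and p(k) -> oo.

    Only the inequality |u| <= C |u^| in L^2 and the uniqueness of u^ are needed from
    Fourier analysis.  Testing u^ against modulated Gaussians gives the heat averages of u;
    their L^2 norms are bounded by Schur's test, and they recover the norm of u
    because the Dirichlet forms of the heat kernels at an L^2 function tend to 0,
    which is reduced to dimension 1 and to continuous functions. *)

Require Import Defs.
From HB Require Import structures.
From mathcomp Require Import all_boot all_order all_algebra.
From mathcomp Require Import all_classical all_reals all_analysis.
From mathcomp Require Import complex.
From mathcomp Require Import measurable_realfun lebesgue_integral_under ring lra.

Set Implicit Arguments.
Unset Strict Implicit.
Unset Printing Implicit Defensive.

Import Order.TTheory GRing.Theory Num.Theory.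
Import numFieldNormedType.Exports.
Local Open Scope classical_set_scope.
Local Open Scope ring_scope.

(** * Gaussian integrals *)

(** Two levels of comparison are needed because comparing every S_{t_k} f directly with f costs
    sum_j #A_j min(4, (2^(-j) X)^2) with X = |xi|^a, and this is O(X^kappa) only when #A_j = O(2^(j
    kappa)). Inside a cell the times differ by at most r^(-j) with r = 2^(1+kappa), so the same
    geometric sum with ratio r in place of 2 tolerates #A_j = O(r^(j kappa)). The cell length is the
    one for which a block of length about 2^(-j) still has only O(2^(j kappa)) cells, as many
    representatives as the direct comparison with f can afford.

    Only finiteness of the summed integrals matters at the end, so the Plancherel inequality may
    lose constant factors: complex functions are split into real and imaginary parts and cross terms
    are estimated by 2 (a^2 + b^2). Gaussians suffice as test functions because their transforms are
    explicit and are heat kernels.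

    Each S_t f is given with its own version of the transform of f, and the Sobolev condition with
    yet another. Uniqueness is what lets a single g serve all times. *)

Section integrable_real.
Context d (T : measurableType d) (R : realType) (mu : {measure set T -> \bar R}).
Implicit Types f g : T -> R.

Lemma integrableR_le f g : measurable_fun setT f -> (forall x, `|f x| <= g x) ->
  mu.-integrable setT (EFin \o g) -> mu.-integrable setT (EFin \o f).
Proof.
move=> mf fg ig; apply: (le_integrable measurableT _ _ ig).
  exact/measurable_EFinP.
by move=> x _ /=; rewrite lee_fin (le_trans (fg x))// ler_norm.
Qed.

Lemma integrableRD f g : mu.-integrable setT (EFin \o f) ->
  mu.-integrable setT (EFin \o g) ->
  mu.-integrable setT (EFin \o (fun x => f x + g x)).
Proof. exact: integrableD. Qed.

Lemma integrableRB f g : mu.-integrable setT (EFin \o f) ->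
  mu.-integrable setT (EFin \o g) ->
  mu.-integrable setT (EFin \o (fun x => f x - g x)).
Proof. exact: integrableB. Qed.

Lemma integrableRZ c f : mu.-integrable setT (EFin \o f) ->
  mu.-integrable setT (EFin \o (fun x => c * f x)).
Proof. exact: integrableZl. Qed.

Lemma integrableR_ge0P f : measurable_fun setT f -> (forall x, 0 <= f x) ->
  (\int[mu]_x (f x)%:E < +oo)%E -> mu.-integrable setT (EFin \o f).
Proof.
move=> mf f0 fi; apply/integrableP; split; first exact/measurable_EFinP.
by under eq_integral do rewrite /= ger0_norm//.
Qed.

Lemma integrableR_ltoo f : (forall x, 0 <= f x) ->
  mu.-integrable setT (EFin \o f) -> (\int[mu]_x (f x)%:E < +oo)%E.
Proof.
move=> f0 /integrableP[_]; congr (_ < _)%E; apply: eq_integral => x _ /=.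
by rewrite ger0_norm.
Qed.

Lemma integrable_measurableR f : mu.-integrable setT (EFin \o f) ->
  measurable_fun setT f.
Proof. by move=> /integrableP[/measurable_EFinP]. Qed.

Lemma EFin_Rintegral f : mu.-integrable setT (EFin \o f) ->
  (\int[mu]_x f x)%:E = (\int[mu]_x (f x)%:E)%E.
Proof. by move=> fi; rewrite /Rintegral fineK//; exact: integrable_fin_num. Qed.

End integrable_real.

Section gaussian_1d.
Context {R : realType}.
Implicit Types s x m w c : R.
Local Notation mu := (@lebesgue_measure R).

(** [s] is an inverse variance, so that the Fourier transform exchanges [s] and [s^-1]. *)
Definition gauss1 s x : R := expR (- (s / 2 * x ^+ 2)).

Lemma gauss1_ge0 s x : 0 <= gauss1 s x. Proof. exact: expR_ge0. Qed.

Lemma measurable_gauss1 s : measurable_fun setT (gauss1 s).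
Proof.
apply: continuous_measurable_fun => x.
apply: (@continuous_comp _ _ _ (fun x : R => - (s / 2 * x ^+ 2)) expR).
  by apply: continuousN; apply: continuousM; [exact: cst_continuous|exact: exprn_continuous].
exact: continuous_expR.
Qed.

Lemma gauss1_normal s m x : 0 < s ->
  gauss1 s (x - m) = Num.sqrt (2 * pi / s) * normal_pdf m (Num.sqrt s^-1) x.
Proof.
move=> s0; have si0 : 0 < s^-1 by rewrite invr_gt0.
have r0 : Num.sqrt s^-1 != 0 by rewrite gt_eqF// sqrtr_gt0.
rewrite normal_pdfE// /normal_peak /normal_fun sqr_sqrtr ?ltW//.
rewrite mulrA (_ : s^-1 * pi *+ 2 = 2 * pi / s); last by rewrite -mulr_natr; ring.
rewrite divff ?mul1r; last first.
  by rewrite gt_eqF// sqrtr_gt0 !mulr_gt0// pi_gt0.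
congr expR; rewrite -mulr_natr; field.
by rewrite gt_eqF.
Qed.

Lemma integral_gauss1 s m : 0 < s ->
  (\int[mu]_x (gauss1 s (x - m))%:E = (Num.sqrt (2 * pi / s))%:E)%E.
Proof.
move=> s0; under eq_integral do rewrite gauss1_normal// EFinM.
rewrite integralZl//; last exact: integrable_normal_pdf.
by rewrite integral_normal_pdf mule1.
Qed.

Lemma integrable_gauss1 s m : 0 < s ->
  mu.-integrable setT (EFin \o (fun x : measurableTypeR R => gauss1 s (x - m))).
Proof.
move=> s0; have -> : (fun x : measurableTypeR R => gauss1 s (x - m)) =
    (fun x => Num.sqrt (2 * pi / s) * normal_pdf m (Num.sqrt s^-1) x).
  by apply/funext => x; rewrite gauss1_normal.
by apply: integrableRZ; exact: integrable_normal_pdf.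
Qed.

Lemma integrable_gauss1_0 s : 0 < s -> mu.-integrable setT (EFin \o gauss1 s).
Proof.
move=> s0; have := integrable_gauss1 0 s0.
by congr (_.-integrable _ _); apply/funext => x /=; rewrite subr0.
Qed.

(** Half of the exponent is given up: one of the two factors [gauss1 (s / 2) x] absorbs [|x|], since
    its inverse is at least [1 + s / 4 * x ^+ 2], and [(1 + 4 / s)] times this exceeds
    [1 + x ^+ 2]. *)
Lemma normr_gauss1_le s x : 0 < s ->
  `|x| * gauss1 s x <= (1 + 4 / s) * gauss1 (s / 2) x.
Proof.
move=> s0; have -> : gauss1 s x = gauss1 (s / 2) x * gauss1 (s / 2) x.
  by rewrite /gauss1 -expRD; congr expR; field.
rewrite mulrA ler_wpM2r ?gauss1_ge0//.
have h : 1 + s / 4 * x ^+ 2 <= expR (s / 4 * x ^+ 2) by exact: expR_ge1Dx.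
have -> : gauss1 (s / 2) x = (expR (s / 4 * x ^+ 2))^-1.
  by rewrite -expRN /gauss1; congr expR; field.
rewrite ler_pdivrMr ?expR_gt0//.
apply: le_trans (ler_wpM2l _ h); last by rewrite addr_ge0// divr_ge0 ?ltW.
have -> : (1 + 4 / s) * (1 + s / 4 * x ^+ 2) = 1 + 4 / s + s / 4 * x ^+ 2 + x ^+ 2.
  by field; rewrite gt_eqF.
have : 0 <= 4 / s by rewrite divr_ge0// ltW.
have : 0 <= s / 4 * x ^+ 2 by rewrite mulr_ge0 ?sqr_ge0// divr_ge0// ltW.
have := sqr_ge0 (`|x| - 1); rewrite -(real_normK (num_real x)).
by nra.
Qed.

Lemma integrable_mul_gauss1 s (h : measurableTypeR R -> R) C : 0 < s ->
  measurable_fun setT h -> (forall x, `|h x| <= C * (1 + `|x|)) ->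
  mu.-integrable setT (EFin \o (fun x : measurableTypeR R => h x * gauss1 s x)).
Proof.
move=> s0 mh hC.
have C0 : 0 <= C.
  by have := hC 0; rewrite normr0 addr0 mulr1; apply: le_trans.
apply: (@integrableR_le _ _ _ _ _
   (fun x : measurableTypeR R => C * gauss1 s x + C * (1 + 4 / s) * gauss1 (s / 2) x)).
- by apply: measurable_funM => //; exact: measurable_gauss1.
- move=> x; rewrite normrM (ger0_norm (gauss1_ge0 _ _)).
  apply: le_trans (ler_wpM2r (gauss1_ge0 _ _) (hC x)) _.
  rewrite mulrDr mulr1 mulrDl lerD2l -!mulrA ler_wpM2l//.
  exact: normr_gauss1_le.
- apply: integrableRD; apply: integrableRZ; apply: integrable_gauss1_0 => //.
  by rewrite divr_gt0.
Qed.

End gaussian_1d.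

(** * Fourier transform of the one-dimensional Gaussian *)

Section gaussian_fourier_1d.
Context {R : realType}.
Implicit Types s x m w c th : R.
Local Notation mu := (@lebesgue_measure R).
Local Notation RR := (measurableTypeR R).

Lemma is_derive_affine w th x : is_derive x 1 (fun x => w * x + th) w.
Proof.
have : is_derive x 1 (fun x => w * x + th) (w *: 1 + 0) by apply: is_deriveD.
by rewrite addr0 [w *: 1]mulr1.
Qed.

Lemma is_derive_cos_affine w th x :
  is_derive x 1 (fun x => cos (w * x + th)) (- (w * sin (w * x + th))).
Proof.
have h := @is_derive1_comp _ cos _ x _ _ (is_derive_cos _) (is_derive_affine w th x).
by apply: (is_derive_eq h); rewrite mulrC mulrN.
Qed.

Lemma is_derive_sin_affine w th x :
  is_derive x 1 (fun x => sin (w * x + th)) (w * cos (w * x + th)).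
Proof.
have h := @is_derive1_comp _ sin _ x _ _ (is_derive_sin _) (is_derive_affine w th x).
by apply: (is_derive_eq h); rewrite mulrC.
Qed.

Lemma is_derive_expR_sqr c x :
  is_derive x 1 (fun x => expR (c * x ^+ 2)) (2 * c * x * expR (c * x ^+ 2)).
Proof.
have h : is_derive x 1 (fun x => c * x ^+ 2) (c * (2 * x)).
  have h : is_derive x 1 (fun x => c * (x * x)) (c *: (x *: 1 + x *: 1)).
    exact: is_deriveZ.
  have -> : (fun x => c * x ^+ 2) = (fun x => c * (x * x)) by [].
  by apply: (is_derive_eq h); rewrite /GRing.scale /=; ring.
have h' := @is_derive1_comp _ expR _ x _ _ (is_derive_expR _) h.
by apply: (is_derive_eq h'); ring.
Qed.

Lemma is_derive_gauss1 s x : is_derive x 1 (gauss1 s) (- (s * x * gauss1 s x)).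
Proof.
have h := is_derive_expR_sqr (- (s / 2)) x.
have E : (fun x => expR (- (s / 2) * x ^+ 2)) = gauss1 s.
  by apply/funext => y; rewrite /gauss1 mulNr.
by rewrite E in h; apply: (is_derive_eq h); rewrite /gauss1 mulNr; field.
Qed.

Lemma measurable_cos : measurable_fun setT (@cos R).
Proof. by apply: measurable_realfun.continuous_measurable_fun; exact: continuous_cos. Qed.

Lemma measurable_sin : measurable_fun setT (@sin R).
Proof. by apply: measurable_realfun.continuous_measurable_fun; exact: continuous_sin. Qed.

Lemma measurable_fun_cos d (T : measurableType d) (f : T -> R) :
  measurable_fun setT f -> measurable_fun setT (fun x : T => cos (f x)).
Proof. by move=> mf; apply: (measurableT_comp measurable_cos). Qed.

Lemma measurable_fun_sin d (T : measurableType d) (f : T -> R) :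
  measurable_fun setT f -> measurable_fun setT (fun x : T => sin (f x)).
Proof. by move=> mf; apply: (measurableT_comp measurable_sin). Qed.

Lemma gauss1_natr_cvg0 s : 0 < s -> gauss1 s (k%:R : R) @[k --> \oo] --> (0 : R).
Proof.
move=> s0; apply: (@squeeze_cvgr _ _ _ _ (fun=> 0 : R) (fun k => 2 * (1 + 4 / s) * (k.+1%:R)^-1)).
- near=> k; rewrite gauss1_ge0/=.
  have k0 : (0 < k%:R :> R) by rewrite ltr0n; near: k; exists 1%N.
  have := normr_gauss1_le k%:R s0; rewrite ger0_norm ?ler0n// => h.
  have h1 : gauss1 (s / 2) k%:R <= 1.
    by rewrite /gauss1 -[leRHS]expR0 ler_expR oppr_le0 mulr_ge0 ?sqr_ge0// !divr_ge0 ?ltW.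
  have C0 : 0 <= 1 + 4 / s by rewrite addr_ge0// divr_ge0 ?ltW.
  rewrite -(ler_pM2l k0) (le_trans h)// (le_trans (ler_wpM2l C0 h1))// mulr1.
  rewrite [leRHS](_ : _ = (1 + 4 / s) * (2 * k%:R / k.+1%:R)); last by ring.
  rewrite ler_peMr// ler_pdivlMr ?ltr0n// mul1r -natrM ler_nat.
  by move: k0; rewrite ltr0n => k0; rewrite ltn_Pmull.
- exact: cvg_cst.
- rewrite -[X in _ --> X](mulr0 (2 * (1 + 4 / s))); apply: cvgMr.
  exact: cvg_harmonic.
Unshelve. all: by end_near.
Qed.

Let P s w th x := w * cos (w * x + th) * gauss1 s x - s * x * sin (w * x + th) * gauss1 s x.

Let is_derive_sin_gauss s w th x :
  is_derive x 1 (fun x => sin (w * x + th) * gauss1 s x) (P s w th x).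
Proof.
have h1 := is_derive_sin_affine w th x.
have h2 := is_derive_gauss1 s x.
have := @is_deriveM _ _ _ _ _ _ _ _ h1 h2.
by move=> h; apply: (is_derive_eq h); rewrite /P /GRing.scale/=; ring.
Qed.

Let measurable_affine w th : measurable_fun setT (fun x : RR => w * x + th).
Proof. by apply: measurable_funD => //; exact: mulrl_measurable. Qed.

Lemma integrable_cos_gauss1 s w th : 0 < s ->
  mu.-integrable setT (EFin \o (fun x : RR => cos (w * x + th) * gauss1 s x)).
Proof.
move=> s0; apply: (@integrable_mul_gauss1 _ _ _ 1) => //.
  exact: measurable_fun_cos.
by move=> x; rewrite mul1r (le_trans (cos_max _))// lerDl.
Qed.

Lemma integrable_mulid_sin_gauss1 s w th : 0 < s ->
  mu.-integrable setT (EFin \o (fun x : RR => x * sin (w * x + th) * gauss1 s x)).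
Proof.
move=> s0; apply: (@integrable_mul_gauss1 _ _ _ 1) => //.
  by apply: measurable_funM => //; exact: measurable_fun_sin.
move=> x; rewrite mul1r normrM (@le_trans _ _ `|x|)//.
  by rewrite ler_piMr// sin_max.
by rewrite lerDr.
Qed.

Let integrable_P s w th : 0 < s -> mu.-integrable setT (EFin \o (P s w th : RR -> R)).
Proof.
move=> s0; have -> : (P s w th : RR -> R) =
    (fun x => w * (cos (w * x + th) * gauss1 s x) - s * (x * sin (w * x + th) * gauss1 s x)).
  by apply/funext => x; rewrite /P; ring.
apply: integrableRB; apply: integrableRZ; first exact: integrable_cos_gauss1.
exact: integrable_mulid_sin_gauss1.
Qed.

Let continuous_P s w th : continuous (P s w th).
Proof.
move=> x; have dg : {for x, continuous (gauss1 s)}.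
  by apply: differentiable_continuous; apply/derivable1_diffP; case: (is_derive_gauss1 s x).
have dc : {for x, continuous (fun x : R => cos (w * x + th))}.
  by apply: differentiable_continuous; apply/derivable1_diffP; case: (is_derive_cos_affine w th x).
have ds : {for x, continuous (fun x : R => sin (w * x + th))}.
  by apply: differentiable_continuous; apply/derivable1_diffP; case: (is_derive_sin_affine w th x).
apply: cvgB; apply: cvgM => //; apply: cvgM => //; first exact: cvg_cst.
by apply: cvgM; [exact: cvg_cst|exact: cvg_id].
Qed.

(** The fundamental theorem of calculus on [[-(k+1), k+1]] leaves boundary terms that vanish with
    the Gaussian, and dominated convergence passes to the whole line. *)
Let integral_P s w th : 0 < s -> \int[mu]_x P s w th x = 0.
Proof.
move=> s0; have iP := integrable_P w th s0.
pose F x := sin (w * x + th) * gauss1 s x.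
pose I (k : nat) : set RR := `[- k.+1%:R, k.+1%:R]%classic.
have hI k : (\int[mu]_x ((EFin \o P s w th) \_ (I k)) x = (F k.+1%:R - F (- k.+1%:R))%:E)%E.
  rewrite -integral_mkcond EFinB /I.
  rewrite -(@continuous_FTC2 _ (P s w th) F)//.
  - by rewrite -subr_gt0 opprK addr_gt0 ?ltr0n.
  - by apply: continuous_subspaceT; exact: continuous_P.
  - split.
    + by move=> x _; case: (is_derive_sin_gauss s w th x).
    + apply: cvg_at_right_filter.
      apply: differentiable_continuous; apply/derivable1_diffP.
      by case: (is_derive_sin_gauss s w th (- k.+1%:R)).
    + apply: cvg_at_left_filter.
      apply: differentiable_continuous; apply/derivable1_diffP.
      by case: (is_derive_sin_gauss s w th k.+1%:R).
  - by move=> x _; rewrite derive1E; case: (is_derive_sin_gauss s w th x).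
have mP : measurable_fun setT (EFin \o (P s w th : RR -> R)).
  by apply/measurable_EFinP; exact: integrable_measurableR iP.
have H : (F k.+1%:R - F (- k.+1%:R))%:E @[k --> \oo] --> (\int[mu]_x (P s w th x)%:E)%E.
  have -> : (fun k => (F k.+1%:R - F (- k.+1%:R))%:E) = (fun k => (\int[mu]_x ((EFin \o P s w th) \_ (I k)) x))%E.
    by apply/funext => k; rewrite hI.
  apply: (@dominated_cvg _ RR _ mu setT measurableT
    (fun k => (EFin \o (P s w th : RR -> R)) \_ (I k)) (EFin \o (P s w th : RR -> R))
    (fun x => `|(P s w th x)%:E|%E)) => //.
  - move=> k; apply/(measurable_restrictT _ _).1 => //.
      exact: measurable_itv.
    exact: measurable_funTS.
  - move=> x _; apply: cvg_near_cst; near=> k.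
    suff xI : I k x by rewrite patchE mem_set.
    rewrite /I /= in_itv/=.
    rewrite -ler_norml (@le_trans _ _ k%:R)// ?ler_nat//.
    near: k; exact: nbhs_infty_ger.
  - exact: integrable_abse.
  - by move=> k x _; rewrite patchE; case: ifP => _; rewrite ?abse0 ?abse_ge0.
have H2 : (F k.+1%:R - F (- k.+1%:R))%:E @[k --> \oo] --> 0%:E.
  apply: cvg_EFin; first by apply: nearW.
  apply/norm_cvg0P; apply: (@squeeze_cvgr _ _ _ _ (fun=> 0 : R) (fun k => 2 * gauss1 s k.+1%:R)).
  - apply: nearW => k; rewrite normr_ge0/= (le_trans (ler_normB _ _))// mulr2n mulrDl !mul1r.
    have gN : gauss1 s (- k.+1%:R) = gauss1 s k.+1%:R by rewrite /gauss1 sqrrN.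
    rewrite /F !normrM gN (ger0_norm (gauss1_ge0 _ _)).
    by rewrite lerD// ler_piMl ?gauss1_ge0// sin_max.
  - exact: cvg_cst.
  - rewrite -[X in _ --> X](mulr0 2); apply: cvgMr.
    rewrite (cvg_shiftS (fun k => gauss1 s k%:R)).
    exact: gauss1_natr_cvg0.
by rewrite /Rintegral; have /= -> := @cvg_unique _ _ _ _ _ _ H H2.
Unshelve. all: by end_near.
Qed.

Lemma integral_mulid_sin_gauss1 s w th : 0 < s ->
  \int[mu]_x (x * sin (w * x + th) * gauss1 s x) =
  w / s * \int[mu]_x (cos (w * x + th) * gauss1 s x).
Proof.
move=> s0; have := integral_P w th s0.
have -> : P s w th =
    (fun x => w * (cos (w * x + th) * gauss1 s x) - s * (x * sin (w * x + th) * gauss1 s x)).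
  by apply/funext => x; rewrite /P; ring.
have i1 := integrable_cos_gauss1 w th s0.
have i2 := integrable_mulid_sin_gauss1 w th s0.
rewrite RintegralB//; [|exact: integrableRZ|exact: integrableRZ].
rewrite RintegralZl// RintegralZl// => /eqP; rewrite subr_eq0 => /eqP E.
by rewrite mulrAC E mulrAC divff ?mul1r// gt_eqF.
Qed.

Let G s th w := \int[mu]_x (cos (w * x + th) * gauss1 s x).

(** Differentiation under the integral is dominated by [|x| * gauss1 s x] uniformly in the
    frequency, so any open interval around [w] would do. *)
Let is_derive_G s th w : 0 < s -> is_derive w 1 (G s th) (- (w / s * G s th w)).
Proof.
move=> s0.
pose f (w : R) (x : RR) := cos (w * x + th) * gauss1 s x.
have df (v x : R) : is_derive v 1 (f ^~ x) (- (x * sin (v * x + th) * gauss1 s x)).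
  have h := is_derive_cos_affine x th v.
  have h' : is_derive v 1 (fun v => gauss1 s x *: cos (x * v + th))
     (gauss1 s x *: - (x * sin (x * v + th))) by exact: is_deriveZ.
  have <- : (fun v => gauss1 s x *: cos (x * v + th)) = f ^~ x.
    by apply/funext => u; rewrite /f /GRing.scale /= mulrC (mulrC x).
  by apply: (is_derive_eq h'); rewrite /GRing.scale /= [v * x]mulrC; ring.
have d1E v x : partial1of2 f v x = - (x * sin (v * x + th) * gauss1 s x).
  by rewrite partial1of2E; case: (df v x).
have Iw : (`]w - 1, w + 1[%classic : set R) w by rewrite /= in_itv/= ltrBlDr ltrDl ltr01.
have ifw v : mu.-integrable setT (EFin \o f v) by exact: integrable_cos_gauss1.
have iG : mu.-integrable setT (EFin \o (fun x : RR => `|x| * gauss1 s x)).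
  apply: (@integrable_mul_gauss1 _ _ _ 1) => //.
  by move=> x; rewrite mul1r normr_id lerDr.
have Gub v x : (`]w - 1, w + 1[%classic : set R) v -> [set: RR] x ->
    `|partial1of2 f v x| <= `|x| * gauss1 s x.
  move=> _ _; rewrite d1E normrN !normrM (ger0_norm (gauss1_ge0 _ _)).
  by rewrite ler_wpM2r ?gauss1_ge0// ler_piMr// sin_max.
have G0 (x : RR) : 0 <= `|x| * gauss1 s x by rewrite mulr_ge0 ?gauss1_ge0.
have df' v x : (`]w - 1, w + 1[%classic : set R) v -> [set: RR] x -> derivable (f ^~ x) v 1.
  by move=> _ _; case: (df v x).
have D1 := @derivable_under_integral _ _ _ mu f setT measurableT w (w - 1) (w + 1) Iw
  (fun v _ => ifw v) df' _ G0 iG Gub.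
have D2 := @differentiation_under_integral _ _ _ mu f setT measurableT w (w - 1) (w + 1) Iw
  (fun v _ => ifw v) df' _ G0 iG Gub.
apply: DeriveDef => //; rewrite -derive1E D2.
under eq_Rintegral do rewrite d1E -mulN1r.
rewrite RintegralZl//; last exact: integrable_mulid_sin_gauss1.
by rewrite integral_mulid_sin_gauss1// mulN1r.
Qed.

(* By [integral_P], obtained by integrating the derivative of
   [sin (w x + th) * gauss1 s x], the integral as a function [G] of [w] satisfies
   the equation [G' = - (w / s) G]. *)
Lemma integral_cos_gauss1 s w th : 0 < s ->
  \int[mu]_x (cos (w * x + th) * gauss1 s x) =
  cos th * (Num.sqrt (2 * pi / s) * gauss1 s^-1 w).
Proof.
(* The second factor is the integrating factor of the equation: [H] has derivative 0, and its value
   is read off at frequency 0. *)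
move=> s0; pose H v := G s th v * expR ((s * 2)^-1 * v ^+ 2).
have dH (v : R) : is_derive v 1 H 0.
  have h := @is_deriveM _ _ _ _ _ _ _ _ (is_derive_G th v s0)
    (is_derive_expR_sqr (s * 2)^-1 v).
  apply: (is_derive_eq h); rewrite /GRing.scale/= invfM; field.
  by rewrite gt_eqF.
have := @is_derive_0_is_cst _ H w 0 dH.
rewrite /H expr0n/= mulr0 expR0 mulr1.
have -> : G s th 0 = cos th * Num.sqrt (2 * pi / s).
  rewrite /G; under eq_Rintegral do rewrite mul0r add0r.
  rewrite RintegralZl//; last exact: integrable_gauss1_0.
  congr (_ * _); rewrite /Rintegral.
  rewrite (_ : integral _ _ _ = \int[mu]_x (gauss1 s (x - 0))%:E)%E; last first.
    by apply: eq_integral => x _; rewrite subr0.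
  by rewrite integral_gauss1.
move=> E; rewrite mulrA -E -/(G s th w) -mulrA -expRD -[LHS]mulr1; congr (_ * _).
rewrite (_ : _ + _ = 0) ?expR0//; field.
by rewrite gt_eqF.
Qed.

End gaussian_fourier_1d.

(** * Integration on R^n with the first coordinate split off *)

Section integral_Rn.
Context {R : realType}.
Local Notation RR := (measurableTypeR R).

Lemma tnth_cons_pairS n (a : R) (x : Rn R n) (i : 'I_n) :
  tnth (cons_pair (a, x)) (lift ord0 i) = tnth x i.
Proof. by rewrite tnthS; congr tnth; exact/val_inj. Qed.

Lemma cons_pair_eta n (x : Rn R n.+1) : exists a y, x = cons_pair (a, y).
Proof. by case: (tupleP x) => a y; exists a, y; exact/val_inj. Qed.

Lemma integral_lebesgueRn0 (f : Rn R 0 -> R) : measurable_fun setT f ->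
  (\int[lebesgueRn R 0]_x (f x)%:E = (f [tuple])%:E)%E.
Proof.
move=> mf; rewrite [in LHS]/= integral_dirac//; last exact/measurable_EFinP.
by rewrite diracT mul1e.
Qed.

Lemma integrable_cons_pair n (f : Rn R n.+1 -> R) :
  (lebesgueRn R n.+1).-integrable setT (EFin \o f) ->
  ((@lebesgue_measure R) \x lebesgueRn R n)%E.-integrable setT
     (EFin \o (fun p => f (cons_pair p))).
Proof.
move=> fi; have mf := integrable_measurableR fi.
apply/integrableP; split.
  by apply/measurable_EFinP; apply: measurableT_comp => //; exact: measurable_cons_pair.
move/integrableP : fi => [_]; rewrite [in X in (X < _)%E -> _]/= /lebesgue_cons.
rewrite (@ge0_integral_pushforward _ _ _ _ _ _ measurable_cons_pair)//.
by apply/measurable_EFinP; apply: measurableT_comp.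
Qed.

Lemma ge0_integral_cons n (f : Rn R n.+1 -> R) :
  measurable_fun setT f -> (forall x, 0 <= f x) ->
  (\int[lebesgueRn R n.+1]_x (f x)%:E =
   \int[lebesgue_measure]_a \int[lebesgueRn R n]_x (f (cons_pair (a, x)))%:E)%E.
Proof.
move=> mf f0; rewrite [in LHS]/= /lebesgue_cons.
rewrite (@ge0_integral_pushforward _ _ _ _ _ _ measurable_cons_pair)//; last 2 first.
  exact/measurable_EFinP.
  by move=> x _; rewrite lee_fin.
rewrite fubini_tonelli1//.
  by apply/measurable_EFinP; apply: measurableT_comp => //; exact: measurable_cons_pair.
by move=> x; rewrite lee_fin.
Qed.

Lemma Rintegral_cons n (f : Rn R n.+1 -> R) :
  (lebesgueRn R n.+1).-integrable setT (EFin \o f) ->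
  (\int[lebesgueRn R n.+1]_x (f x)%:E =
   \int[lebesgue_measure]_a \int[lebesgueRn R n]_x (f (cons_pair (a, x)))%:E)%E.
Proof.
move=> fi; have mf := integrable_measurableR fi.
have := integrable_cons_pair fi => fi'.
rewrite [in LHS]/= /lebesgue_cons.
rewrite (integral_pushforward measurable_cons_pair)//; last exact/measurable_EFinP.
by rewrite -integral12_prod_meas1.
Qed.

End integral_Rn.

Section measurable_Rn.
Context {R : realType} (d : measure_display) (T : measurableType d) (n : nat).
Implicit Types f g : T -> Rn R n.

Lemma measurable_fun_tnth f (i : 'I_n) : measurable_fun setT f ->
  measurable_fun setT (fun x : T => tnth (f x) i : measurableTypeR R).
Proof. by move=> mf; apply: (measurableT_comp (measurable_tnth i)). Qed.

Lemma measurable_fun_dotRn f g : measurable_fun setT f -> measurable_fun setT g ->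
  measurable_fun setT (fun x : T => dotRn (f x) (g x)).
Proof.
move=> mf mg; apply: measurable_sum => i; apply: measurable_funM.
  exact: measurable_fun_tnth.
exact: measurable_fun_tnth.
Qed.

Definition subRn (x y : Rn R n) : Rn R n :=
  [tuple (tnth x i : R) - (tnth y i : R) | i < n].

Lemma measurable_fun_subRn f g : measurable_fun setT f -> measurable_fun setT g ->
  measurable_fun setT (fun x : T => subRn (f x) (g x)).
Proof.
move=> mf mg; apply/measurable_fun_tnthP => i.
rewrite (_ : _ \o _ = fun x => (tnth (f x) i : R) - (tnth (g x) i : R)).
  by apply: measurable_funB; exact: measurable_fun_tnth.
by apply/funext => x /=; rewrite tnth_mktuple.
Qed.

End measurable_Rn.

(** * Gaussians on R^n and their transforms *)

Section gaussian_Rn.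
Context {R : realType}.
Local Notation RR := (measurableTypeR R).
Implicit Types (n : nat) (s th : R).

Definition gaussRn n s (x : Rn R n) : R := expR (- (s / 2 * dotRn x x)).

Definition gauss_mass n s : R := Num.sqrt (2 * pi / s) ^+ n.

Lemma gauss_mass_gt0 n s : 0 < s -> 0 < gauss_mass n s.
Proof. by move=> s0; rewrite exprn_gt0// sqrtr_gt0 !mulr_gt0 ?invr_gt0// pi_gt0. Qed.

Lemma dotRn_cons n (a b : R) (x y : Rn R n) :
  dotRn (cons_pair (a, x)) (cons_pair (b, y)) = a * b + dotRn x y.
Proof.
rewrite /dotRn big_ord_recl; congr (_ + _).
by apply: eq_bigr => i _; rewrite !tnth_cons_pairS.
Qed.

Lemma dotRnC n (x y : Rn R n) : dotRn x y = dotRn y x.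
Proof. by apply: eq_bigr => i _; rewrite mulrC. Qed.

Lemma dotRnBl n (x y z : Rn R n) : dotRn (subRn x y) z = dotRn x z - dotRn y z.
Proof.
rewrite /dotRn -sumrB; apply: eq_bigr => i _.
by rewrite tnth_mktuple mulrBl.
Qed.

Lemma dotRn_sub_sym n (x y : Rn R n) :
  dotRn (subRn x y) (subRn x y) = dotRn (subRn y x) (subRn y x).
Proof. by apply: eq_bigr => i _; rewrite !tnth_mktuple -opprB mulrNN. Qed.

Lemma subRn_cons n (a b : R) (x y : Rn R n) :
  subRn (cons_pair (a, x)) (cons_pair (b, y)) = cons_pair (a - b, subRn x y).
Proof.
apply/eq_from_tnth => i; rewrite tnth_mktuple.
have [->|[j ->]] : i = ord0 \/ exists j, i = lift ord0 j.
  by case: (unliftP ord0 i) => [j ->|->]; [right; exists j|left].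
- by [].
- by rewrite !tnth_cons_pairS tnth_mktuple.
Qed.

Lemma gaussRn_cons n s (a : R) (x : Rn R n) :
  gaussRn s (cons_pair (a, x)) = gauss1 s a * gaussRn s x.
Proof. by rewrite /gaussRn dotRn_cons mulrDr opprD expRD /gauss1 expr2. Qed.

Lemma gaussRn_ge0 n s (x : Rn R n) : 0 <= gaussRn s x.
Proof. exact: expR_ge0. Qed.

Lemma gaussRn_subC n s (x y : Rn R n) : gaussRn s (subRn x y) = gaussRn s (subRn y x).
Proof. by rewrite /gaussRn dotRn_sub_sym. Qed.

Lemma measurable_fun_gaussRn d (T : measurableType d) n s (f : T -> Rn R n) :
  measurable_fun setT f -> measurable_fun setT (fun x : T => gaussRn s (f x)).
Proof.
move=> mf; apply: (measurableT_comp (@measurable_realfun.measurable_expR R)).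
apply: measurable_funN; apply: measurable_funM => //.
exact: measurable_fun_dotRn.
Qed.

Lemma integral_gaussRn_sub n s (y : Rn R n) : 0 < s ->
  (\int[lebesgueRn R n]_x (gaussRn s (subRn x y))%:E = (gauss_mass n s)%:E)%E.
Proof.
move=> s0; elim: n y => [y|n IH y].
  rewrite integral_lebesgueRn0; last first.
    by apply: measurable_fun_gaussRn; apply: measurable_fun_subRn.
  by rewrite /gaussRn /dotRn big_ord0 mulr0 oppr0 expR0.
have [b [z ->]] := cons_pair_eta y.
rewrite ge0_integral_cons; last 2 first.
- by apply: measurable_fun_gaussRn; apply: measurable_fun_subRn.
- by move=> x; exact: gaussRn_ge0.
under eq_integral => a _.
  under eq_integral do rewrite subRn_cons gaussRn_cons EFinM.
  rewrite ge0_integralZl//; last 3 first.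
  - by apply/measurable_EFinP/measurable_fun_gaussRn; exact: measurable_fun_subRn.
  - by move=> x _; rewrite lee_fin gaussRn_ge0.
  - by rewrite lee_fin gauss1_ge0.
  rewrite IH.
  over.
rewrite ge0_integralZr//=; last 3 first.
- apply/measurable_EFinP/(measurableT_comp (measurable_gauss1 s)).
  exact: measurable_funB.
- by move=> x _; rewrite lee_fin gauss1_ge0.
- by rewrite lee_fin ltW// gauss_mass_gt0.
by rewrite integral_gauss1// -EFinM /gauss_mass exprS.
Qed.

Lemma integrable_gaussRn_sub n s (y : Rn R n) : 0 < s ->
  (lebesgueRn R n).-integrable setT (EFin \o (fun x => gaussRn s (subRn x y))).
Proof.
move=> s0; apply: integrableR_ge0P.
- by apply: measurable_fun_gaussRn; apply: measurable_fun_subRn.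
- by move=> x; exact: gaussRn_ge0.
- by rewrite integral_gaussRn_sub// ltry.
Qed.

Definition zeroRn n : Rn R n := [tuple 0 | i < n].

Lemma subRn0 n (x : Rn R n) : subRn x (zeroRn n) = x.
Proof. by apply/eq_from_tnth => i; rewrite !tnth_mktuple subr0. Qed.

Lemma integrable_gaussRn n s : 0 < s ->
  (lebesgueRn R n).-integrable setT (EFin \o (gaussRn s : Rn R n -> R)).
Proof.
move=> /(integrable_gaussRn_sub (zeroRn n)).
by congr (_.-integrable _ _); apply/funext => x /=; rewrite subRn0.
Qed.

Lemma measurable_cos_dotRn n (w : Rn R n) th :
  measurable_fun setT (fun x : Rn R n => cos (dotRn w x + th)).
Proof.
apply: measurable_fun_cos; apply: measurable_funD => //.
exact: measurable_fun_dotRn.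
Qed.

Lemma integrable_cos_gaussRn n s (w : Rn R n) th : 0 < s ->
  (lebesgueRn R n).-integrable setT (EFin \o (fun x => cos (dotRn w x + th) * gaussRn s x)).
Proof.
move=> s0; apply: integrableR_le (integrable_gaussRn n s0).
  apply: measurable_funM; first exact: measurable_cos_dotRn.
  exact: measurable_fun_gaussRn.
by move=> x; rewrite normrM (ger0_norm (gaussRn_ge0 _ _)) ler_piMl ?gaussRn_ge0// cos_max.
Qed.

(** The phase [th] makes the induction close: with the first coordinate frozen at [a], the remaining
    integral has phase [b * a + th]. *)
Lemma integral_cos_gaussRn n s (w : Rn R n) th : 0 < s ->
  \int[lebesgueRn R n]_x (cos (dotRn w x + th) * gaussRn s x) =
  cos th * (gauss_mass n s * gaussRn s^-1 w).
Proof.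
move=> s0; elim: n w th => [w th|n IH w th].
  rewrite /Rintegral integral_lebesgueRn0; last first.
    by apply: integrable_measurableR (integrable_cos_gaussRn w th s0).
  rewrite /= /gaussRn /dotRn !big_ord0.
  by rewrite !mulr0 oppr0 expR0 add0r /gauss_mass expr0 mul1r.
have [b [z ->]] := cons_pair_eta w.
rewrite /Rintegral Rintegral_cons; last exact: integrable_cos_gaussRn.
under eq_integral => a _.
  under eq_integral => x _.
    rewrite dotRn_cons gaussRn_cons mulrCA (addrC (b * a)) -addrA.
    over.
  rewrite -EFin_Rintegral; last by apply: integrableRZ; exact: integrable_cos_gaussRn.
  rewrite RintegralZl//; last exact: integrable_cos_gaussRn.
  rewrite IH mulrA [_ * cos _]mulrC.
  over.
rewrite -[LHS]/(Rintegral _ _ _).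
rewrite RintegralZr//; last exact: integrable_cos_gauss1.
by rewrite integral_cos_gauss1// gaussRn_cons /gauss_mass exprS; ring.
Qed.

End gaussian_Rn.

(** * The Plancherel inequality for Gaussian-damped functions *)

Section tensor.
Context d1 d2 (T1 : measurableType d1) (T2 : measurableType d2) (R : realType).
Variables (m1 : {sigma_finite_measure set T1 -> \bar R}).
Variables (m2 : {sigma_finite_measure set T2 -> \bar R}).

Lemma integrableR_tensor (f : T1 -> R) (g : T2 -> R) :
  m1.-integrable setT (EFin \o f) -> m2.-integrable setT (EFin \o g) ->
  (m1 \x m2)%E.-integrable setT (EFin \o (fun z => f z.1 * g z.2)).
Proof.
move=> fi gi; have mf := integrable_measurableR fi; have mg := integrable_measurableR gi.
have mz : measurable_fun setT (fun z : T1 * T2 => f z.1 * g z.2).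
  by apply: measurable_funM; [apply: (measurableT_comp mf)|apply: (measurableT_comp mg)].
apply/integrable12ltyP; first exact/measurable_EFinP.
have ig : (\int[m2]_y `|(g y)%:E| < +oo)%E by case/integrableP : gi.
under eq_integral => x _.
  under eq_integral do rewrite /= normrM EFinM.
  rewrite ge0_integralZl//; last by apply/measurable_EFinP; exact: measurableT_comp.
  over.
rewrite ge0_integralZr//; last 2 first.
- by apply/measurable_EFinP; exact: measurableT_comp.
- by apply: integral_ge0.
rewrite lte_mul_pinfty//.
- by apply: integral_ge0.
- case/integrableP : fi => _ fi; rewrite ge0_fin_numE//.
  by apply: integral_ge0.
Qed.

(** Measurability comes from the Tonelli integrals of the positive and negative parts, composed with
    [fine]; a section that is not integrable receives whatever value [fine] assigns. *)
Lemma measurable_Rintegral_param (f : T1 * T2 -> R) : measurable_fun setT f ->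
  measurable_fun setT (fun x : T1 => \int[m2]_y f (x, y)).
Proof.
move=> mf; have mf' : measurable_fun setT (EFin \o f) by exact/measurable_EFinP.
rewrite (_ : (fun x => _) = fun x => fine
   (fubini_F m2 (EFin \o f)^\+ x - fubini_F m2 (EFin \o f)^\- x)%E); last first.
  apply/funext => x; rewrite /Rintegral integralE.
  by congr (fine (_ - _)%E); apply: eq_integral => y _; rewrite ?funeposE ?funenegE.
apply: (measurableT_comp (fine_measurable measurableT)); apply: emeasurable_funB.
  by apply: measurable_fun_fubini_tonelli_F => //; exact: measurable_funepos.
by apply: measurable_fun_fubini_tonelli_F => //; exact: measurable_funeneg.
Qed.

(** The canonical sigma-finite structure of [m1 \x m2] is the one for
    subprobabilities, hence this copy. *)
Definition prod_measure : set (T1 * T2) -> \bar R := (m1 \x m2)%E.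

Let prod_measure0 : (prod_measure set0 = 0)%E. Proof. exact: measure0. Qed.

Let prod_measure_ge0 A : (0 <= prod_measure A)%E. Proof. exact: measure_ge0. Qed.

Let prod_measure_sigma_additive : semi_sigma_additive prod_measure.
Proof. exact: measure_semi_sigma_additive. Qed.

HB.instance Definition _ := isMeasure.Build _ _ _
  prod_measure prod_measure0 prod_measure_ge0 prod_measure_sigma_additive.

Let prod_measure_sigma_finite : sigma_finite setT prod_measure.
Proof.
have /sigma_finiteP[F [TF ndF Foo]] := sigma_finiteT m1.
have /sigma_finiteP[G [TG ndG Goo]] := sigma_finiteT m2.
exists (fun k => F k `*` G k).
  apply/esym; rewrite -subTset => -[x y] _.
  have [k _ Fk] : (\bigcup_i F i) x by rewrite -TF.
  have [l _ Gl] : (\bigcup_i G i) y by rewrite -TG.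
  exists (maxn k l) => //; split.
  - by move: Fk; exact/subsetPset/ndF/leq_maxl.
  - by move: Gl; exact/subsetPset/ndG/leq_maxr.
move=> k; have [mF Fk] := Foo k; have [mG Gk] := Goo k.
split; first exact: measurableX.
by rewrite /prod_measure product_measure1E// lte_mul_pinfty// ge0_fin_numE.
Qed.

HB.instance Definition _ := Measure_isSigmaFinite.Build _ _ _
  prod_measure prod_measure_sigma_finite.

Lemma integral_prod_measure (f : T1 * T2 -> \bar R) :
  (\int[prod_measure]_z f z = \int[m1 \x m2]_z f z)%E.
Proof. exact: eq_measure_integral. Qed.

Lemma integrable_prod_measure (f : T1 * T2 -> \bar R) :
  prod_measure.-integrable setT f <-> (m1 \x m2)%E.-integrable setT f.
Proof. by split=> /integrableP[mf fi]; apply/integrableP; split => //;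
  move: fi; rewrite integral_prod_measure. Qed.

End tensor.

Section L2_real.
Context d (T : measurableType d) (R : realType) (mu : {measure set T -> \bar R}).
Implicit Types p q : T -> R.

Definition L2R p :=
  measurable_fun setT p /\ (\int[mu]_x (p x ^+ 2)%:E < +oo)%E.

Lemma L2R_integrable_sqr p : L2R p ->
  mu.-integrable setT (EFin \o (fun x => p x ^+ 2)).
Proof.
move=> [mp p2]; apply: integrableR_ge0P => //; first exact: measurable_funX.
by move=> x; exact: sqr_ge0.
Qed.

Lemma integrable_L2RM p q : L2R p -> L2R q ->
  mu.-integrable setT (EFin \o (fun x => p x * q x)).
Proof.
move=> p2 q2; apply: integrableR_le (integrableRD (L2R_integrable_sqr p2) (L2R_integrable_sqr q2)).
  by apply: measurable_funM; [case: p2|case: q2].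
move=> x; rewrite ler_norml; have := sqr_ge0 (p x + q x); have := sqr_ge0 (p x - q x).
have := sqr_ge0 (p x); have := sqr_ge0 (q x) => h1 h2 h3 h4.
by apply/andP; split; nra.
Qed.

Lemma L2R_le p q : measurable_fun setT p -> (forall x, p x ^+ 2 <= q x ^+ 2) ->
  L2R q -> L2R p.
Proof.
move=> mp pq [mq q2]; split => //; apply: le_lt_trans q2.
apply: ge0_le_integral => //.
- by move=> x _; rewrite lee_fin sqr_ge0.
- by apply/measurable_EFinP; exact: measurable_funX.
- by apply/measurable_EFinP; exact: measurable_funX.
- by move=> x _; rewrite lee_fin.
Qed.

Lemma L2RZ c p : L2R p -> L2R (fun x => c * p x).
Proof.
move=> p2; split; first by apply: measurable_funM => //; case: p2.
apply: integrableR_ltoo; first by move=> x; exact: sqr_ge0.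
rewrite (_ : (fun x => _) = (fun x => c ^+ 2 * p x ^+ 2)).
  by apply: integrableRZ; exact: L2R_integrable_sqr.
by apply/funext => x; rewrite exprMn.
Qed.

Lemma L2RD p q : L2R p -> L2R q -> L2R (fun x => p x + q x).
Proof.
move=> p2 q2; split; first by apply: measurable_funD; [case: p2|case: q2].
apply: integrableR_ltoo; first by move=> x; exact: sqr_ge0.
apply: integrableR_le (integrableRD (integrableRZ 2 (L2R_integrable_sqr p2))
    (integrableRZ 2 (L2R_integrable_sqr q2))).
  by apply: measurable_funX; apply: measurable_funD; [case: p2|case: q2].
move=> x; rewrite ger0_norm ?sqr_ge0// -subr_ge0.
by rewrite (_ : _ - _ = (p x - q x) ^+ 2) ?sqr_ge0//; ring.
Qed.

Lemma L2RB p q : L2R p -> L2R q -> L2R (fun x => p x - q x).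
Proof.
move=> p2 q2; have := L2RD p2 (L2RZ (-1) q2).
by congr L2R; apply/funext => x; rewrite mulN1r.
Qed.

End L2_real.

Lemma gauss_massV {R : realType} n (s : R) : 0 < s ->
  gauss_mass n s * gauss_mass n s^-1 = (2 * pi) ^+ n.
Proof.
move=> s0; rewrite /gauss_mass -exprMn -sqrtrM ?invrK; last first.
  by rewrite !mulr_ge0 ?invr_ge0 ?pi_ge0// ltW.
rewrite (_ : 2 * pi / s * (2 * pi * s) = (2 * pi) ^+ 2); last by field; rewrite gt_eqF.
by rewrite sqrtr_sqr ger0_norm// mulr_ge0// pi_ge0.
Qed.

Section fourier_energy.
Context {R : realType} {n : nat}.
Local Notation mu := (lebesgueRn R n).
Local Notation mu2 := (prod_measure mu mu).

Lemma dotRn_ge0 (x : Rn R n) : 0 <= dotRn x x.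
Proof. by apply: sumr_ge0 => i _; rewrite -expr2 sqr_ge0. Qed.

Lemma gaussRn_le1 s (x : Rn R n) : 0 <= s -> gaussRn s x <= 1.
Proof.
move=> s0; rewrite -expR0 ler_expR oppr_le0 mulr_ge0 ?dotRn_ge0//.
by rewrite divr_ge0.
Qed.

Lemma gaussRn_cvg1 (x : Rn R n) :
  gaussRn (k.+1%:R^-1) x @[k --> \oo] --> (1 : R).
Proof.
have h : - (k.+1%:R^-1 / 2 * dotRn x x) @[k --> \oo] --> (- 0 : R); last first.
  rewrite -[X in _ --> X](@expR0 R) -[in X in _ --> X]oppr0.
  exact: (@cvg_comp _ _ _ _ expR _ _ _ h (@continuous_expR R (- 0))).
apply: cvgN; rewrite -[X in _ --> X](mul0r (dotRn x x)).
apply: cvgMl; rewrite -[X in _ --> X](mul0r (2^-1)); apply: cvgMl.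
exact: cvg_harmonic.
Qed.

(** The cutoffs with [s = (k+1)^-1] increase to 1, so monotone convergence removes them from a bound
    that is uniform in [s]. *)
Lemma ge0_integral_le_gauss_cutoff (Q : Rn R n -> R) B :
  measurable_fun setT Q -> (forall x, 0 <= Q x) ->
  (forall s, 0 < s -> (\int[mu]_x (gaussRn s x * Q x)%:E <= B)%E) ->
  (\int[mu]_x (Q x)%:E <= B)%E.
Proof.
move=> mQ Q0 QB.
have H : (\int[mu]_x (gaussRn (k.+1%:R^-1) x * Q x)%:E @[k --> \oo] -->
    \int[mu]_x (Q x)%:E)%E.
  rewrite (_ : (\int[mu]_x (Q x)%:E = \int[mu]_x
      (limn (fun k => (gaussRn (k.+1%:R^-1) x * Q x)%:E)))%E); last first.
    apply: eq_integral => x _; apply/esym/cvg_lim => //.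
    apply: cvg_EFin; first exact: nearW.
    rewrite -[X in _ --> X]mul1r; apply: cvgMl; exact: gaussRn_cvg1.
  apply: (@cvg_monotone_convergence _ _ _ mu setT measurableT
    (fun k x => (gaussRn (k.+1%:R^-1) x * Q x)%:E)).
  - move=> k; apply/measurable_EFinP; apply: measurable_funM => //.
    exact: measurable_fun_gaussRn.
  - by move=> k x _; rewrite lee_fin mulr_ge0// gaussRn_ge0.
  - move=> x _ k l kl; rewrite lee_fin ler_wpM2r//.
    rewrite ler_expR lerN2 ler_wpM2r ?dotRn_ge0// ler_wpM2r//.
    by rewrite lef_pV2 ?posrE ?ltr0n// ler_nat.
rewrite -(cvg_lim _ H)//; apply: lime_le; first by apply/cvg_ex; eexists; exact: H.
by apply: nearW => k; apply: QB; rewrite invr_gt0.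
Qed.

Variable F : Rn R n -> R.
Hypothesis Fi : mu.-integrable setT (EFin \o F).
Hypothesis F2 : L2R mu F.

Let mF : measurable_fun setT F. Proof. by case: F2. Qed.

(** Together with [sin_transform]: the real and imaginary parts of the integral of
    [F xi * exp (i x.xi)], for real [F]. *)
Definition cos_transform (x : Rn R n) := \int[mu]_xi (F xi * cos (dotRn x xi)).
Definition sin_transform (x : Rn R n) := \int[mu]_xi (F xi * sin (dotRn x xi)).

Let measurable_cs d (T : measurableType d) (f g : T -> Rn R n) :
  measurable_fun setT f -> measurable_fun setT g ->
  measurable_fun setT (fun x : T => cos (dotRn (f x) (g x))) /\
  measurable_fun setT (fun x : T => sin (dotRn (f x) (g x))).
Proof.
move=> mf mg; split; [apply: measurable_fun_cos|apply: measurable_fun_sin];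
  exact: measurable_fun_dotRn.
Qed.

Let integrable_Fcos x : mu.-integrable setT (EFin \o (fun xi => F xi * cos (dotRn x xi))).
Proof.
apply: integrableR_le (integrable_abse Fi).
  by apply: measurable_funM => //; case: (@measurable_cs _ _ (fun=> x) id).
by move=> xi /=; rewrite normrM ler_piMr// cos_max.
Qed.

Let integrable_Fsin x : mu.-integrable setT (EFin \o (fun xi => F xi * sin (dotRn x xi))).
Proof.
apply: integrableR_le (integrable_abse Fi).
  by apply: measurable_funM => //; case: (@measurable_cs _ _ (fun=> x) id).
by move=> xi /=; rewrite normrM ler_piMr// sin_max.
Qed.

Lemma measurable_cos_transform : measurable_fun setT cos_transform.
Proof.
have h : measurable_fun setT (fun z : Rn R n * Rn R n => F z.2 * cos (dotRn z.1 z.2)).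
  apply: measurable_funM; first exact: (measurableT_comp mF).
  by case: (@measurable_cs _ _ fst snd).
exact: (measurable_Rintegral_param mu h).
Qed.

Lemma measurable_sin_transform : measurable_fun setT sin_transform.
Proof.
have h : measurable_fun setT (fun z : Rn R n * Rn R n => F z.2 * sin (dotRn z.1 z.2)).
  apply: measurable_funM; first exact: (measurableT_comp mF).
  by case: (@measurable_cs _ _ fst snd).
exact: (measurable_Rintegral_param mu h).
Qed.

Let G (z : Rn R n * Rn R n) := F z.1 * F z.2.

Let integrable_G : mu2.-integrable setT (EFin \o G).
Proof. by apply/integrable_prod_measure; exact: integrableR_tensor. Qed.

Let K (x : Rn R n) (z : Rn R n * Rn R n) := G z * cos (dotRn x (subRn z.1 z.2)).

Let integrable_K x : mu2.-integrable setT (EFin \o K x).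
Proof.
apply: integrableR_le (integrable_abse integrable_G).
  apply: measurable_funM; first exact: integrable_measurableR integrable_G.
  apply: measurable_fun_cos; apply: measurable_fun_dotRn => //.
  exact: measurable_fun_subRn.
by move=> z /=; rewrite normrM ler_piMr// cos_max.
Qed.

(** The square of an integral is a double integral, and [cosB] merges the two products into one
    cosine of [x.(xi - eta)]. *)
Let energyE x :
  ((cos_transform x ^+ 2 + sin_transform x ^+ 2)%:E = \int[mu2]_z (K x z)%:E)%E.
Proof.
rewrite integral_prod_measure -integral12_prod_meas1//; last first.
  by apply/integrable_prod_measure; exact: integrable_K.
under eq_integral => xi _.
  rewrite /fubini_F/=; under eq_integral => eta _.
    rewrite (_ : K x (xi, eta) =
      (F xi * cos (dotRn x xi)) * (F eta * cos (dotRn x eta)) +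
      (F xi * sin (dotRn x xi)) * (F eta * sin (dotRn x eta))); last first.
      by rewrite /K /G /= dotRnC dotRnBl cosB (dotRnC xi) (dotRnC eta); ring.
    over.
  rewrite -EFin_Rintegral; last by apply: integrableRD; exact: integrableRZ.
  rewrite RintegralD//; [|exact: integrableRZ|exact: integrableRZ].
  rewrite !RintegralZl// -/(cos_transform x) -/(sin_transform x).
  rewrite (mulrC _ (cos_transform x)) (mulrC _ (sin_transform x)).
  over.
rewrite -EFin_Rintegral; last by apply: integrableRD; exact: integrableRZ.
rewrite RintegralD//; [|exact: integrableRZ|exact: integrableRZ].
by rewrite !RintegralZl// -/(cos_transform x) -/(sin_transform x) !expr2.
Qed.

(* Expanding the square and integrating in [x] first leaves a double integral of
   [F xi * F eta] against the Gaussian kernel in [xi - eta], bounded by Schur's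
   test. *)
Lemma gauss_energy_le s : 0 < s ->
  (\int[mu]_x (gaussRn s x * (cos_transform x ^+ 2 + sin_transform x ^+ 2))%:E <=
   ((2 * pi) ^+ n)%:E * \int[mu]_xi (F xi ^+ 2)%:E)%E.
Proof.
move=> s0; under eq_integral => x _.
  rewrite EFinM energyE -integralZl//; last exact: integrable_K.
  over.
have iH : (mu \x mu2)%E.-integrable setT (EFin \o
    (fun w : Rn R n * (Rn R n * Rn R n) => gaussRn s w.1 * K w.1 w.2)).
  have := @integrableR_tensor _ _ _ _ _ mu mu2 _ _ (integrable_gaussRn n s0) integrable_G.
  move=> /integrable_abse; apply: integrableR_le.
    apply: measurable_funM; first exact: measurable_fun_gaussRn.
    apply: measurable_funM.
      by apply: (measurableT_comp (f := G)); first exact: integrable_measurableR integrable_G.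
    apply: measurable_fun_cos; apply: measurable_fun_dotRn => //.
    by apply: measurable_fun_subRn; exact: measurableT_comp.
  by move=> w /=; rewrite !normrM ler_wpM2l// ler_piMr// cos_max.
rewrite (Fubini iH).
under eq_integral => z _.
  under eq_integral => x _.
    rewrite /= /K mulrCA mulrA -(mulrA (G z)) [gaussRn s x * _]mulrC dotRnC -[dotRn _ _]addr0.
    over.
  rewrite -EFin_Rintegral; last by apply: integrableRZ; exact: integrable_cos_gaussRn.
  rewrite RintegralZl//; last exact: integrable_cos_gaussRn.
  rewrite integral_cos_gaussRn// cos0 mul1r.
  over.
pose g1 (z : Rn R n * Rn R n) := F z.1 ^+ 2 * gaussRn s^-1 (subRn z.1 z.2).
pose g2 (z : Rn R n * Rn R n) := F z.2 ^+ 2 * gaussRn s^-1 (subRn z.1 z.2).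
have mg : measurable_fun setT (fun z : Rn R n * Rn R n => gaussRn s^-1 (subRn z.1 z.2)).
  by apply: measurable_fun_gaussRn; exact: measurable_fun_subRn.
have mg1 : measurable_fun setT g1.
  by apply: measurable_funM => //; apply: measurable_funX; exact: (measurableT_comp mF).
have mg2 : measurable_fun setT g2.
  by apply: measurable_funM => //; apply: measurable_funX; exact: (measurableT_comp mF).
have g10 z : 0 <= g1 z by rewrite mulr_ge0 ?sqr_ge0 ?gaussRn_ge0.
have g20 z : 0 <= g2 z by rewrite mulr_ge0 ?sqr_ge0 ?gaussRn_ge0.
(* The [2^-1] is from [|F xi * F eta| <= (F xi ^+ 2 + F eta ^+ 2) / 2], the mass from the
   integration in [x]. Each of [g1], [g2] then brings the mass for [s^-1], and [gauss_massV] turns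
   the product into [(2 * pi) ^+ n]. *)
pose c := 2^-1 * gauss_mass n s.
have c0 : 0 <= c by rewrite mulr_ge0// ltW// gauss_mass_gt0.
have si0 : 0 < s^-1 by rewrite invr_gt0.
have mF2 : measurable_fun setT (EFin \o (fun x => F x ^+ 2)).
  by apply/measurable_EFinP; exact: measurable_funX.
have I1 : (\int[mu2]_z (g1 z)%:E = (gauss_mass n s^-1)%:E * \int[mu]_xi (F xi ^+ 2)%:E)%E.
  rewrite integral_prod_measure fubini_tonelli1//; last by exact/measurable_EFinP.
  rewrite -ge0_integralZl//; last 2 first.
    by move=> x _; rewrite lee_fin sqr_ge0.
    by rewrite lee_fin ltW// gauss_mass_gt0.
  apply: eq_integral => x _; rewrite /fubini_F /g1/=.
  under eq_integral do rewrite EFinM.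
  rewrite ge0_integralZl//; last 3 first.
  - by apply/measurable_EFinP/measurable_fun_gaussRn; exact: measurable_fun_subRn.
  - by move=> y _; rewrite lee_fin gaussRn_ge0.
  - by rewrite lee_fin sqr_ge0.
  under eq_integral do rewrite gaussRn_subC.
  by rewrite integral_gaussRn_sub// muleC.
have I2 : (\int[mu2]_z (g2 z)%:E = (gauss_mass n s^-1)%:E * \int[mu]_xi (F xi ^+ 2)%:E)%E.
  rewrite integral_prod_measure fubini_tonelli2//; last by exact/measurable_EFinP.
  rewrite -ge0_integralZl//; last 2 first.
    by move=> x _; rewrite lee_fin sqr_ge0.
    by rewrite lee_fin ltW// gauss_mass_gt0.
  apply: eq_integral => x _; rewrite /fubini_G /g2/=.
  under eq_integral do rewrite EFinM.
  rewrite ge0_integralZl//; last 3 first.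
  - by apply/measurable_EFinP/measurable_fun_gaussRn; exact: measurable_fun_subRn.
  - by move=> y _; rewrite lee_fin gaussRn_ge0.
  - by rewrite lee_fin sqr_ge0.
  by rewrite integral_gaussRn_sub// muleC.
have F2oo : (\int[mu]_xi (F xi ^+ 2)%:E < +oo)%E by case: F2.
have I0 : (0 <= \int[mu]_xi (F xi ^+ 2)%:E)%E.
  by apply: integral_ge0 => x _; rewrite lee_fin sqr_ge0.
have ig1 : mu2.-integrable setT (EFin \o g1).
  apply: integrableR_ge0P => //; rewrite I1 lte_mul_pinfty ?lee_fin//.
  by rewrite ltW// gauss_mass_gt0.
have ig2 : mu2.-integrable setT (EFin \o g2).
  apply: integrableR_ge0P => //; rewrite I2 lte_mul_pinfty ?lee_fin//.
  by rewrite ltW// gauss_mass_gt0.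
have G_le z : `|G z * (gauss_mass n s * gaussRn s^-1 (subRn z.1 z.2))| <= c * (g1 z + g2 z).
  rewrite /G /g1 /g2 /c -mulrDl !normrM (ger0_norm (gaussRn_ge0 _ _)).
  rewrite (ger0_norm (ltW (gauss_mass_gt0 n s0))).
  have := sqr_ge0 (`|F z.1| - `|F z.2|).
  rewrite sqrrB !real_normK ?num_real// => h.
  rewrite [leLHS](_ : _ = (`|F z.1| * `|F z.2|) * (gauss_mass n s * gaussRn s^-1 (subRn z.1 z.2)))//.
  rewrite [leRHS](_ : _ = (2^-1 * (F z.1 ^+ 2 + F z.2 ^+ 2)) *
    (gauss_mass n s * gaussRn s^-1 (subRn z.1 z.2))); last by ring.
  rewrite ler_wpM2r ?mulr_ge0 ?gaussRn_ge0//; first by rewrite ltW// gauss_mass_gt0.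
  by move: h; rewrite -mulr_natr; lra.
apply: (@le_trans _ _ (\int[mu2]_z (c * (g1 z + g2 z))%:E)%E).
  apply: le_integral => //.
  - apply: integrableR_le (integrableRZ c (integrableRD ig1 ig2)).
      apply: measurable_funM; first exact: integrable_measurableR integrable_G.
      by apply: measurable_funM => //.
    by move=> z; rewrite (le_trans (G_le z)).
  - by apply: integrableRZ; exact: integrableRD.
  - by move=> z _; rewrite lee_fin (le_trans (ler_norm _))// G_le.
under eq_integral do rewrite EFinM EFinD.
rewrite ge0_integralZl//; last 2 first.
- by apply: emeasurable_funD; apply/measurable_EFinP.
- by move=> z _; rewrite lee_fin addr_ge0.
rewrite ge0_integralD//; try by [apply/measurable_EFinP|move=> z _; rewrite lee_fin].
have cm : 0 <= gauss_mass n s^-1 by rewrite ltW// gauss_mass_gt0.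
rewrite I1 I2 -ge0_muleDl ?lee_fin// muleA -EFinD -EFinM.
suff -> : c * (gauss_mass n s^-1 + gauss_mass n s^-1) = (2 * pi) ^+ n by [].
by rewrite -(gauss_massV n s0) /c; field.
Qed.

Theorem energy_le :
  (\int[mu]_x (cos_transform x ^+ 2 + sin_transform x ^+ 2)%:E <=
   ((2 * pi) ^+ n)%:E * \int[mu]_xi (F xi ^+ 2)%:E)%E.
Proof.
apply: ge0_integral_le_gauss_cutoff; last by move=> s s0; exact: gauss_energy_le.
  apply: measurable_funD; apply: measurable_funX.
    exact: measurable_cos_transform.
  exact: measurable_sin_transform.
by move=> x; rewrite addr_ge0 ?sqr_ge0.
Qed.

End fourier_energy.

(** * Gaussian approximate identities *)

Section dirichlet_form.
Context d (T : measurableType d) (R : realType).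
Variable m : {sigma_finite_measure set T -> \bar R}.
Implicit Types (K : T -> T -> R) (v w : T -> R).

Definition markov_kernel K :=
  [/\ measurable_fun setT (fun z : T * T => K z.1 z.2),
      forall x y, 0 <= K x y,
      forall x y, K x y = K y x &
      forall x, (\int[m]_y (K x y)%:E = 1)%E].

Lemma measurable_kernel_section K x : markov_kernel K ->
  measurable_fun setT (K x).
Proof. by move=> [mK _ _ _]; exact: (measurableT_comp mK (pair1_measurable x)). Qed.

(* For [v] in L^2 and a Markov kernel [K], this is [2 (|v|^2 - <v, K v>)]. *)
Definition dirichlet K v : \bar R :=
  (\int[m \x m]_z (K z.1 z.2 * (v z.1 - v z.2) ^+ 2)%:E)%E.

Lemma dirichlet_ge0 K v : markov_kernel K -> (0 <= dirichlet K v)%E.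
Proof.
by move=> [_ K0 _ _]; apply: integral_ge0 => z _; rewrite lee_fin mulr_ge0 ?sqr_ge0.
Qed.

Lemma measurable_dirichlet K v : markov_kernel K -> measurable_fun setT v ->
  measurable_fun setT (fun z : T * T => (K z.1 z.2 * (v z.1 - v z.2) ^+ 2)%:E).
Proof.
move=> [mK _ _ _] mv; apply/measurable_EFinP; apply: measurable_funM => //.
by apply: measurable_funX; apply: measurable_funB; exact: measurableT_comp.
Qed.

(** Unit mass integrates out the second variable; symmetry of [K] gives the same for the first. *)
Lemma markov_kernel_int K (u : T -> R) : markov_kernel K -> measurable_fun setT u ->
  (forall x, 0 <= u x) ->
  (\int[m \x m]_z (K z.1 z.2 * u z.1)%:E = \int[m]_x (u x)%:E)%E /\
  (\int[m \x m]_z (K z.1 z.2 * u z.2)%:E = \int[m]_x (u x)%:E)%E.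
Proof.
move=> MK mu u0; have [mK K0 symK K1] := MK; split.
- rewrite fubini_tonelli1//; last 2 first.
  + apply/measurable_EFinP; apply: measurable_funM => //.
    exact: (measurableT_comp mu).
  + by move=> z; rewrite lee_fin mulr_ge0.
  apply: eq_integral => x _; rewrite /fubini_F/=.
  under eq_integral do rewrite EFinM.
  rewrite ge0_integralZr//; last 3 first.
  + by apply/measurable_EFinP; exact: measurable_kernel_section.
  + by move=> y _; rewrite lee_fin.
  + by rewrite lee_fin.
  by rewrite K1 mul1e.
- rewrite fubini_tonelli2//; last 2 first.
  + apply/measurable_EFinP; apply: measurable_funM => //.
    exact: (measurableT_comp mu).
  + by move=> z; rewrite lee_fin mulr_ge0.
  apply: eq_integral => x _; rewrite /fubini_G/=.
  under eq_integral do rewrite EFinM symK.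
  rewrite ge0_integralZr//; last 3 first.
  + by apply/measurable_EFinP; exact: measurable_kernel_section.
  + by move=> y _; rewrite lee_fin.
  + by rewrite lee_fin.
  by rewrite K1 mul1e.
Qed.

(** From [(a - b)^2 <= 2 a^2 + 2 b^2] and the two marginals. The constant is the same for all
    kernels, so the bound serves as a dominating function and carries convergence from a dense class
    to all of L^2. *)
Lemma dirichlet_le_sqr K v : markov_kernel K -> measurable_fun setT v ->
  (dirichlet K v <= 4%:E * \int[m]_x (v x ^+ 2)%:E)%E.
Proof.
move=> MK mv; have [mK K0 _ _] := MK.
have mv2 : measurable_fun setT (fun x => v x ^+ 2) by exact: measurable_funX.
have v20 x : 0 <= v x ^+ 2 by exact: sqr_ge0.
have [e1 e2] := markov_kernel_int MK mv2 v20.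
have m1 : measurable_fun setT (fun z : T * T => (K z.1 z.2 * v z.1 ^+ 2)%:E).
  apply/measurable_EFinP; apply: measurable_funM => //; exact: (measurableT_comp mv2).
have m2 : measurable_fun setT (fun z : T * T => (K z.1 z.2 * v z.2 ^+ 2)%:E).
  apply/measurable_EFinP; apply: measurable_funM => //; exact: (measurableT_comp mv2).
apply: (@le_trans _ _ (\int[m \x m]_z
  (2%:E * ((K z.1 z.2 * v z.1 ^+ 2)%:E + (K z.1 z.2 * v z.2 ^+ 2)%:E)))%E).
  apply: ge0_le_integral => //.
  - by move=> z _; rewrite lee_fin mulr_ge0 ?sqr_ge0.
  - exact: measurable_dirichlet.
  - by apply: measurable_funeM; exact: emeasurable_funD.
  - move=> z _; rewrite -EFinD -EFinM lee_fin -mulrDr [leRHS]mulrCA ler_wpM2l//.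
    by have := sqr_ge0 (v z.1 + v z.2); nra.
rewrite ge0_integralZl//; last 2 first.
- exact: emeasurable_funD.
- by move=> z _; rewrite -EFinD lee_fin addr_ge0// mulr_ge0.
rewrite ge0_integralD//; last 2 first.
- by move=> z _; rewrite lee_fin mulr_ge0.
- by move=> z _; rewrite lee_fin mulr_ge0.
rewrite e1 e2; set I := (\int[m]_x _)%E.
rewrite -[X in (X + X)%E]mul1e -ge0_muleDl// muleA -EFinD -EFinM.
by rewrite (_ : 2 * (1 + 1) = 4 :> R)//; ring.
Qed.

Lemma dirichlet_le_add K v w : markov_kernel K -> measurable_fun setT v ->
  measurable_fun setT w ->
  (dirichlet K v <= 2%:E * dirichlet K w + 2%:E * dirichlet K (fun x => v x - w x)%R)%E.
Proof.
move=> MK mv mw; have [mK K0 _ _] := MK.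
have mvw : measurable_fun setT (fun x => v x - w x) by exact: measurable_funB.
have D0 u z : (0 <= (K z.1 z.2 * (u z.1 - u z.2) ^+ 2)%:E)%E.
  by rewrite lee_fin mulr_ge0 ?sqr_ge0.
rewrite /dirichlet -ge0_integralZl//; last exact: measurable_dirichlet.
rewrite -ge0_integralZl//; last 2 first.
- exact: (measurable_dirichlet MK mvw).
- by move=> z _; exact: (D0 (fun x => v x - w x)).
rewrite -ge0_integralD//; last 4 first.
- by move=> z _; rewrite mule_ge0.
- by apply: measurable_funeM; exact: measurable_dirichlet.
- by move=> z _; apply: mule_ge0 => //; exact: (D0 (fun x => v x - w x)).
- by apply: measurable_funeM; exact: (measurable_dirichlet MK mvw).
apply: ge0_le_integral => //.
- exact: measurable_dirichlet.
- apply: emeasurable_funD; apply: measurable_funeM; first exact: measurable_dirichlet.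
  exact: (measurable_dirichlet MK mvw).
- move=> z _; rewrite -!EFinM -EFinD lee_fin !(mulrCA 2) -mulrDr ler_wpM2l//.
  rewrite -subr_ge0 (_ : _ - _ = ((w z.1 - w z.2) - (v z.1 - w z.1 - (v z.2 - w z.2))) ^+ 2) ?sqr_ge0//.
  by ring.
Qed.

(** Convergence is asked of the Dirichlet form rather than of [K k v] in norm: the form dominates
    the squared distance from [v] to its average, and for a product kernel it is controlled by the
    forms of the sections, which permits induction on the dimension. *)
Definition approx_identity (K : nat -> T -> T -> R) :=
  (forall k, markov_kernel (K k)) /\
  (forall v, L2R m v -> dirichlet (K k) v @[k --> \oo] --> 0%E).

End dirichlet_form.

Section ereal_cvg0.
Context {R : realType}.

Lemma ge0_cvg0e (u : nat -> \bar R) : (forall k, (0 <= u k)%E) ->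
  (forall e : R, 0 < e -> \forall k \near \oo, (u k <= e%:E)%E) ->
  u k @[k --> \oo] --> 0%E.
Proof.
move=> u0 H; apply/fine_cvgP; split.
  near=> k; rewrite ge0_fin_numE//.
  apply: (@le_lt_trans _ _ 1%:E); last exact: ltry.
  by near: k; exact: H.
apply/cvgrPdist_le => e e0; near=> k.
rewrite sub0r normrN ger0_norm ?fine_ge0//.
rewrite -lee_fin fineK; first by near: k; exact: H.
rewrite ge0_fin_numE//; apply: (@le_lt_trans _ _ e%:E); last exact: ltry.
by near: k; exact: H.
Unshelve. all: by end_near.
Qed.

Lemma cvg0e_near (u : nat -> \bar R) (e : R) : 0 < e ->
  u k @[k --> \oo] --> 0%E -> \forall k \near \oo, (u k <= e%:E)%E.
Proof.
move=> e0 /fine_cvgP[uf /cvgrPdist_le /(_ _ e0) ue]; near=> k.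
have fk : u k \is a fin_num by near: k.
rewrite -(fineK fk) lee_fin.
have : `|0 - fine (u k)| <= e by near: k.
by rewrite sub0r normrN; apply: le_trans; exact: ler_norm.
Unshelve. all: by end_near.
Qed.

End ereal_cvg0.

(** * Dirichlet forms of product kernels *)

Section dirichlet_product.
Context d1 d2 (T1 : measurableType d1) (T2 : measurableType d2) (R : realType).
Variable m1 : {sigma_finite_measure set T1 -> \bar R}.
Variable m2 : {sigma_finite_measure set T2 -> \bar R}.
Local Notation m12 := (prod_measure m1 m2).

Definition prod_kernel (K1 : T1 -> T1 -> R) (K2 : T2 -> T2 -> R) (p q : T1 * T2) :=
  K1 p.1 q.1 * K2 p.2 q.2.

Let T := (T1 * T2)%type.

Let measurable_swap12 (f : T1 * T1 -> R) : measurable_fun setT f ->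
  measurable_fun setT (fun z : T * T => f (z.1.1, z.2.1)).
Proof.
move=> mf; apply: (measurableT_comp mf); apply: measurable_fun_pair.
  exact: (measurableT_comp measurable_fst measurable_fst).
exact: (measurableT_comp measurable_fst measurable_snd).
Qed.

Let measurable_swap22 (f : T2 * T2 -> R) : measurable_fun setT f ->
  measurable_fun setT (fun z : T * T => f (z.1.2, z.2.2)).
Proof.
move=> mf; apply: (measurableT_comp mf); apply: measurable_fun_pair.
  exact: (measurableT_comp measurable_snd measurable_fst).
exact: (measurableT_comp measurable_snd measurable_snd).
Qed.

Lemma markov_prod_kernel K1 K2 : markov_kernel m1 K1 -> markov_kernel m2 K2 ->
  markov_kernel m12 (prod_kernel K1 K2).
Proof.
move=> MK1 MK2; have [mK1 K10 symK1 K11] := MK1; have [mK2 K20 symK2 K21] := MK2.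
split.
- by apply: measurable_funM; [exact: (measurable_swap12 mK1)|exact: (measurable_swap22 mK2)].
- by move=> p q; rewrite mulr_ge0.
- by move=> p q; rewrite /prod_kernel symK1 symK2.
- move=> p; rewrite integral_prod_measure fubini_tonelli1//; last 2 first.
  + apply/measurable_EFinP; apply: measurable_funM.
      exact: (measurableT_comp (measurable_kernel_section _ MK1)).
    exact: (measurableT_comp (measurable_kernel_section _ MK2)).
  + by move=> q; rewrite lee_fin mulr_ge0.
  rewrite -(K11 p.1); apply: eq_integral => b _; rewrite /fubini_F /prod_kernel/=.
  under eq_integral do rewrite EFinM.
  rewrite ge0_integralZl//; last 3 first.
  + by apply/measurable_EFinP; exact: measurable_kernel_section.
  + by move=> y _; rewrite lee_fin.
  + by rewrite lee_fin.
  by rewrite K21 mule1.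
Qed.

Variables (K1 : T1 -> T1 -> R) (K2 : T2 -> T2 -> R).
Hypotheses (MK1 : markov_kernel m1 K1) (MK2 : markov_kernel m2 K2).
Variable v : T1 * T2 -> R.
Hypothesis mv : measurable_fun setT v.

Let measurable_v1 a : measurable_fun setT (fun x => v (a, x)).
Proof. exact: (measurableT_comp mv (pair1_measurable a)). Qed.

Let measurable_v2 y : measurable_fun setT (fun a => v (a, y)).
Proof. exact: (measurableT_comp mv (pair2_measurable y)). Qed.

Let D1 (w : T2 * (T1 * T1)) := (K1 w.2.1 w.2.2 * (v (w.2.1, w.1) - v (w.2.2, w.1)) ^+ 2)%:E.
Let D2 (w : T1 * (T2 * T2)) := (K2 w.2.1 w.2.2 * (v (w.1, w.2.1) - v (w.1, w.2.2)) ^+ 2)%:E.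

Let measurable_D2 : measurable_fun setT D2.
Proof.
have [mK2 _ _ _] := MK2.
apply/measurable_EFinP; apply: measurable_funM; first exact: (measurableT_comp mK2).
apply: measurable_funX; apply: measurable_funB; apply: (measurableT_comp mv);
  apply: measurable_fun_pair => //; exact: measurableT_comp.
Qed.

Lemma measurable_dirichlet_section2 :
  measurable_fun setT (fun a => dirichlet m2 K2 (fun x => v (a, x))).
Proof.
have [_ K20 _ _] := MK2.
have D20 w : (0 <= D2 w)%E by rewrite lee_fin mulr_ge0 ?sqr_ge0.
have := @measurable_fun_fubini_tonelli_F _ _ _ _ _ (prod_measure m2 m2) D2 measurable_D2 D20.
by congr measurable_fun.
Qed.

Let t1 (z : T * T) := prod_kernel K1 K2 z.1 z.2 * (v z.1 - v (z.1.1, z.2.2)) ^+ 2.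
Let t2 (z : T * T) := prod_kernel K1 K2 z.1 z.2 * (v (z.1.1, z.2.2) - v z.2) ^+ 2.

Let measurable_mid : measurable_fun setT (fun z : T * T => v (z.1.1, z.2.2)).
Proof. by apply: (measurableT_comp mv); apply: measurable_fun_pair; exact: measurableT_comp. Qed.

Let measurable_t1 : measurable_fun setT (EFin \o t1).
Proof.
apply/measurable_EFinP; apply: measurable_funM; first by case: (markov_prod_kernel MK1 MK2).
apply: measurable_funX; apply: measurable_funB; last exact: measurable_mid.
exact: (measurableT_comp mv).
Qed.

Let measurable_t2 : measurable_fun setT (EFin \o t2).
Proof.
apply/measurable_EFinP; apply: measurable_funM; first by case: (markov_prod_kernel MK1 MK2).
apply: measurable_funX; apply: measurable_funB; first exact: measurable_mid.
exact: (measurableT_comp mv).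
Qed.

Let prod_kernel_ge0 p q : 0 <= prod_kernel K1 K2 p q.
Proof. by case: MK1 => _ K10 _ _; case: MK2 => _ K20 _ _; rewrite mulr_ge0. Qed.

(** The difference in [t1] does not involve [z.2.1], so the unit mass of [K1] removes that
    coordinate and leaves the form of [K2] on each section. *)
Let integral_t1 : (\int[m12 \x m12]_z (t1 z)%:E =
  \int[m1]_a dirichlet m2 K2 (fun x => v (a, x)))%E.
Proof.
have [mK1 K10 symK1 K11] := MK1; have [mK2 K20 symK2 K21] := MK2.
pose g (w : T * T2) := (K2 w.1.2 w.2 * (v w.1 - v (w.1.1, w.2)) ^+ 2)%:E.
have g0 w : (0 <= g w)%E by rewrite lee_fin mulr_ge0 ?sqr_ge0.
have mg : measurable_fun setT g.
  apply/measurable_EFinP; apply: measurable_funM.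
    apply: (measurableT_comp mK2 (g := fun w : T * T2 => (w.1.2, w.2))).
    by apply: measurable_fun_pair => //; exact: measurableT_comp.
  apply: measurable_funX; apply: measurable_funB; apply: (measurableT_comp mv) => //.
  by apply: measurable_fun_pair => //; exact: measurableT_comp.
have inner p : fubini_F m12 (EFin \o t1) p = fubini_F m2 g p.
  have mgp : measurable_fun setT (fun y => g (p, y)).
    exact: (measurableT_comp mg (pair1_measurable p)).
  rewrite /fubini_F integral_prod_measure fubini_tonelli1; last 2 first.
  - exact: (measurableT_comp measurable_t1 (pair1_measurable p)).
  - by move=> q; rewrite lee_fin mulr_ge0 ?sqr_ge0.
  transitivity (\int[m1]_b ((K1 p.1 b)%:E * \int[m2]_y g (p, y)))%E.
    apply: eq_integral => b _.
    rewrite /fubini_F /t1 /prod_kernel/= -ge0_integralZl//; last by rewrite lee_fin.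
    by apply: eq_integral => y _; rewrite -mulrA EFinM.
  rewrite ge0_integralZr//; last 3 first.
  - by apply/measurable_EFinP; exact: measurable_kernel_section MK1.
  - by move=> b _; rewrite lee_fin.
  - by apply: integral_ge0.
  by rewrite K11 mul1e.
rewrite fubini_tonelli1//; last by move=> z; rewrite lee_fin mulr_ge0 ?sqr_ge0.
under eq_integral do rewrite inner.
rewrite integral_prod_measure fubini_tonelli1; last 2 first.
- exact: measurable_fun_fubini_tonelli_F.
- by move=> p; apply: integral_ge0.
apply: eq_integral => a _; rewrite /dirichlet fubini_tonelli1//.
- exact: (measurable_dirichlet MK2 (measurable_v1 a)).
- by move=> z; rewrite lee_fin mulr_ge0 ?sqr_ge0.
Qed.

(** Here the idle coordinate is [z.1.2]. It is the first argument of [K2], whose mass is normalised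
    in the second, hence the use of symmetry. *)
Let integral_t2 : (\int[m12 \x m12]_z (t2 z)%:E =
  \int[m2]_y dirichlet m1 K1 (fun a => v (a, y)))%E.
Proof.
have [mK1 K10 symK1 K11] := MK1; have [mK2 K20 symK2 K21] := MK2.
pose g (w : T1 * T) := (K1 w.1 w.2.1 * (v (w.1, w.2.2) - v w.2) ^+ 2)%:E.
have g0 w : (0 <= g w)%E by rewrite lee_fin mulr_ge0 ?sqr_ge0.
have mg : measurable_fun setT g.
  apply/measurable_EFinP; apply: measurable_funM.
    apply: (measurableT_comp mK1 (g := fun w : T1 * T => (w.1, w.2.1))).
    by apply: measurable_fun_pair => //; exact: measurableT_comp.
  apply: measurable_funX; apply: measurable_funB; apply: (measurableT_comp mv) => //.
  by apply: measurable_fun_pair => //; exact: measurableT_comp.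
have inner q : fubini_G m12 (EFin \o t2) q = fubini_G m1 g q.
  have mgq : measurable_fun setT (fun a => g (a, q)).
    exact: (measurableT_comp mg (pair2_measurable q)).
  rewrite /fubini_G integral_prod_measure fubini_tonelli1; last 2 first.
  - exact: (measurableT_comp measurable_t2 (pair2_measurable q)).
  - by move=> p; rewrite lee_fin mulr_ge0 ?sqr_ge0.
  apply: eq_integral => a _.
  rewrite /fubini_F /t2 /prod_kernel/=.
  under eq_integral do rewrite mulrAC EFinM -/(g (a, q)) symK2.
  rewrite ge0_integralZl//; last 2 first.
  - by apply/measurable_EFinP; exact: measurable_kernel_section MK2.
  - by move=> x _; rewrite lee_fin.
  by rewrite K21 mule1.
rewrite fubini_tonelli2//; last by move=> z; rewrite lee_fin mulr_ge0 ?sqr_ge0.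
under eq_integral do rewrite inner.
rewrite integral_prod_measure fubini_tonelli2; last 2 first.
- exact: measurable_fun_fubini_tonelli_G.
- by move=> p; apply: integral_ge0.
apply: eq_integral => y _; rewrite /dirichlet fubini_tonelli2//.
- exact: (measurable_dirichlet MK1 (measurable_v2 y)).
- by move=> z; rewrite lee_fin mulr_ge0 ?sqr_ge0.
Qed.

(* Pass from [z.1] to [z.2] through the point [(z.1.1, z.2.2)], changing one
   coordinate at a time. *)
Lemma dirichlet_prod_le : (dirichlet m12 (prod_kernel K1 K2) v <=
  2%:E * \int[m1]_a dirichlet m2 K2 (fun x => v (a, x)) +
  2%:E * \int[m2]_y dirichlet m1 K1 (fun a => v (a, y)))%E.
Proof.
have t10 z : (0 <= (t1 z)%:E)%E by rewrite lee_fin mulr_ge0 ?sqr_ge0.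
have t20 z : (0 <= (t2 z)%:E)%E by rewrite lee_fin mulr_ge0 ?sqr_ge0.
rewrite -integral_t1 -integral_t2 -ge0_integralZl// -ge0_integralZl//.
rewrite -ge0_integralD//; last 4 first.
- by move=> z _; exact: mule_ge0.
- by apply: measurable_funeM.
- by move=> z _; exact: mule_ge0.
- by apply: measurable_funeM.
apply: ge0_le_integral => //.
- by move=> z _; rewrite lee_fin mulr_ge0 ?sqr_ge0.
- by apply: measurable_dirichlet => //; exact: markov_prod_kernel.
- by apply: emeasurable_funD; apply: measurable_funeM.
- move=> z _; rewrite -!EFinM -EFinD lee_fin /t1 /t2 !(mulrCA 2) -mulrDr ler_wpM2l//.
  rewrite -subr_ge0 (_ : _ - _ =
    ((v z.1 - v (z.1.1, z.2.2)) - (v (z.1.1, z.2.2) - v z.2)) ^+ 2) ?sqr_ge0//.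
  by ring.
Qed.

End dirichlet_product.

Section approx_identity_product.
Context d1 d2 (T1 : measurableType d1) (T2 : measurableType d2) (R : realType).
Variable m1 : {sigma_finite_measure set T1 -> \bar R}.
Variable m2 : {sigma_finite_measure set T2 -> \bar R}.
Variables (K1 : nat -> T1 -> T1 -> R) (K2 : nat -> T2 -> T2 -> R).

(** Almost every section of [v] is in L^2, so its forms tend to 0; they are at most 4 times its
    squared norm, which is integrable in [a], and dominated convergence applies. *)
Lemma dirichlet_section_cvg0 (v : T1 * T2 -> R) :
  approx_identity m2 K2 -> L2R (prod_measure m1 m2) v ->
  (\int[m1]_a dirichlet m2 (K2 k) (fun x => v (a, x)) @[k --> \oo] --> 0)%E.
Proof.
move=> [MK2 aK2] [mv v2].
have mv2 : measurable_fun setT (fun z => (v z ^+ 2)%:E).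
  by apply/measurable_EFinP; exact: measurable_funX.
have v20 z : (0 <= (v z ^+ 2)%:E)%E by rewrite lee_fin sqr_ge0.
pose g := fubini_F m2 (fun z => (v z ^+ 2)%:E).
have mg : measurable_fun setT g by exact: measurable_fun_fubini_tonelli_F.
have g0 a : (0 <= g a)%E by apply: integral_ge0.
have ig : m1.-integrable setT g.
  apply/integrableP; split => //; under eq_integral do rewrite gee0_abs//.
  by move: v2; rewrite integral_prod_measure fubini_tonelli1.
have mva a : measurable_fun setT (fun x => v (a, x)).
  exact: (measurableT_comp mv (pair1_measurable a)).
have := @dominated_convergence _ _ _ m1 setT measurableT
  (fun k a => dirichlet m2 (K2 k) (fun x => v (a, x))) (cst 0%E) (fun a => 4%:E * g a)%E.
case.
- by move=> k; exact: measurable_dirichlet_section2.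
- exact: measurable_cst.
- have := integrable_ae measurableT ig; apply: filterS => a /(_ I) ga _.
  apply: aK2; split; first exact: mva.
  by move: ga; rewrite ge0_fin_numE.
- by apply: integrableZl.
- apply: aeW => a k _; rewrite gee0_abs; last exact: dirichlet_ge0.
  exact: dirichlet_le_sqr.
by move=> _ _; rewrite integral0.
Qed.

Lemma L2R_swap (v : T1 * T2 -> R) : L2R (prod_measure m1 m2) v ->
  L2R (prod_measure m2 m1) (fun z => v (z.2, z.1)).
Proof.
move=> [mv v2].
have mv' : measurable_fun setT (fun z : T2 * T1 => v (z.2, z.1)).
  by apply: (measurableT_comp mv); exact: measurable_fun_pair.
split=> //; rewrite integral_prod_measure fubini_tonelli1; last 2 first.
- by apply/measurable_EFinP; exact: measurable_funX.
- by move=> z; rewrite lee_fin sqr_ge0.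
move: v2; rewrite integral_prod_measure fubini_tonelli2//.
- by apply/measurable_EFinP; exact: measurable_funX.
- by move=> z; rewrite lee_fin sqr_ge0.
Qed.

End approx_identity_product.

Lemma approx_identity_prod d1 d2 (T1 : measurableType d1) (T2 : measurableType d2)
    (R : realType) (m1 : {sigma_finite_measure set T1 -> \bar R})
    (m2 : {sigma_finite_measure set T2 -> \bar R})
    (K1 : nat -> T1 -> T1 -> R) (K2 : nat -> T2 -> T2 -> R) :
  approx_identity m1 K1 -> approx_identity m2 K2 ->
  approx_identity (prod_measure m1 m2) (fun k => prod_kernel (K1 k) (K2 k)).
Proof.
move=> a1 a2; have [MK1 _] := a1; have [MK2 _] := a2.
split; first by move=> k; exact: markov_prod_kernel.
move=> v v2; have [mv _] := v2.
have h1 := dirichlet_section_cvg0 a2 v2.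
have h2 := dirichlet_section_cvg0 a1 (L2R_swap v2).
apply: ge0_cvg0e => [k|e e0].
  by apply: dirichlet_ge0; exact: markov_prod_kernel.
have e4 : 0 < e / 4 by rewrite divr_gt0.
near=> k.
have k1 : (\int[m1]_a dirichlet m2 (K2 k) (fun x => v (a, x)) <= (e / 4)%:E)%E.
  by near: k; exact: cvg0e_near h1.
have k2 : (\int[m2]_y dirichlet m1 (K1 k) (fun a => v (a, y)) <= (e / 4)%:E)%E.
  by near: k; exact: cvg0e_near h2.
apply: le_trans (dirichlet_prod_le _ _ mv) _ => //.
have -> : e%:E = (2%:E * (e / 4)%:E + 2%:E * (e / 4)%:E)%E.
  by rewrite -!EFinM -EFinD; congr EFin; field.
by apply: leeD; rewrite lee_pmul2l.
Unshelve. all: by end_near.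
Qed.

(** * The heat kernel on the line is an approximate identity *)

Section gaussian_kernel_1d.
Context {R : realType}.
Local Notation RR := (measurableTypeR R).
Local Notation leb := (@lebesgue_measure R).

Definition ker1 (s : R) (x y : RR) : R := (Num.sqrt (2 * pi / s))^-1 * gauss1 s (x - y).

Let mass_gt0 (s : R) : 0 < s -> 0 < Num.sqrt (2 * pi / s).
Proof. by move=> s0; rewrite sqrtr_gt0 !mulr_gt0 ?invr_gt0// pi_gt0. Qed.

Lemma gauss1_subC (s x y : R) : gauss1 s (x - y) = gauss1 s (y - x).
Proof. by rewrite /gauss1 -(sqrrN (x - y)) opprB. Qed.

Lemma markov_ker1 s : 0 < s -> markov_kernel leb (ker1 s).
Proof.
move=> s0; have c0 := mass_gt0 s0; split.
- apply: measurable_funM => //; apply: (measurableT_comp (measurable_gauss1 s)).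
  by apply: measurable_funB.
- by move=> x y; rewrite mulr_ge0 ?gauss1_ge0// invr_ge0 ltW.
- by move=> x y; rewrite /ker1 gauss1_subC.
- move=> x; under eq_integral do rewrite /ker1 EFinM gauss1_subC.
  rewrite ge0_integralZl//; last 2 first.
  + apply/measurable_EFinP; apply: (measurableT_comp (measurable_gauss1 s)).
    exact: measurable_funB.
  + by move=> y _; rewrite lee_fin gauss1_ge0.
  by rewrite integral_gauss1// -EFinM mulVf// gt_eqF.
Qed.

(** Half of the exponent absorbs [(x - y) ^+ 2]; [Num.sqrt 2] is the ratio of the normalising
    constants for [s] and [s / 2]. *)
Lemma ker1_tail (s x y : R) : 0 < s ->
  (x - y) ^+ 2 * ker1 s x y <= 4 / s * (Num.sqrt 2 * ker1 (s / 2) x y).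
Proof.
move=> s0; have c0 := mass_gt0 s0.
have E : Num.sqrt 2 * (Num.sqrt (2 * pi / (s / 2)))^-1 = (Num.sqrt (2 * pi / s))^-1 :> R.
  rewrite (_ : 2 * pi / (s / 2) = 2 * (2 * pi / s)); last by field; rewrite gt_eqF.
  by rewrite sqrtrM// invfM mulrA divff ?mul1r// gt_eqF// sqrtr_gt0.
rewrite /ker1 mulrCA [leRHS](_ : _ = (Num.sqrt (2 * pi / s))^-1 *
  (4 / s * gauss1 (s / 2) (x - y))); last by rewrite -E; ring.
rewrite ler_wpM2l ?invr_ge0 ?(ltW c0)//; set z := x - y.
have -> : gauss1 s z = gauss1 (s / 2) z * gauss1 (s / 2) z.
  by rewrite /gauss1 -expRD; congr expR; field.
rewrite mulrA ler_wpM2r ?gauss1_ge0//.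
have h : s / 4 * z ^+ 2 <= expR (s / 4 * z ^+ 2).
  by apply: le_trans (expR_ge1Dx _); rewrite lerDr.
have -> : gauss1 (s / 2) z = (expR (s / 4 * z ^+ 2))^-1.
  by rewrite -expRN /gauss1; congr expR; field.
rewrite ler_pdivrMr ?expR_gt0// -ler_pdivrMl ?divr_gt0// invf_div.
exact: h.
Qed.

(** Near [x] continuity makes the squared difference small. At distance at least [r] it is bounded,
    and a Chebyshev estimate with [ker1_tail] shows that this region contributes [O(1 / s)]. *)
Lemma ker1_dirichlet_at (G : RR -> R) (M : R) (x : RR) : measurable_fun setT G ->
  (forall y, `|G y| <= M) -> {for x, continuous (G : R -> R)} ->
  (\int[leb]_y (ker1 k.+1%:R x y * (G x - G y) ^+ 2)%:E @[k --> \oo] --> 0)%E.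
Proof.
move=> mG GM cG; have M0 : 0 <= M by apply: le_trans (GM x).
apply: ge0_cvg0e => [k|e e0].
  apply: integral_ge0 => y _; rewrite lee_fin mulr_ge0 ?sqr_ge0//.
  by have [_ ->] := @markov_ker1 k.+1%:R (ltr0Sn _ _).
have e2 : 0 < e / 2 by rewrite divr_gt0.
have [r r0 Hr] : exists2 r : R, 0 < r &
    forall y, `|x - y| < r -> (G x - G y) ^+ 2 <= e / 2.
  have se : 0 < Num.sqrt (e / 2) by rewrite sqrtr_gt0.
  have /cvgrPdist_lt /(_ _ se) /nbhs_ballP[r r0 Hr] := cG.
  exists r => // y xy; have := Hr y xy => h.
  rewrite -(sqr_sqrtr (ltW e2)) -[leLHS]real_normK ?num_real//.
  by rewrite ler_sqr ?nnegrE// ltW.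
(* [4 * M ^+ 2] bounds the squared difference, [r ^- 2] comes from [|x - y| >= r], and
   [4 * Num.sqrt 2] from [ker1_tail]. *)
pose C := 4 * M ^+ 2 / r ^+ 2 * (4 * Num.sqrt 2).
have C0 : 0 <= C by rewrite !mulr_ge0 ?invr_ge0 ?sqr_ge0// sqrtr_ge0.
have HC : \forall k \near \oo, C / k.+1%:R <= e / 2.
  have h : C * (k.+1%:R)^-1 @[k --> \oo] --> (C * 0 : R).
    by apply: cvgMr; exact: cvg_harmonic.
  rewrite mulr0 in h; have /cvgrPdist_le /(_ _ e2) := h.
  by apply: filterS => k; rewrite sub0r normrN; apply: le_trans; exact: ler_norm.
near=> k.
have HCk : C / k.+1%:R <= e / 2 by near: k.
have s0 : 0 < k.+1%:R :> R by rewrite ltr0n.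
set s := k.+1%:R in HCk s0 *.
have [mK K0 symK K1] := markov_ker1 s0.
have s20 : 0 < s / 2 by rewrite divr_gt0.
have [mK' K0' symK' K1'] := markov_ker1 s20.
have mKx := measurable_kernel_section x (markov_ker1 s0).
have mKx' := measurable_kernel_section x (markov_ker1 s20).
have pw y : ker1 s x y * (G x - G y) ^+ 2 <=
    e / 2 * ker1 s x y + C / s * ker1 (s / 2) x y.
  have [xy|xy] := ltP `|x - y| r.
    rewrite mulrC (le_trans (ler_wpM2r (K0 x y) (Hr y xy)))// lerDl.
    by rewrite mulr_ge0// divr_ge0// ltW.
  rewrite (@le_trans _ _ (C / s * ker1 (s / 2) x y))//; last first.
    by rewrite lerDr mulr_ge0// ltW.
  have G4 : (G x - G y) ^+ 2 <= 4 * M ^+ 2.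
    rewrite -[leLHS]real_normK ?num_real//.
    rewrite (_ : 4 * M ^+ 2 = (M + M) ^+ 2); last by ring.
    by rewrite ler_sqr ?nnegrE ?addr_ge0// (le_trans (ler_normB _ _))// lerD.
  have r2 : 0 < r ^+ 2 by rewrite exprn_gt0.
  have xy2 : 1 <= (x - y) ^+ 2 / r ^+ 2.
    rewrite ler_pdivlMr// mul1r -[leRHS]real_normK ?num_real//.
    by rewrite ler_sqr ?nnegrE// ltW.
  have P0 : 0 <= 4 * M ^+ 2 by rewrite mulr_ge0// sqr_ge0.
  apply: (le_trans (ler_wpM2l (K0 x y) G4)).
  apply: (@le_trans _ _ ((ker1 s x y * (4 * M ^+ 2)) * ((x - y) ^+ 2 / r ^+ 2))).
    by rewrite ler_peMr// mulr_ge0.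
  rewrite [leLHS](_ : _ = 4 * M ^+ 2 / r ^+ 2 * ((x - y) ^+ 2 * ker1 s x y)); last by ring.
  rewrite [leRHS](_ : _ = 4 * M ^+ 2 / r ^+ 2 *
     (4 / s * (Num.sqrt 2 * ker1 (s / 2) x y))); last by rewrite /C; ring.
  by rewrite ler_wpM2l ?(divr_ge0 P0 (ltW r2))//; exact: ker1_tail.
have Cs0 : 0 <= C / s by rewrite divr_ge0// ltW.
apply: (@le_trans _ _ (\int[leb]_y ((e / 2)%:E * (ker1 s x y)%:E +
   (C / s)%:E * (ker1 (s / 2) x y)%:E))%E).
  apply: ge0_le_integral => //.
  - by move=> y _; rewrite lee_fin mulr_ge0 ?sqr_ge0.
  - apply/measurable_EFinP; apply: measurable_funM => //.
    by apply: measurable_funX; exact: measurable_funB.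
  - by apply: emeasurable_funD; apply: measurable_funeM; exact/measurable_EFinP.
  - by move=> y _; rewrite -!EFinM -EFinD lee_fin.
rewrite ge0_integralD//; last 4 first.
- by move=> y _; rewrite -EFinM lee_fin mulr_ge0// ltW.
- by apply: measurable_funeM; exact/measurable_EFinP.
- by move=> y _; rewrite -EFinM lee_fin mulr_ge0.
- by apply: measurable_funeM; exact/measurable_EFinP.
rewrite ge0_integralZl//; last 3 first.
- exact/measurable_EFinP.
- by move=> y _; rewrite lee_fin.
- by rewrite lee_fin ltW.
rewrite ge0_integralZl//; last 2 first.
- exact/measurable_EFinP.
- by move=> y _; rewrite lee_fin.
rewrite K1 K1' !mule1 -EFinD lee_fin {2}[e]splitr lerD2l.
exact: HCk.
Unshelve. all: by end_near.
Qed.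

Let itv (m : nat) : set RR := `]- m%:R, m%:R[%classic.

Let itvE m x : itv m x <-> `|x| < m%:R.
Proof. by rewrite /itv/= in_itv/= ltr_norml. Qed.

Let measurable_itvm m : measurable (itv m).
Proof. exact: measurable_itv. Qed.

Let itv_fin m : (leb (itv m) < +oo)%E.
Proof. by rewrite /itv lebesgue_measure_itv/=; case: ifP => _; rewrite -?EFinD ltry. Qed.

(** The cut function may jump at the endpoints of the interval. This is harmless: pairs of points
    both outside contribute nothing, so by symmetry the form is at most twice the integral over [x]
    in the open interval, where the function is continuous. The interval has finite measure, so a
    constant dominates. *)
Lemma dirichlet_ker1_continuous (h : R -> R) (M : R) (m : nat) :
  continuous h -> (forall y, `|h y| <= M) ->
  dirichlet leb (ker1 k.+1%:R) (fun x : RR => h x * \1_(itv m) x) @[k --> \oo] --> 0%E.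
Proof.
move=> ch hM; have M0 : 0 <= M by apply: le_trans (hM 0).
pose G (x : RR) := h x * \1_(itv m) x.
have mG : measurable_fun setT G.
  apply: measurable_funM; last exact: measurable_indic.
  exact: measurable_realfun.continuous_measurable_fun.
have GM x : `|G x| <= M.
  rewrite normrM (@le_trans _ _ `|h x|)// ler_piMr// indicE.
  by case: (_ \in _); rewrite ?normr1 ?normr0.
have cG x : itv m x -> {for x, continuous (G : R -> R)}.
  move=> Ix; have cx := ch x.
  have E : {near x, (h : R -> R) =1 G}.
    have : \forall y \near x, itv m y.
      by apply: open_nbhs_nbhs; split => //; exact: interval_open.
    by apply: filterS => y Iy; rewrite /G indicE mem_set// mulr1.
  have Gx : G x = h x by rewrite /G indicE mem_set// mulr1.
  have : (G : R -> R) y @[y --> (x : R)] --> h x.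
    by apply: cvg_trans cx; apply: near_eq_cvg.
  by rewrite -Gx.
pose I k x := (\int[leb]_y (ker1 k.+1%:R x y * (G x - G y) ^+ 2)%:E)%E.
have MK k : markov_kernel leb (ker1 k.+1%:R) by apply: markov_ker1; rewrite ltr0n.
have K0 k x y : 0 <= ker1 k.+1%:R x y by case: (MK k).
have I0 k x : (0 <= I k x)%E.
  by apply: integral_ge0 => y _; rewrite lee_fin mulr_ge0 ?sqr_ge0.
have mI k : measurable_fun setT (I k).
  apply: (measurable_fun_fubini_tonelli_F
     (fun z => (ker1 k.+1%:R z.1 z.2 * (G z.1 - G z.2) ^+ 2)%:E)).
    exact: measurable_dirichlet.
  by move=> z; rewrite lee_fin mulr_ge0 ?sqr_ge0.
have I4 k x : (I k x <= (4 * M ^+ 2)%:E)%E.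
  have [_ _ _ K1] := MK k.
  rewrite -[leRHS]mule1 -(K1 x) -ge0_integralZl//; last 3 first.
  - by apply/measurable_EFinP; exact: measurable_kernel_section.
  - by move=> y _; rewrite lee_fin.
  - by rewrite lee_fin mulr_ge0// sqr_ge0.
  apply: ge0_le_integral => //.
  - by move=> y _; rewrite lee_fin mulr_ge0 ?sqr_ge0.
  - apply/measurable_EFinP; apply: measurable_funM; first exact: measurable_kernel_section.
    by apply: measurable_funX; exact: measurable_funB.
  - by apply: measurable_funeM; apply/measurable_EFinP; exact: measurable_kernel_section.
  - move=> y _; rewrite -EFinM lee_fin mulrC ler_wpM2r// -[leLHS]real_normK ?num_real//.
    rewrite (_ : 4 * M ^+ 2 = (M + M) ^+ 2); last by ring.
    by rewrite ler_sqr ?nnegrE ?addr_ge0// (le_trans (ler_normB _ _))// lerD.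
have dirI k : (dirichlet leb (ker1 k.+1%:R) G <= 2%:E * \int[leb]_(x in itv m) I k x)%E.
  have [mK _ symK _] := MK k.
  have mD := measurable_dirichlet (MK k) mG.
  pose f1 (z : RR * RR) := ((\1_(itv m) z.1)%:E * (ker1 k.+1%:R z.1 z.2 * (G z.1 - G z.2) ^+ 2)%:E)%E.
  pose f2 (z : RR * RR) := ((\1_(itv m) z.2)%:E * (ker1 k.+1%:R z.1 z.2 * (G z.1 - G z.2) ^+ 2)%:E)%E.
  have f10 z : (0 <= f1 z)%E by rewrite mule_ge0 ?lee_fin// mulr_ge0 ?sqr_ge0.
  have f20 z : (0 <= f2 z)%E by rewrite mule_ge0 ?lee_fin// mulr_ge0 ?sqr_ge0.
  have mf1 : measurable_fun setT f1.
    apply: emeasurable_funM => //; apply/measurable_EFinP.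
    by apply: measurableT_comp.
  have mf2 : measurable_fun setT f2.
    apply: emeasurable_funM => //; apply/measurable_EFinP.
    by apply: measurableT_comp.
  have If1 : (\int[leb \x leb]_z f1 z = \int[leb]_(x in itv m) I k x)%E.
    rewrite (fubini_tonelli1 f1 mf1 f10) [RHS]integral_mkcond.
    apply: eq_integral => x _; rewrite /fubini_F /f1/= patchE indicE.
    case: ifP => _; last by under eq_integral do rewrite mul0e; rewrite integral0.
    by under eq_integral do rewrite mul1e.
  have If2 : (\int[leb \x leb]_z f2 z = \int[leb]_(x in itv m) I k x)%E.
    rewrite (fubini_tonelli2 f2 mf2 f20) [RHS]integral_mkcond.
    apply: eq_integral => x _; rewrite /fubini_G /f2/= patchE indicE.
    case: ifP => _; last by under eq_integral do rewrite mul0e; rewrite integral0.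
    by under eq_integral do rewrite mul1e symK -sqrrN opprB.
  rewrite (_ : 2%:E * _ = \int[leb \x leb]_z (f1 z + f2 z))%E; last first.
    transitivity (\int[leb \x leb]_z f1 z + \int[leb \x leb]_z f2 z)%E.
      rewrite If1 If2; set J := (\int[_]_(_ in _) _)%E.
      by rewrite -[X in (_ = X + X)%E]mul1e -ge0_muleDl// -EFinD.
    by rewrite ge0_integralD.
  apply: ge0_le_integral => //.
  - by move=> z _; rewrite lee_fin mulr_ge0 ?sqr_ge0.
  - exact: emeasurable_funD.
  - move=> z _; rewrite /f1 /f2 -!EFinM -EFinD lee_fin -mulrDl.
    have D0 : 0 <= ker1 k.+1%:R z.1 z.2 * (G z.1 - G z.2) ^+ 2 by rewrite mulr_ge0 ?sqr_ge0.
    move: D0; rewrite /G !indicE; case: (_ \in _); case: (_ \in _) => /= D0.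
    + by rewrite ler_peMl// lerDr.
    + by rewrite addr0 mul1r.
    + by rewrite add0r mul1r.
    + by rewrite !mulr0 subrr expr0n/= !mulr0.
have cvI : (\int[leb]_(x in itv m) I k x @[k --> \oo] --> \int[leb]_(x in itv m) (cst 0 x))%E.
  apply: (@dominated_cvg _ RR _ leb (itv m) (measurable_itvm m) I (cst 0%E) (cst (4 * M ^+ 2)%:E)).
  - by move=> k; exact: measurable_funTS.
  - by move=> x Ix; exact: ker1_dirichlet_at (cG x Ix).
  - by [].
  - apply/integrableP; split; first exact: measurable_cst.
    rewrite (_ : (fun x => _) = cst (4 * M ^+ 2)%:E); last first.
      by apply/funext => x /=; rewrite ger0_norm// mulr_ge0// sqr_ge0.
    rewrite integral_cst//; apply: lte_mul_pinfty => //; last exact: itv_fin.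
    by rewrite lee_fin mulr_ge0// sqr_ge0.
  - by move=> k x _; rewrite gee0_abs.
rewrite integral0 in cvI.
apply: ge0_cvg0e => [k|e e0]; first exact: dirichlet_ge0.
have e2 : 0 < e / 2 by rewrite divr_gt0.
have := cvg0e_near e2 cvI; apply: filterS => k Ik.
apply: le_trans (dirI k) _.
have -> : e%:E = (2%:E * (e / 2)%:E)%E by rewrite -EFinM; congr EFin; field.
by rewrite lee_pmul2l.
Qed.

(** For [M >= 0], the projection onto [[-M, M]], written with absolute values so that continuity is
    immediate. *)
Let clip (M x : R) : R := (`|x + M| - `|x - M|) / 2.

Let clip_le M x : 0 <= M -> `|clip M x| <= M.
Proof.
move=> M0; rewrite /clip normrM normfV (ger0_norm (ler0n _ 2)) ler_pdivrMr//.
rewrite (le_trans (ler_dist_dist _ _))// (_ : x + M - (x - M) = M * 2); last by ring.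
by rewrite ger0_norm// mulr_ge0.
Qed.

Let clip_dist M x y : 0 <= M -> `|y| <= M -> `|y - clip M x| <= `|y - x|.
Proof.
move=> M0; rewrite ler_norml => /andP[y1 y2]; rewrite /clip.
have [h1|h1] := ler0P (x + M); have [h2|h2] := ler0P (x - M);
  rewrite ler_norml; apply/andP; split; have [?|?] := ler0P (y - x); lra.
Qed.

Let continuous_clip M : continuous (clip M).
Proof.
move=> x; apply: cvgM; last exact: cvg_cst.
apply: cvgB; apply: cvg_norm; first by apply: cvgD; [exact: cvg_id|exact: cvg_cst].
by apply: cvgB; [exact: cvg_id|exact: cvg_cst].
Qed.

Let trunc_set (v : RR -> R) (m : nat) : set RR := itv m `&` [set x | `|v x| <= m%:R].

Let measurable_trunc_set v m : measurable_fun setT v -> measurable (trunc_set v m).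
Proof.
move=> mv; apply: measurableI; first exact: measurable_itv.
rewrite (_ : [set x | _] = v @^-1` `[- m%:R, m%:R]%classic).
  by rewrite -[X in measurable X]setTI; apply: mv => //; exact: measurable_itv.
by apply/seteqP; split => x /=; rewrite in_itv/= ler_norml.
Qed.

Let trunc v m (x : RR) : R := v x * \1_(trunc_set v m) x.

Let measurable_trunc v m : measurable_fun setT v -> measurable_fun setT (trunc v m).
Proof.
move=> mv; apply: measurable_funM => //; apply: measurable_indic.
exact: measurable_trunc_set.
Qed.

Let trunc_cvg v : L2R leb v ->
  (\int[leb]_x ((v x - trunc v m x) ^+ 2)%:E @[m --> \oo] --> 0)%E.
Proof.
move=> v2; have [mv _] := v2.
rewrite -[X in _ --> X](@integral0 _ RR _ leb setT).
apply: (@dominated_cvg _ RR _ leb setT measurableT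
  (fun m x => ((v x - trunc v m x) ^+ 2)%:E) (cst 0%E) (fun x => (v x ^+ 2)%:E)).
- move=> m; apply/measurable_EFinP; apply: measurable_funX; apply: measurable_funB => //.
  exact: measurable_trunc.
- move=> x _; apply: cvg_near_cst; near=> m.
  have xm : trunc_set v m x.
    have h : (Num.truncn (Num.max `|x| `|v x|)).+1%:R <= m%:R :> R.
      by rewrite ler_nat; near: m; exact: nbhs_infty_ge.
    have h2 := lt_le_trans (truncnS_gt (Num.max `|x| `|v x|)) h.
    move: h2; rewrite gt_max => /andP[h3 h4]; split; first exact/itvE.
    by rewrite /= ltW.
  by rewrite /trunc indicE mem_set// mulr1 subrr expr0n.
- by [].
- exact: L2R_integrable_sqr.
- move=> m x _; rewrite gee0_abs ?lee_fin ?sqr_ge0// /trunc indicE.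
  by case: (_ \in _); rewrite ?mulr1 ?subrr ?mulr0 ?subr0 ?expr0n/= ?sqr_ge0.
Unshelve. all: by end_near.
Qed.

(** An L^1 approximation by continuous functions becomes an L^2 one: after clipping, which does not
    increase the distance, both functions are bounded by [m], so the squared difference is at most
    [2 m] times the difference. *)
Let trunc_approx v m e : measurable_fun setT v -> 0 < e ->
  exists h : R -> R, [/\ continuous h, (forall y, `|h y| <= m%:R) &
   (\int[leb]_x ((trunc v m x - h x * \1_(itv m) x) ^+ 2)%:E <= e%:E)%E].
Proof.
move=> mv e0; pose M : R := m%:R.
have tM x : `|trunc v m x| <= M.
  rewrite /trunc indicE; case: (boolP (_ \in _)) => [/set_mem[_]|_].
    by rewrite mulr1.
  by rewrite mulr0 normr0.
have mt := measurable_trunc m mv.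
have it : leb.-integrable (itv m) (EFin \o trunc v m).
  apply: measurable_bounded_integrable => //.
  - exact: itv_fin.
  - exact: measurable_funTS.
  - exists M; split; first exact: num_real.
    by move=> y My x _ /=; rewrite (le_trans (tM x))// ltW.
have [g [cg ig g0]] := approximation_continuous_integrable (measurable_itvm m) (itv_fin m) it.
(* The L^1 error gets multiplied by [2 * M]; the [+ 1] keeps the denominator positive when
   [m = 0]. *)
have e' : 0 < e / (2 * M + 1) by rewrite divr_gt0// ltr_wpDl// mulr_ge0// ler0n.
have [N _ HN] := cvg0e_near e' g0.
pose h := clip M \o g N.
have M0 : 0 <= M by exact: ler0n.
have ch : continuous h.
  by move=> x; apply: continuous_comp; [exact: cg|exact: continuous_clip].
exists h; split=> //.
  by move=> y; exact: clip_le.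
have mgN : measurable_fun setT (g N : RR -> R) by exact: measurable_realfun.continuous_measurable_fun.
have mh : measurable_fun setT (h : RR -> R) by exact: measurable_realfun.continuous_measurable_fun.
apply: (@le_trans _ _ (\int[leb]_(x in itv m) ((2 * M)%:E * `|(trunc v m x - g N x)%:E|))%E).
  rewrite [leRHS]integral_mkcond; apply: ge0_le_integral => //.
  - by move=> x _; rewrite lee_fin sqr_ge0.
  - apply/measurable_EFinP; apply: measurable_funX; apply: measurable_funB => //.
    by apply: measurable_funM => //; exact: measurable_indic.
  - apply/(measurable_restrictT _ _).1 => //.
    apply: measurable_funTS; apply: measurable_funeM; apply/measurable_EFinP.
    by apply: measurableT_comp => //; exact: measurable_funB.
  - move=> x _; rewrite patchE indicE; case: (boolP (x \in itv m)) => xI; last first.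
      rewrite mulr0 subr0 /trunc indicE (_ : (x \in _) = false) ?mulr0 ?expr0n//.
      apply/negbTE; apply: contra xI; rewrite !inE => -[]//.
    rewrite mulr1 -EFinM lee_fin -[leLHS]real_normK ?num_real// expr2.
    have h1 : `|trunc v m x - h x| <= `|trunc v m x - g N x| by exact: clip_dist.
    have h2 : `|trunc v m x - h x| <= 2 * M.
      rewrite (le_trans (ler_normB _ _))// mulr2n mulrDl mul1r lerD//.
      exact: clip_le.
    by rewrite ler_pM.
rewrite ge0_integralZl//; last 2 first.
- apply/measurable_EFinP; apply: measurableT_comp => //.
  by apply: measurable_funTS; exact: measurable_funB.
- by rewrite lee_fin mulr_ge0.
have := HN N (leqnn N) => /= HN'.
have M20 : 0 <= 2 * M by rewrite mulr_ge0.
apply: (le_trans (lee_wpmul2l _ HN')); first by rewrite lee_fin.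
rewrite -EFinM lee_fin mulrA ler_pdivrMr; last by rewrite ltr_wpDl.
by rewrite mulrDr mulr1 mulrC lerDl ltW.
Qed.

(** A density argument: truncate [v] in domain and in values, replace the result by a continuous
    function cut to an interval, and control the remainder by the bound that is uniform over
    kernels. *)
Theorem approx_identity_ker1 : approx_identity leb (fun k => ker1 k.+1%:R).
Proof.
have MK k : markov_kernel leb (ker1 k.+1%:R) by apply: markov_ker1; rewrite ltr0n.
split=> // v v2; have [mv _] := v2.
apply: ge0_cvg0e => [k|e e0]; first exact: dirichlet_ge0.
(* The budget is [e = 2 (e/6) + 2 * 4 * (2 (e/48) + 2 (e/48))]: the outer 2s from
   [dirichlet_le_add], the 4 from [dirichlet_le_sqr], the inner 2s from the square of a sum. *)
have e6 : 0 < e / 6 by rewrite divr_gt0.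
have e48 : 0 < e / 48 by rewrite divr_gt0.
have [m _ /(_ m (leqnn m)) Hm] := cvg0e_near e48 (trunc_cvg v2).
have [h [ch hM Hh]] := trunc_approx m mv e48.
pose G (x : RR) := h x * \1_(itv m) x.
have mh : measurable_fun setT (h : RR -> R) by exact: measurable_realfun.continuous_measurable_fun.
have mG : measurable_fun setT G by apply: measurable_funM => //; exact: measurable_indic.
have mt := measurable_trunc m mv.
have := cvg0e_near e6 (dirichlet_ker1_continuous m ch hM).
apply: filterS => k Hk.
apply: (le_trans (dirichlet_le_add (MK k) mv mG)).
have mvG : measurable_fun setT (fun x => v x - G x) by exact: measurable_funB.
have D2 := dirichlet_le_sqr (MK k) mvG.
have m1 : measurable_fun setT (fun x => ((v x - trunc v m x) ^+ 2)%:E).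
  by apply/measurable_EFinP; apply: measurable_funX; exact: measurable_funB.
have m2 : measurable_fun setT (fun x => ((trunc v m x - G x) ^+ 2)%:E).
  by apply/measurable_EFinP; apply: measurable_funX; exact: measurable_funB.
have I2 : (\int[leb]_x ((v x - G x) ^+ 2)%:E <= 2%:E * (e / 48)%:E + 2%:E * (e / 48)%:E)%E.
  apply: (@le_trans _ _ (2%:E * \int[leb]_x ((v x - trunc v m x) ^+ 2)%:E +
     2%:E * \int[leb]_x ((trunc v m x - G x) ^+ 2)%:E)%E); last first.
    by apply: leeD; rewrite lee_pmul2l.
  rewrite -!ge0_integralZl//; try by [move=> x _; rewrite lee_fin sqr_ge0].
  rewrite -ge0_integralD//; last 4 first.
  - by move=> x _; rewrite mule_ge0// lee_fin sqr_ge0.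
  - exact: measurable_funeM.
  - by move=> x _; rewrite mule_ge0// lee_fin sqr_ge0.
  - exact: measurable_funeM.
  apply: ge0_le_integral => //.
  - by move=> x _; rewrite lee_fin sqr_ge0.
  - by apply/measurable_EFinP; exact: measurable_funX.
  - by apply: emeasurable_funD; exact: measurable_funeM.
  - move=> x _; rewrite -!EFinM -EFinD lee_fin -subr_ge0.
    rewrite (_ : _ - _ = ((v x - trunc v m x) - (trunc v m x - G x)) ^+ 2) ?sqr_ge0//.
    by ring.
apply: (@le_trans _ _ (2%:E * (e / 6)%:E + 2%:E * (4%:E * (2%:E * (e / 48)%:E + 2%:E * (e / 48)%:E)))%E).
  apply: leeD; rewrite lee_pmul2l//.
  by apply: (le_trans D2); rewrite lee_pmul2l.
by rewrite !(=^~ EFinM, =^~ EFinD) lee_fin; lra.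
Qed.

End gaussian_kernel_1d.

(** * Recovering the norm of a function from its averages *)

Section averaging.
Context d (T : measurableType d) (R : realType).
Variable m : {sigma_finite_measure set T -> \bar R}.

Definition average (K : T -> T -> R) (v : T -> R) (x : T) : R :=
  \int[m]_y (K x y * v y).

Lemma measurable_average K v : markov_kernel m K -> measurable_fun setT v ->
  measurable_fun setT (average K v).
Proof.
move=> [mK _ _ _] mv.
have h : measurable_fun setT (fun z : T * T => K z.1 z.2 * v z.2).
  by apply: measurable_funM => //; exact: measurableT_comp.
exact: (measurable_Rintegral_param m h).
Qed.

(** The integral of [K x y * (c - v y) ^+ 2] is the quadratic [c^2 - 2 c A + S], minimal at the
    average [A]. Its values at [c = v x] and [c = A] differ by exactly [(v x - A)^2], and the latter
    is nonnegative. The bound on [K] makes all these integrals finite at every [x]. *)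
Lemma average_sub_sqr_le K C v x : markov_kernel m K -> (forall x y, K x y <= C) ->
  L2R m v ->
  (((v x - average K v x) ^+ 2)%:E <= \int[m]_y (K x y * (v x - v y) ^+ 2)%:E)%E.
Proof.
move=> MK KC v2; have [mK K0 symK K1] := MK; have [mv _] := v2.
have mKx := measurable_kernel_section x MK.
have iK : m.-integrable setT (EFin \o K x).
  by apply: integrableR_ge0P => //; rewrite K1 ltry.
have C0 : 0 <= C by exact: le_trans (K0 x x) (KC x x).
have iKv2 : m.-integrable setT (EFin \o (fun y => K x y * v y ^+ 2)).
  apply: integrableR_le (integrableRZ C (L2R_integrable_sqr v2)).
    by apply: measurable_funM => //; exact: measurable_funX.
  move=> y; rewrite ger0_norm; last by rewrite mulr_ge0 ?sqr_ge0.
  by rewrite ler_wpM2r ?sqr_ge0.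
have iKv : m.-integrable setT (EFin \o (fun y => K x y * v y)).
  apply: integrableR_le (integrableRD iK iKv2); first exact: measurable_funM.
  move=> y; rewrite normrM (ger0_norm (K0 _ _)) -[X in _ <= X + _]mulr1 -mulrDr.
  rewrite ler_wpM2l// -[v y ^+ 2]real_normK ?num_real//.
  by have := sqr_ge0 (`|v y| - 1); have := normr_ge0 (v y); nra.
set A := average K v x; pose S := \int[m]_y (K x y * v y ^+ 2).
have Q c : (\int[m]_y (K x y * (c - v y) ^+ 2)%:E = (c ^+ 2 - 2 * c * A + S)%:E)%E.
  under eq_integral => y _.
    rewrite (_ : K x y * _ = c ^+ 2 * K x y - (2 * c) * (K x y * v y) + K x y * v y ^+ 2); last by ring.
    over.
  have i1 := integrableRZ (c ^+ 2) iK; have i2 := integrableRZ (2 * c) iKv.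
  rewrite -EFin_Rintegral; last by apply: integrableRD => //; exact: integrableRB.
  rewrite RintegralD//; last exact: integrableRB.
  rewrite RintegralB// RintegralZl// RintegralZl//.
  have -> : \int[m]_y K x y = 1 by rewrite /Rintegral K1.
  by rewrite mulr1.
have : (0 <= \int[m]_y (K x y * (A - v y) ^+ 2)%:E)%E.
  by apply: integral_ge0 => y _; rewrite lee_fin mulr_ge0 ?sqr_ge0.
rewrite !Q !lee_fin => h.
by rewrite -subr_ge0 (_ : _ - _ = A ^+ 2 - 2 * A * A + S)//; ring.
Qed.

(* [|v|^2 <= 2 |K v|^2 + 2 |v - K v|^2], where [|v - K v|^2] is at most the
   Dirichlet form of [v]. *)
Lemma sqr_integral_le_average (K : nat -> T -> T -> R) (C : nat -> R) (v : T -> R) (B : R) :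
  approx_identity m K -> (forall k x y, K k x y <= C k) -> L2R m v ->
  (forall k, \int[m]_x (average (K k) v x ^+ 2)%:E <= B%:E)%E ->
  (\int[m]_x (v x ^+ 2)%:E <= (2 * B)%:E)%E.
Proof.
move=> [MK aK] KC v2 HB; have [mv _] := v2.
apply/lee_addgt0Pr => e e0.
have e2 : 0 < e / 2 by rewrite divr_gt0.
have [k _ /(_ k (leqnn k)) Hk] := cvg0e_near e2 (aK v v2).
have mA := measurable_average (MK k) mv.
have mA2 : measurable_fun setT (fun x => (average (K k) v x ^+ 2)%:E).
  by apply/measurable_EFinP; exact: measurable_funX.
have mB2 : measurable_fun setT (fun x => ((v x - average (K k) v x) ^+ 2)%:E).
  by apply/measurable_EFinP; apply: measurable_funX; exact: measurable_funB.
have K0 x y : 0 <= K k x y by case: (MK k).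
have I2 : (\int[m]_x ((v x - average (K k) v x) ^+ 2)%:E <= (e / 2)%:E)%E.
  apply: le_trans Hk; rewrite /dirichlet fubini_tonelli1; last 2 first.
  - exact: (measurable_dirichlet (MK k) mv).
  - by move=> z; rewrite lee_fin mulr_ge0 ?sqr_ge0.
  apply: ge0_le_integral => //.
  - by move=> x _; rewrite lee_fin sqr_ge0.
  - apply: measurable_fun_fubini_tonelli_F.
      exact: (measurable_dirichlet (MK k) mv).
    by move=> z; rewrite lee_fin mulr_ge0 ?sqr_ge0.
  - by move=> x _; exact: (average_sub_sqr_le _ (MK k) (KC k)).
apply: (@le_trans _ _ (2%:E * \int[m]_x (average (K k) v x ^+ 2)%:E +
  2%:E * \int[m]_x ((v x - average (K k) v x) ^+ 2)%:E)%E).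
  rewrite -!ge0_integralZl//; try by [move=> x _; rewrite lee_fin sqr_ge0].
  rewrite -ge0_integralD//; last 4 first.
  - by move=> x _; rewrite mule_ge0// lee_fin sqr_ge0.
  - exact: measurable_funeM.
  - by move=> x _; rewrite mule_ge0// lee_fin sqr_ge0.
  - exact: measurable_funeM.
  apply: ge0_le_integral => //.
  - by move=> x _; rewrite lee_fin sqr_ge0.
  - by apply/measurable_EFinP; exact: measurable_funX.
  - by apply: emeasurable_funD; exact: measurable_funeM.
  - move=> x _; rewrite -!EFinM -EFinD lee_fin -subr_ge0.
    rewrite (_ : _ - _ = (average (K k) v x - (v x - average (K k) v x)) ^+ 2) ?sqr_ge0//.
    by ring.
have -> : ((2 * B)%:E + e%:E = 2%:E * B%:E + 2%:E * (e / 2)%:E)%E.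
  by rewrite -!EFinM -!EFinD; congr EFin; field.
by apply: leeD; rewrite lee_pmul2l.
Qed.

End averaging.

(** * The heat kernel on R^n *)

Section gaussian_kernel_Rn.
Context {R : realType}.
Local Notation leb := (@lebesgue_measure R).

Definition kerRn n (s : R) (x y : Rn R n) : R :=
  (gauss_mass n s)^-1 * gaussRn s (subRn x y).

Lemma kerRn_le n s (x y : Rn R n) : 0 < s -> kerRn s x y <= (gauss_mass n s)^-1.
Proof.
move=> s0; rewrite ler_piMr ?(gaussRn_le1 _ (ltW s0))//.
by rewrite invr_ge0 (ltW (gauss_mass_gt0 n s0)).
Qed.

Lemma markov_kerRn n s : 0 < s -> markov_kernel (lebesgueRn R n) (@kerRn n s).
Proof.
move=> s0; have c0 := gauss_mass_gt0 n s0; split.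
- apply: measurable_funM => //; apply: measurable_fun_gaussRn.
  exact: measurable_fun_subRn.
- by move=> x y; rewrite mulr_ge0 ?gaussRn_ge0// invr_ge0 ltW.
- by move=> x y; rewrite /kerRn gaussRn_subC.
- move=> x; under eq_integral do rewrite /kerRn EFinM gaussRn_subC.
  rewrite ge0_integralZl//; last 3 first.
  + by apply/measurable_EFinP/measurable_fun_gaussRn; exact: measurable_fun_subRn.
  + by move=> y _; rewrite lee_fin gaussRn_ge0.
  + by rewrite lee_fin invr_ge0 ltW.
  by rewrite integral_gaussRn_sub// -EFinM mulVf// gt_eqF.
Qed.

Lemma kerRn_cons n s (p q : measurableTypeR R * Rn R n) :
  kerRn s (cons_pair p) (cons_pair q) = prod_kernel (ker1 s) (@kerRn n s) p q.
Proof.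
case: p => a x; case: q => b y.
rewrite /prod_kernel/= /kerRn /ker1 subRn_cons gaussRn_cons /gauss_mass exprS invfM.
by rewrite mulrACA.
Qed.

Lemma ge0_integral_cons_prod n (f : Rn R n.+1 -> \bar R) :
  measurable_fun setT f -> (forall x, 0 <= f x)%E ->
  (\int[lebesgueRn R n.+1]_x f x =
   \int[prod_measure leb (lebesgueRn R n)]_p f (cons_pair p))%E.
Proof.
move=> mf f0; rewrite [in LHS]/= /lebesgue_cons integral_prod_measure.
by rewrite (@ge0_integral_pushforward _ _ _ _ _ _ measurable_cons_pair).
Qed.

Lemma dirichlet_cons n s (v : Rn R n.+1 -> R) : 0 < s -> measurable_fun setT v ->
  dirichlet (lebesgueRn R n.+1) (@kerRn n.+1 s) v =
  dirichlet (prod_measure leb (lebesgueRn R n)) (prod_kernel (ker1 s) (@kerRn n s))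
    (v \o cons_pair).
Proof.
move=> s0 mv.
have MK := markov_kerRn n.+1 s0.
have [_ K0 _ _] := MK.
have mvc : measurable_fun setT (v \o cons_pair).
  by apply: measurableT_comp => //; exact: measurable_cons_pair.
have MP := markov_prod_kernel (markov_ker1 s0) (markov_kerRn n s0).
have [_ P0 _ _] := MP.
rewrite /dirichlet fubini_tonelli1; last 2 first.
- exact: (measurable_dirichlet MK mv).
- by move=> z; rewrite lee_fin mulr_ge0 ?sqr_ge0.
rewrite fubini_tonelli1; last 2 first.
- exact: (measurable_dirichlet MP mvc).
- by move=> z; rewrite lee_fin mulr_ge0 ?sqr_ge0.
rewrite ge0_integral_cons_prod; last 2 first.
- apply: measurable_fun_fubini_tonelli_F; first exact: (measurable_dirichlet MK mv).
  by move=> z; rewrite lee_fin mulr_ge0 ?sqr_ge0.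
- by move=> x; apply: integral_ge0 => y _; rewrite lee_fin mulr_ge0 ?sqr_ge0.
apply: eq_integral => p _; rewrite /fubini_F ge0_integral_cons_prod; last 2 first.
- exact: (measurableT_comp (measurable_dirichlet MK mv) (pair1_measurable (cons_pair p))).
- by move=> y; rewrite lee_fin mulr_ge0 ?sqr_ge0.
by apply: eq_integral => q _; rewrite kerRn_cons.
Qed.

(** [cons_pair] identifies the kernel in dimension [n+1] with the product of those in dimensions 1
    and [n]. In dimension 0 there is a single point and all differences vanish. *)
Theorem approx_identity_kerRn n :
  approx_identity (lebesgueRn R n) (fun k => @kerRn n k.+1%:R).
Proof.
elim: n => [|n IH].
  split=> [k|v _]; first by apply: markov_kerRn; rewrite ltr0n.
  rewrite (_ : (fun k => _) = cst 0%E); first exact: cvg_cst.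
  apply/funext => k /=; rewrite /dirichlet.
  under eq_integral => z _ do rewrite (tuple0 z.1) (tuple0 z.2) subrr expr0n mulr0.
  by rewrite integral0.
split=> [k|v v2]; first by apply: markov_kerRn; rewrite ltr0n.
have [mv vi] := v2.
have [_ H] := approx_identity_prod approx_identity_ker1 IH.
have := H (v \o cons_pair) _.
rewrite (_ : (fun k => dirichlet (lebesgueRn R n.+1) _ _) = (fun k =>
  dirichlet (prod_measure leb (lebesgueRn R n))
     (prod_kernel (ker1 k.+1%:R) (@kerRn n k.+1%:R)) (v \o cons_pair))); last first.
  by apply/funext => k; rewrite dirichlet_cons// ltr0n.
apply; split.
  by apply: measurableT_comp => //; exact: measurable_cons_pair.
rewrite ge0_integral_cons_prod in vi => //.
  by apply/measurable_EFinP; exact: measurable_funX.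
by move=> x; rewrite lee_fin sqr_ge0.
Qed.

Lemma sqr_integral_le_heat n (v : Rn R n -> R) (B : R) : L2R (lebesgueRn R n) v ->
  (forall s : R, 0 < s ->
    (\int[lebesgueRn R n]_x (average (lebesgueRn R n) (@kerRn n s) v x ^+ 2)%:E <= B%:E)%E) ->
  (\int[lebesgueRn R n]_x (v x ^+ 2)%:E <= (2 * B)%:E)%E.
Proof.
move=> v2 HB.
apply: (sqr_integral_le_average (approx_identity_kerRn n)
  (C := fun k => (gauss_mass n k.+1%:R)^-1)) => //.
- by move=> k x y; apply: kerRn_le; rewrite ltr0n.
- by move=> k; apply: HB; rewrite ltr0n.
Qed.

End gaussian_kernel_Rn.

(** * Gaussians as Schwartz functions *)

Section schwartz_gaussians.
Context {R : realType} {n : nat}.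
Implicit Types (x w y : Rn R n) (s th c : R).
Local Notation normc := ComplexField.Normc.normc.

Lemma normRn_ge0 x : 0 <= normRn x. Proof. exact: sqrtr_ge0. Qed.

Lemma sqr_normRn x : normRn x ^+ 2 = dotRn x x.
Proof. by rewrite sqr_sqrtr// dotRn_ge0. Qed.

Lemma gaussRn_normRn s x : gaussRn s x = gauss1 s (normRn x).
Proof. by rewrite /gaussRn /gauss1 sqr_normRn. Qed.

Lemma normr_tnth_le x i : `|tnth x i : R| <= normRn x.
Proof.
rewrite -ler_sqr ?nnegrE ?normRn_ge0// real_normK ?num_real// sqr_normRn.
rewrite /dotRn (bigD1 i)//= -expr2 lerDl.
by apply: sumr_ge0 => j _; rewrite -expr2 sqr_ge0.
Qed.

Lemma gauss1_le1 s (r : R) : 0 <= s -> gauss1 s r <= 1.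
Proof.
by move=> s0; rewrite -expR0 ler_expR oppr_le0 mulr_ge0 ?sqr_ge0// divr_ge0.
Qed.

(** Each factor [1 + r] is paid for with half of the remaining exponent, so [s] must vary in the
    induction. *)
Lemma gauss1_decay (N : nat) s : 0 < s ->
  exists M : R, forall r : R, 0 <= r -> (1 + r) ^+ N * gauss1 s r <= M.
Proof.
elim: N s => [|N IH] s s0.
  by exists 1 => r _; rewrite expr0 mul1r gauss1_le1// ltW.
have s20 : 0 < s / 2 by rewrite divr_gt0.
have [M HM] := IH _ s20.
exists (M * (1 + (1 + 4 / (s / 2)))) => r r0.
have -> : gauss1 s r = gauss1 (s / 2) r * gauss1 (s / 2) r.
  by rewrite /gauss1 -expRD; congr expR; field.
rewrite (_ : _ * _ = (1 + r) ^+ N * gauss1 (s / 2) r * ((1 + r) * gauss1 (s / 2) r)); last first.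
  by rewrite exprS; ring.
have r10 : 0 <= 1 + r by rewrite addr_ge0.
rewrite ler_pM//.
- by rewrite mulr_ge0 ?gauss1_ge0// exprn_ge0.
- by rewrite mulr_ge0 ?gauss1_ge0.
- exact: HM.
- rewrite mulrDl mul1r lerD//; first by rewrite gauss1_le1// ltW.
  have := normr_gauss1_le r s20; rewrite ger0_norm// => /le_trans; apply.
  rewrite ler_piMr//; first by rewrite addr_ge0// divr_ge0// ltW.
  by rewrite gauss1_le1// divr_ge0// ltW.
Qed.

(** By [|x|^2 <= 2 |x - y|^2 + 2 |y|^2]. It recentres the Gaussian at the origin, where the weight
    [1 + normRn x] of the Schwartz seminorms lives. *)
Lemma gaussRn_sub_le s x y : 0 < s ->
  gaussRn s (subRn x y) <= expR (s / 2 * dotRn y y) * gaussRn (s / 2) x.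
Proof.
move=> s0; rewrite /gaussRn -expRD ler_expR.
have h : dotRn x x <= 2 * dotRn (subRn x y) (subRn x y) + 2 * dotRn y y.
  rewrite /dotRn !mulr_sumr -big_split/=; apply: ler_sum => i _.
  rewrite !tnth_mktuple -subr_ge0; set a := tnth x i; set b := tnth y i.
  rewrite (_ : _ - _ = ((a : R) - 2 * (b : R)) ^+ 2) ?sqr_ge0//.
  by ring.
rewrite -(ler_pM2l s0) in h; nra.
Qed.

Lemma shiftRn0 i x : shiftRn i x 0 = x.
Proof. by apply/eq_from_tnth => j; rewrite tnth_mktuple mulr0 addr0. Qed.

Lemma is_derive_tnth_shift i x j :
  is_derive (0 : R) 1 (fun h : R => tnth (shiftRn i x h) j : R) ((j == i)%:R : R).
Proof.
have -> : (fun h : R => tnth (shiftRn i x h) j : R) =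
    (fun h : R => (j == i)%:R * h + (tnth x j : R)).
  by apply/funext => h; rewrite tnth_mktuple addrC.
exact: is_derive_affine.
Qed.

Lemma is_derive_sum_seq (I : Type) (r : seq I) (F : I -> R -> R) (dF : I -> R) (t : R) :
  (forall i, is_derive t 1 (F i) (dF i)) ->
  is_derive t 1 (fun h => \sum_(i <- r) F i h) (\sum_(i <- r) dF i).
Proof.
move=> dFi; elim: r => [|j r IH].
  rewrite big_nil (_ : (fun h => _) = cst 0).
    exact: is_derive_cst.
  by apply/funext => h; rewrite big_nil.
rewrite big_cons (_ : (fun h => _) = (fun h => F j h + \sum_(i <- r) F i h)).
  exact: is_deriveD.
by apply/funext => h; rewrite big_cons.
Qed.

Lemma is_derive_dotRn_shift i w x :
  is_derive (0 : R) 1 (fun h : R => dotRn w (shiftRn i x h)) (tnth w i : R).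
Proof.
have -> : (tnth w i : R) = \sum_(j < n) (tnth w j : R) * ((j == i)%:R : R).
  rewrite (bigD1 i)//= eqxx mulr1 big1 ?addr0// => j /negbTE ->.
  by rewrite mulr0.
apply: is_derive_sum_seq => j.
have h := is_derive_tnth_shift i x j.
have h' : is_derive (0 : R) 1 (fun h : R => (tnth w j : R) *: (tnth (shiftRn i x h) j : R))
   ((tnth w j : R) *: ((j == i)%:R : R)) by exact: is_deriveZ.
exact: h'.
Qed.

Lemma is_derive_sqr_sub_shift i x y :
  is_derive (0 : R) 1 (fun h : R => dotRn (subRn (shiftRn i x h) y) (subRn (shiftRn i x h) y))
   (2 * ((tnth x i : R) - (tnth y i : R))).
Proof.
have -> : 2 * ((tnth x i : R) - (tnth y i : R)) =
    \sum_(j < n) 2 * ((tnth x j : R) - (tnth y j : R)) * ((j == i)%:R : R).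
  rewrite (bigD1 i)//= eqxx mulr1 big1 ?addr0// => j /negbTE ->.
  by rewrite mulr0.
apply: is_derive_sum_seq => j.
have -> : (fun h : R => (tnth (subRn (shiftRn i x h) y) j : R) * (tnth (subRn (shiftRn i x h) y) j : R)) =
   (fun h : R => ((j == i)%:R * h + ((tnth x j : R) - (tnth y j : R))) *
                 ((j == i)%:R * h + ((tnth x j : R) - (tnth y j : R)))).
  by apply/funext => h; rewrite !tnth_mktuple addrAC -addrA [_ * h + _]addrC addrA.
have h1 := is_derive_affine ((j == i)%:R) ((tnth x j : R) - (tnth y j : R)) 0.
have h2 := @is_deriveM _ _ _ _ _ _ _ _ h1 h1.
by apply: (is_derive_eq h2); rewrite /GRing.scale/= mulr0 add0r; ring.
Qed.

Variables (s : R) (w y0 : Rn R n).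
Hypothesis s0 : 0 < s.

Definition modulated_gauss th x : R := gaussRn s (subRn x y0) * cos (dotRn w x + th).

(* The phases [th] account for sines, so that derivatives stay in the class. *)
Inductive gauss_class : (Rn R n -> R) -> Prop :=
| gauss_class_base th : gauss_class (modulated_gauss th)
| gauss_classD f g : gauss_class f -> gauss_class g -> gauss_class (fun x => f x + g x)
| gauss_classZ c f : gauss_class f -> gauss_class (fun x => c * f x)
| gauss_class_coord i f : gauss_class f -> gauss_class (fun x => (tnth x i : R) * f x).

Lemma gauss_class_derive i f : gauss_class f -> exists2 g, gauss_class g &
  forall x, is_derive (0 : R) 1 (fun h : R => f (shiftRn i x h)) (g x).
Proof.
elim=> {f} [th|f1 f2 _ [g1 c1 d1] _ [g2 c2 d2]|c f _ [g cg dg]|j f cf [g cg dg]].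
(* The Gaussian factor contributes [- s (x_i - y0_i)]; the derivative of the cosine is [w_i] times
   the cosine advanced by [pi / 2]. *)
- exists (fun x => - s * ((tnth x i : R) * modulated_gauss th x) +
     (s * (tnth y0 i : R) * modulated_gauss th x +
      (tnth w i : R) * modulated_gauss (th + pi / 2) x)).
    do 2?apply: gauss_classD; do ?apply: gauss_classZ; do ?apply: gauss_class_coord;
      exact: gauss_class_base.
  move=> x.
  have hq := is_derive_sqr_sub_shift i x y0.
  have hg : is_derive (0 : R) 1 (fun h : R => gaussRn s (subRn (shiftRn i x h) y0))
     (- (s * ((tnth x i : R) - (tnth y0 i : R))) * gaussRn s (subRn x y0)).
    have hm : is_derive (0 : R) 1
        (fun h : R => (- (s / 2)) *: dotRn (subRn (shiftRn i x h) y0) (subRn (shiftRn i x h) y0))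
        (- (s / 2) *: (2 * ((tnth x i : R) - (tnth y0 i : R)))) by exact: is_deriveZ.
    have he := @is_derive1_comp _ expR _ 0 _ _ (is_derive_expR _) hm.
    have -> : (fun h : R => gaussRn s (subRn (shiftRn i x h) y0)) =
      expR \o (fun h : R => (- (s / 2)) *: dotRn (subRn (shiftRn i x h) y0) (subRn (shiftRn i x h) y0)).
      by apply/funext => h; rewrite /gaussRn /= /GRing.scale/= mulNr.
    apply: (is_derive_eq he).
    by rewrite shiftRn0 /gaussRn /GRing.scale/= mulNr mulrC; congr (_ * _); field.
  have hd : is_derive (0 : R) 1 (fun h : R => dotRn w (shiftRn i x h) + th) (tnth w i : R).
    have := is_deriveD (is_derive_dotRn_shift i w x) (is_derive_cst th (0 : R) 1).
    by rewrite addr0.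
  have hc := @is_derive1_comp _ cos _ 0 _ _ (is_derive_cos _) hd.
  have hM := @is_deriveM _ _ _ _ _ _ _ _ hg hc.
  apply: (is_derive_eq hM).
  have E : cos (dotRn w x + (th + pi / 2)) = - sin (dotRn w x + th).
    by rewrite addrA cosDpihalf.
  by rewrite /= shiftRn0 /modulated_gauss E /GRing.scale/=; ring.
- exists (fun x => g1 x + g2 x); first exact: gauss_classD.
  by move=> x; exact: is_deriveD.
- exists (fun x => c * g x); first exact: gauss_classZ.
  move=> x; have h := dg x.
  have h' : is_derive (0 : R) 1 (fun h : R => c *: f (shiftRn i x h)) (c *: g x).
    exact: is_deriveZ.
  exact: h'.
- exists (fun x => (j == i)%:R * f x + (tnth x j : R) * g x).
    by apply: gauss_classD; [exact: gauss_classZ|exact: gauss_class_coord].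
  move=> x; have h1 := is_derive_tnth_shift i x j.
  have hM := @is_deriveM _ _ _ _ _ _ _ _ h1 (dg x).
  by apply: (is_derive_eq hM); rewrite shiftRn0 /GRing.scale/= addrC [f x * _]mulrC.
Qed.

(** [N] is quantified inside the induction because a coordinate factor is absorbed by passing from
    [N] to [N.+1]. *)
Lemma gauss_class_decay f : gauss_class f -> forall N, exists M : R, forall x,
  (1 + normRn x) ^+ N * `|f x| <= M.
Proof.
have n0 x N : 0 <= (1 + normRn x) ^+ N by rewrite exprn_ge0// addr_ge0// normRn_ge0.
elim=> {f} [th|f1 f2 _ H1 _ H2|c f _ H|j f cf H] N.
- have s20 : 0 < s / 2 by rewrite divr_gt0.
  have [M HM] := gauss1_decay N s20.
  exists (expR (s / 2 * dotRn y0 y0) * M) => x.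
  rewrite normrM (ger0_norm (gaussRn_ge0 _ _)).
  apply: (@le_trans _ _ ((1 + normRn x) ^+ N * gaussRn s (subRn x y0))).
    by rewrite ler_wpM2l// ler_piMr ?gaussRn_ge0// cos_max.
  apply: (le_trans (ler_wpM2l (n0 x N) (gaussRn_sub_le x y0 s0))).
  rewrite mulrCA ler_wpM2l ?expR_ge0// gaussRn_normRn.
  exact: HM (normRn_ge0 x).
- have [M1 HM1] := H1 N; have [M2 HM2] := H2 N; exists (M1 + M2) => x.
  apply: (@le_trans _ _ ((1 + normRn x) ^+ N * `|f1 x| + (1 + normRn x) ^+ N * `|f2 x|)).
    by rewrite -mulrDr ler_wpM2l// ler_normD.
  by rewrite lerD.
- have [M HM] := H N; exists (`|c| * M) => x.
  by rewrite normrM mulrCA ler_wpM2l.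
- have [M HM] := H N.+1; exists M => x; apply: le_trans (HM x).
  rewrite normrM exprS -mulrA mulrCA ler_wpM2r//.
    by rewrite mulr_ge0.
  by rewrite (le_trans (normr_tnth_le x j))// lerDr.
Qed.

Definition gauss_classC (phi : Rn R n -> R[i]) := exists f g,
  [/\ gauss_class f, gauss_class g & phi = fun x => Complex (f x) (g x)].

Lemma gauss_classC_partial i phi : gauss_classC phi ->
  (forall x, partial_derivable i phi x) /\ gauss_classC (partial i phi).
Proof.
move=> [f [g [cf cg ->]]].
have [f' cf' df'] := gauss_class_derive i cf.
have [g' cg' dg'] := gauss_class_derive i cg.
split=> [x|].
  by split; [case: (df' x)|case: (dg' x)].
exists f', g'; split => //; apply/funext => x.
by rewrite /partial !derive1E/=; case: (df' x) => _ ->; case: (dg' x) => _ ->.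
Qed.

Lemma gauss_classC_partials l phi : gauss_classC phi -> gauss_classC (partials l phi).
Proof. by move=> cphi; elim: l => //= i l IH; case: (gauss_classC_partial i IH). Qed.

Lemma normc_le_add (a b : R) : normc (Complex a b) <= `|a| + `|b|.
Proof.
rewrite /normc -[leRHS]ger0_norm ?addr_ge0// -sqrtr_sqr ler_wsqrtr//.
rewrite sqrrD !real_normK ?num_real// [leRHS]addrAC lerDl.
by rewrite mulrn_wge0// mulr_ge0.
Qed.

Lemma schwartz_gauss_classC phi : gauss_classC phi -> schwartz phi.
Proof.
move=> cphi l; have cl := gauss_classC_partials l cphi; split.
  by move=> i; case: (gauss_classC_partial i cl).
move=> N; have [f [g [cf cg ->]]] := cl.
have [M1 H1] := gauss_class_decay cf N; have [M2 H2] := gauss_class_decay cg N.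
exists (M1 + M2) => x.
have n0 : 0 <= (1 + normRn x) ^+ N by rewrite exprn_ge0// addr_ge0// normRn_ge0.
apply: (le_trans (ler_wpM2l n0 (normc_le_add _ _))).
by rewrite mulrDr lerD.
Qed.

End schwartz_gaussians.

(** * Fourier transforms of square-integrable functions *)

Section complex_L2.
Context {R : realType} {n : nat}.
Local Notation mu := (lebesgueRn R n).
Local Notation normc := ComplexField.Normc.normc.
Implicit Types (u h : Rn R n -> R[i]).

Lemma sqr_normc (z : R[i]) : normc z ^+ 2 = complex.Re z ^+ 2 + complex.Im z ^+ 2.
Proof. by case: z => a b; rewrite /normc sqr_sqrtr// addr_ge0 ?sqr_ge0. Qed.

Lemma inL2P u : inL2 u ->
  L2R mu (fun x => complex.Re (u x)) /\ L2R mu (fun x => complex.Im (u x)).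
Proof.
move=> [[mr mi] u2]; split; split => //; apply: le_lt_trans u2;
  (apply: ge0_le_integral => //;
  [by move=> x _; rewrite lee_fin sqr_ge0
  |by apply/measurable_EFinP; exact: measurable_funX
  | |by move=> x _; rewrite lee_fin sqr_normc ?lerDl ?lerDr sqr_ge0]);
  apply/measurable_EFinP;
  rewrite (_ : (fun x => _) = fun x => complex.Re (u x) ^+ 2 + complex.Im (u x) ^+ 2);
    try (by apply/funext => x; rewrite sqr_normc);
  by apply: measurable_funD; exact: measurable_funX.
Qed.

Lemma L2R_kerRn s (w : Rn R n) : 0 < s -> L2R mu (kerRn s w).
Proof.
move=> s0; have [mK K0 _ K1] := markov_kerRn n s0.
have mKw := measurable_kernel_section w (markov_kerRn n s0).
split=> //; apply: integrableR_ltoo => [x|]; first exact: sqr_ge0.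
have iK : mu.-integrable setT (EFin \o kerRn s w).
  by apply: integrableR_ge0P => //; rewrite K1 ltry.
apply: integrableR_le (integrableRZ (gauss_mass n s)^-1 iK).
  exact: measurable_funX.
move=> x; rewrite ger0_norm ?sqr_ge0// expr2 ler_wpM2r//.
exact: kerRn_le.
Qed.

Lemma L2R_gaussRn s : 0 < s -> L2R mu (gaussRn s).
Proof.
move=> s0; have := L2RZ (gauss_mass n s) (L2R_kerRn (zeroRn n) s0).
congr L2R; apply/funext => x; rewrite /kerRn mulVKf ?gt_eqF ?gauss_mass_gt0//.
by rewrite gaussRn_subC subRn0.
Qed.

Lemma L2R_mul_gaussRn s (p : Rn R n -> R) : 0 < s -> L2R mu p ->
  L2R mu (fun x => p x * gaussRn s x).
Proof.
move=> s0 p2; have [mp _] := p2; apply: L2R_le p2.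
  by apply: measurable_funM => //; exact: measurable_fun_gaussRn.
move=> x; rewrite exprMn ler_piMr ?sqr_ge0//.
by rewrite exprn_ile1 ?gaussRn_ge0 ?(gaussRn_le1 _ (ltW s0)).
Qed.

Lemma integrable_mul_gaussRn s (p : Rn R n -> R) : 0 < s -> L2R mu p ->
  mu.-integrable setT (EFin \o (fun x => p x * gaussRn s x)).
Proof. by move=> s0 p2; apply: integrable_L2RM => //; exact: L2R_gaussRn. Qed.

Lemma integrable_mul_gaussRn_cos s (p : Rn R n -> R) (w : Rn R n) : 0 < s -> L2R mu p ->
  mu.-integrable setT (EFin \o (fun x => p x * gaussRn s x * cos (dotRn w x))).
Proof.
move=> s0 p2; apply: integrableR_le (integrable_abse (integrable_mul_gaussRn s0 p2)).
  apply: measurable_funM; last by apply: measurable_fun_cos; exact: measurable_fun_dotRn.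
  exact: integrable_measurableR (integrable_mul_gaussRn s0 p2).
by move=> x /=; rewrite normrM ler_piMr// cos_max.
Qed.

Lemma integrable_mul_gaussRn_sin s (p : Rn R n -> R) (w : Rn R n) : 0 < s -> L2R mu p ->
  mu.-integrable setT (EFin \o (fun x => p x * gaussRn s x * sin (dotRn w x))).
Proof.
move=> s0 p2; apply: integrableR_le (integrable_abse (integrable_mul_gaussRn s0 p2)).
  apply: measurable_funM; last by apply: measurable_fun_sin; exact: measurable_fun_dotRn.
  exact: integrable_measurableR (integrable_mul_gaussRn s0 p2).
by move=> x /=; rewrite normrM ler_piMr// sin_max.
Qed.

Lemma integrable_kerRn_mul s (u : Rn R n -> R) (w : Rn R n) : 0 < s -> L2R mu u ->
  mu.-integrable setT (EFin \o (fun x => kerRn s w x * u x)).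
Proof. by move=> s0 u2; apply: integrable_L2RM => //; exact: L2R_kerRn. Qed.

(* Real form of the identity between [u = u1 + i u2] and [p + i q] which says that
   the latter is the Fourier transform of the former, tested against the Gaussians
   [exp (i w.x) * gaussRn s x] only. *)
Definition heat_pair (u1 u2 p q : Rn R n -> R) := forall (s : R) (w : Rn R n), 0 < s ->
  (2 * pi) ^+ n * average mu (kerRn s^-1) u1 w =
    cos_transform (fun x => p x * gaussRn s x) w - sin_transform (fun x => q x * gaussRn s x) w /\
  (2 * pi) ^+ n * average mu (kerRn s^-1) u2 w =
    sin_transform (fun x => p x * gaussRn s x) w + cos_transform (fun x => q x * gaussRn s x) w.

Let averageB s (u v : Rn R n -> R) w : 0 < s -> L2R mu u -> L2R mu v ->
  average mu (kerRn s) (fun x => u x - v x) w =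
  average mu (kerRn s) u w - average mu (kerRn s) v w.
Proof.
move=> s0 u2 v2; rewrite /average -RintegralB//; [|exact: integrable_kerRn_mul..].
by apply: eq_Rintegral => x _; rewrite mulrBr.
Qed.

Let cos_transformB s (p q : Rn R n -> R) w : 0 < s -> L2R mu p -> L2R mu q ->
  cos_transform (fun x => (p x - q x) * gaussRn s x) w =
  cos_transform (fun x => p x * gaussRn s x) w - cos_transform (fun x => q x * gaussRn s x) w.
Proof.
move=> s0 p2 q2; rewrite /cos_transform -RintegralB//; [|exact: integrable_mul_gaussRn_cos..].
by apply: eq_Rintegral => x _; rewrite !mulrBl.
Qed.

Let sin_transformB s (p q : Rn R n -> R) w : 0 < s -> L2R mu p -> L2R mu q ->
  sin_transform (fun x => (p x - q x) * gaussRn s x) w =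
  sin_transform (fun x => p x * gaussRn s x) w - sin_transform (fun x => q x * gaussRn s x) w.
Proof.
move=> s0 p2 q2; rewrite /sin_transform -RintegralB//; [|exact: integrable_mul_gaussRn_sin..].
by apply: eq_Rintegral => x _; rewrite !mulrBl.
Qed.

Lemma heat_pairB (u1 u2 p q u1' u2' p' q' : Rn R n -> R) :
  L2R mu u1 -> L2R mu u2 -> L2R mu p -> L2R mu q ->
  L2R mu u1' -> L2R mu u2' -> L2R mu p' -> L2R mu q' ->
  heat_pair u1 u2 p q -> heat_pair u1' u2' p' q' ->
  heat_pair (fun x => u1 x - u1' x) (fun x => u2 x - u2' x)
            (fun x => p x - p' x) (fun x => q x - q' x).
Proof.
move=> ? ? ? ? ? ? ? ? H H' s w s0.
have si0 : 0 < s^-1 by rewrite invr_gt0.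
have [e1 e2] := H s w s0; have [e1' e2'] := H' s w s0.
rewrite !averageB// !cos_transformB// !sin_transformB// !mulrBr e1 e2 e1' e2'.
by split; ring.
Qed.

Let energy s (p : Rn R n -> R) (w : Rn R n) : R :=
  cos_transform (fun x => p x * gaussRn s x) w ^+ 2 +
  sin_transform (fun x => p x * gaussRn s x) w ^+ 2.

Let energy_ge0 s p w : 0 <= energy s p w.
Proof. by rewrite addr_ge0 ?sqr_ge0. Qed.

Let measurable_energy s (p : Rn R n -> R) : 0 < s -> L2R mu p ->
  measurable_fun setT (energy s p).
Proof.
move=> s0 p2; have i := integrable_mul_gaussRn s0 p2.
have p2' := L2R_mul_gaussRn s0 p2.
apply: measurable_funD; apply: measurable_funX.
  exact: measurable_cos_transform.
exact: measurable_sin_transform.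
Qed.

Let integral_energy_le s (p : Rn R n -> R) : 0 < s -> L2R mu p ->
  (\int[mu]_w (energy s p w)%:E <= ((2 * pi) ^+ n)%:E * \int[mu]_x (p x ^+ 2)%:E)%E.
Proof.
move=> s0 p2; have [mp _] := p2.
apply: (le_trans (energy_le (integrable_mul_gaussRn s0 p2) (L2R_mul_gaussRn s0 p2))).
apply: lee_wpmul2l; first by rewrite lee_fin exprn_ge0// mulr_ge0// pi_ge0.
apply: ge0_le_integral => //.
- by move=> x _; rewrite lee_fin sqr_ge0.
- apply/measurable_EFinP; apply: measurable_funX; apply: measurable_funM => //.
  exact: measurable_fun_gaussRn.
- by apply/measurable_EFinP; exact: measurable_funX.
- move=> x _; rewrite lee_fin exprMn ler_piMr ?sqr_ge0//.
  by rewrite exprn_ile1 ?gaussRn_ge0 ?(gaussRn_le1 _ (ltW s0)).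
Qed.

(** The heat average with parameter [r] is tested with [s = r^-1]. The 4 is the 2 of the hypothesis
    times the 2 of [sqr_integral_le_heat]; one power of [(2 * pi) ^+ n] from the square on the left
    is cancelled by the constant of [energy_le]. *)
Let sqr_integral_le_energy (u p q : Rn R n -> R) (B : R) :
  L2R mu u -> L2R mu p -> L2R mu q ->
  (\int[mu]_x (p x ^+ 2)%:E + \int[mu]_x (q x ^+ 2)%:E = B%:E)%E ->
  (forall (s : R) w, 0 < s -> ((2 * pi) ^+ n * average mu (kerRn s^-1) u w) ^+ 2 <=
     2 * (energy s p w + energy s q w)) ->
  (\int[mu]_x (u x ^+ 2)%:E <= (4 / (2 * pi) ^+ n * B)%:E)%E.
Proof.
move=> u2 p2 q2 BE H; set c : R := (2 * pi) ^+ n.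
have c0 : 0 < c by rewrite exprn_gt0// mulr_gt0// pi_gt0.
have [mu1 _] := u2.
rewrite (_ : 4 / c * B = 2 * (2 / c * B)); last by field; rewrite gt_eqF.
apply: sqr_integral_le_heat => // r r0.
have s0 : 0 < r^-1 by rewrite invr_gt0.
have {}H w := H r^-1 w s0; rewrite invrK in H.
have mEp := measurable_energy s0 p2; have mEq := measurable_energy s0 q2.
have k0 : 0 <= 2 / c ^+ 2 by rewrite divr_ge0// exprn_ge0// ltW.
apply: (@le_trans _ _ (\int[mu]_w ((2 / c ^+ 2)%:E *
    ((energy r^-1 p w)%:E + (energy r^-1 q w)%:E)))%E).
  apply: ge0_le_integral => //.
  - by move=> w _; rewrite lee_fin sqr_ge0.
  - apply/measurable_EFinP; apply: measurable_funX.
    exact: measurable_average (markov_kerRn n r0) mu1.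
  - by apply: measurable_funeM; apply: emeasurable_funD; exact/measurable_EFinP.
  - move=> w _; rewrite -EFinD -EFinM lee_fin.
    have := H w; rewrite exprMn -/c.
    move=> h; rewrite [leRHS]mulrAC ler_pdivlMr; last by rewrite exprn_gt0.
    by rewrite mulrC.
rewrite ge0_integralZl//; last 2 first.
- by apply: emeasurable_funD; exact/measurable_EFinP.
- by move=> w _; rewrite -EFinD lee_fin addr_ge0.
rewrite ge0_integralD//; last 4 first.
- by move=> w _; rewrite lee_fin.
- exact/measurable_EFinP.
- by move=> w _; rewrite lee_fin.
- exact/measurable_EFinP.
rewrite (_ : (2 / c * B)%:E = ((2 / c ^+ 2)%:E * (c%:E * B%:E))%E); last first.
  by rewrite -!EFinM; congr EFin; field; rewrite gt_eqF.
apply: lee_wpmul2l; first by rewrite lee_fin.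
rewrite -BE ge0_muleDr; last 2 first.
- by apply: integral_ge0 => x _; rewrite lee_fin sqr_ge0.
- by apply: integral_ge0 => x _; rewrite lee_fin sqr_ge0.
by apply: leeD; exact: integral_energy_le.
Qed.

(** A Plancherel inequality up to a constant. The average of each of [u1], [u2] mixes the transforms
    of [p] and [q]; bounding the cross terms by squares gives 4 for each function, hence the 8. *)
Lemma heat_pair_sqr_integral_le (u1 u2 p q : Rn R n -> R) :
  L2R mu u1 -> L2R mu u2 -> L2R mu p -> L2R mu q -> heat_pair u1 u2 p q ->
  (\int[mu]_x (u1 x ^+ 2 + u2 x ^+ 2)%:E <=
   (8 / (2 * pi) ^+ n)%:E * \int[mu]_x (p x ^+ 2 + q x ^+ 2)%:E)%E.
Proof.
move=> u12 u22 p2 q2 H; set c : R := (2 * pi) ^+ n.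
have [mu1 _] := u12; have [mu2 _] := u22; have [mp pf] := p2; have [mq qf] := q2.
have Dint (f g : Rn R n -> R) : measurable_fun setT f -> measurable_fun setT g ->
    (\int[mu]_x (f x ^+ 2 + g x ^+ 2)%:E =
     \int[mu]_x (f x ^+ 2)%:E + \int[mu]_x (g x ^+ 2)%:E)%E.
  move=> mf mg; under eq_integral do rewrite EFinD.
  rewrite ge0_integralD//.
  - by move=> x _; rewrite lee_fin sqr_ge0.
  - by apply/measurable_EFinP; exact: measurable_funX.
  - by move=> x _; rewrite lee_fin sqr_ge0.
  - by apply/measurable_EFinP; exact: measurable_funX.
rewrite !Dint//; set P := (\int[mu]_x (p x ^+ 2)%:E)%E; set Q := (\int[mu]_x (q x ^+ 2)%:E)%E.
have PQ : (P + Q = (fine (P + Q))%:E)%E.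
  rewrite fineK// ge0_fin_numE; first exact: lte_add_pinfty.
  by apply: adde_ge0; apply: integral_ge0 => x _; rewrite lee_fin sqr_ge0.
have I1 := sqr_integral_le_energy u12 p2 q2 PQ.
have I2 := sqr_integral_le_energy u22 p2 q2 PQ.
rewrite [in leRHS]PQ -EFinM (_ : 8 / c * _ = 4 / c * fine (P + Q)%E + 4 / c * fine (P + Q)%E); last by ring.
rewrite EFinD; apply: leeD.
  apply: I1 => s w s0; have [-> _] := H s w s0.
  rewrite /energy; set a := cos_transform _ _; set b := sin_transform _ _.
  set a' := cos_transform _ _; set b' := sin_transform _ _.
  by have := sqr_ge0 (a + b); have := sqr_ge0 b'; have := sqr_ge0 a'; nra.
apply: I2 => s w s0; have [_ ->] := H s w s0.
rewrite /energy; set a := cos_transform _ _; set b := sin_transform _ _.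
set a' := cos_transform _ _; set b' := sin_transform _ _.
by have := sqr_ge0 (b - a); have := sqr_ge0 a'; have := sqr_ge0 b'; nra.
Qed.

End complex_L2.

(** * Testing against Gaussians, and uniqueness of the transform *)

Section fourier_pairing.
Context {R : realType} {n : nat}.
Local Notation mu := (lebesgueRn R n).
Local Notation normc := ComplexField.Normc.normc.

Definition modgauss (s : R) (w : Rn R n) : Rn R n -> R[i] := fun x =>
  Complex (gaussRn s x * cos (dotRn w x)) (gaussRn s x * sin (dotRn w x)).

Lemma schwartz_modgauss s w : 0 < s -> schwartz (modgauss s w).
Proof.
move=> s0; apply: (schwartz_gauss_classC (w := w) (y0 := zeroRn n) s0).
exists (modulated_gauss s w (zeroRn n) 0), (modulated_gauss s w (zeroRn n) (- (pi / 2))).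
split; [exact: gauss_class_base|exact: gauss_class_base|].
by apply/funext => x; rewrite /modulated_gauss subRn0 addr0 cosBpihalf.
Qed.

Lemma schwartz_gauss_center s (y : Rn R n) : 0 < s ->
  schwartz (fun x => Complex (gaussRn s (subRn x y)) 0 : R[i]).
Proof.
move=> s0; apply: (schwartz_gauss_classC (w := zeroRn n) (y0 := y) s0).
(* Frequency 0 makes the cosine equal to 1, and the zero imaginary part is a null multiple of a
   member of the class. *)
exists (modulated_gauss s (zeroRn n) y 0), (fun x => 0 * modulated_gauss s (zeroRn n) y 0 x).
split; [exact: gauss_class_base|by apply: gauss_classZ; exact: gauss_class_base|].
apply/funext => x; rewrite mul0r /modulated_gauss.
have -> : dotRn (zeroRn n) x = 0 by apply: big1 => i _; rewrite tnth_mktuple mul0r.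
by rewrite addr0 cos0 mulr1.
Qed.

(** Completes the link between test functions and heat averages: the transform is real and is a
    multiple of the heat kernel centred at [w]. Its imaginary part is the integral of a cosine with
    phase [- (pi / 2)], which vanishes. *)
Lemma fourier_modgauss s w : 0 < s ->
  fourier (modgauss s w) =
  fun y => Complex ((2 * pi) ^+ n * kerRn s^-1 w y) 0 : R[i].
Proof.
move=> s0; apply/funext => y; rewrite /fourier /integralC.
have E th x : cos (dotRn (subRn w y) x + th) =
   cos (dotRn w x - dotRn y x + th) by rewrite dotRnBl.
have E1 x : complex.Re (expi (- dotRn y x) * modgauss s w x) =
    cos (dotRn (subRn w y) x + 0) * gaussRn s x.
  by rewrite E addr0 cosB /expi /modgauss /= cosN sinN; ring.
have E2 x : complex.Im (expi (- dotRn y x) * modgauss s w x) =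
    cos (dotRn (subRn w y) x + - (pi / 2)) * gaussRn s x.
  by rewrite E cosBpihalf sinB /expi /modgauss /= cosN sinN; ring.
under eq_Rintegral do rewrite E1.
under [X in Complex _ X]eq_Rintegral do rewrite E2.
rewrite !integral_cos_gaussRn// cos0 cosN cos_pihalf mul0r mul1r.
congr Complex; rewrite /kerRn -(gauss_massV n s0); field.
by rewrite gt_eqF// gauss_mass_gt0// invr_gt0.
Qed.

Lemma heat_pair_fourier (u h : Rn R n -> R[i]) : inL2 u -> inL2 h ->
  has_fourier (regular u) h ->
  heat_pair (fun x => complex.Re (u x)) (fun x => complex.Im (u x))
    (fun x => complex.Re (h x)) (fun x => complex.Im (h x)).
Proof.
move=> /inL2P[u1 u2] /inL2P[p q] H s w s0.
have := H _ (schwartz_modgauss w s0).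
have si0 : 0 < s^-1 by rewrite invr_gt0.
rewrite fourier_modgauss// /regular /integralC => -[].
have E1 x : complex.Re (u x * Complex ((2 * pi) ^+ n * kerRn s^-1 w x) 0) =
    (2 * pi) ^+ n * (kerRn s^-1 w x * complex.Re (u x)).
  by case: (u x) => a b /=; ring.
have E2 x : complex.Im (u x * Complex ((2 * pi) ^+ n * kerRn s^-1 w x) 0) =
    (2 * pi) ^+ n * (kerRn s^-1 w x * complex.Im (u x)).
  by case: (u x) => a b /=; ring.
have E3 x : complex.Re (h x * modgauss s w x) =
  complex.Re (h x) * gaussRn s x * cos (dotRn w x) -
  complex.Im (h x) * gaussRn s x * sin (dotRn w x).
  by rewrite /modgauss; case: (h x) => a b /=; ring.
have E4 x : complex.Im (h x * modgauss s w x) =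
  complex.Re (h x) * gaussRn s x * sin (dotRn w x) +
  complex.Im (h x) * gaussRn s x * cos (dotRn w x).
  by rewrite /modgauss; case: (h x) => a b /=; ring.
under eq_Rintegral do rewrite E1.
under [in X in _ = X -> _]eq_Rintegral do rewrite E3.
move=> e1.
under eq_Rintegral do rewrite E2.
under [in X in _ = X -> _]eq_Rintegral do rewrite E4.
move=> e2; split.
  rewrite /average -RintegralZl//; last exact: integrable_kerRn_mul.
  rewrite e1 RintegralB//; first exact: integrable_mul_gaussRn_cos.
  exact: integrable_mul_gaussRn_sin.
rewrite /average -RintegralZl//; last exact: integrable_kerRn_mul.
rewrite e2 RintegralD//; first exact: integrable_mul_gaussRn_sin.
exact: integrable_mul_gaussRn_cos.
Qed.

Lemma integrable_mul_gaussRn_sub s (y : Rn R n) (k : Rn R n -> R) : 0 < s -> L2R mu k ->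
  mu.-integrable setT (EFin \o (fun x => k x * gaussRn s (subRn x y))).
Proof.
move=> s0 k2; have h := integrableRZ (gauss_mass n s) (integrable_kerRn_mul y s0 k2).
rewrite (_ : (fun x => _) = (fun x => gauss_mass n s * (kerRn s y x * k x)))//.
apply/funext => x; have c0 : gauss_mass n s != 0 by rewrite gt_eqF// gauss_mass_gt0.
by rewrite /kerRn (gaussRn_subC s x y) mulrA (mulrA (gauss_mass n s)) divff// mul1r mulrC.
Qed.

(** The hypothesis says that all heat averages of [d] vanish, so [sqr_integral_le_heat] applies with
    [B = 0]. *)
Lemma L2R_average_eq0 (d : Rn R n -> R) : L2R mu d ->
  (forall (s : R) y, 0 < s -> \int[mu]_x (d x * gaussRn s (subRn x y)) = 0) ->
  {ae mu, forall x, d x = 0}.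
Proof.
move=> d2 H; have [md _] := d2.
have I0 : (\int[mu]_x (d x ^+ 2)%:E <= (2 * 0)%:E)%E.
  apply: sqr_integral_le_heat => // s s0.
  rewrite integral0_eq// => y _.
  suff -> : average mu (kerRn s) d y = 0 by rewrite expr0n.
  rewrite /average; under eq_Rintegral => x _.
    rewrite /kerRn gaussRn_subC -mulrA [gaussRn _ _ * _]mulrC.
    over.
  rewrite RintegralZl ?H ?mulr0//.
  exact: integrable_mul_gaussRn_sub.
have md2 : measurable_fun setT (fun x => (d x ^+ 2)%:E).
  by apply/measurable_EFinP; exact: measurable_funX.
have : (\int[mu]_x `|(d x ^+ 2)%:E| = 0)%E.
  apply/eqP; rewrite eq_le integral_ge0 ?andbT//.
  rewrite mulr0 in I0; apply: le_trans I0; rewrite le_eqVlt; apply/orP; left; apply/eqP.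
  by apply: eq_integral => x _; rewrite gee0_abs// lee_fin sqr_ge0.
move=> /(ae_eq_integral_abs _ measurableT md2); apply: filterS => x /(_ I)[].
by move=> /eqP; rewrite sqrf_eq0 => /eqP.
Qed.

(** Pairing [g] or [h] with a translated Gaussian gives the same value of [T], so the real and
    imaginary parts of [g - h] are orthogonal to all translated Gaussians. *)
Lemma has_fourier_unique T (g h : Rn R n -> R[i]) : inL2 g -> inL2 h ->
  has_fourier T g -> has_fourier T h -> {ae mu, forall x, g x = h x}.
Proof.
move=> /inL2P[g1 g2] /inL2P[h1 h2] Hg Hh.
have key (s : R) y : 0 < s ->
  (\int[mu]_x ((complex.Re (g x) - complex.Re (h x)) * gaussRn s (subRn x y)) = 0) /\
  (\int[mu]_x ((complex.Im (g x) - complex.Im (h x)) * gaussRn s (subRn x y)) = 0).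
  move=> s0; have := Hg _ (schwartz_gauss_center y s0).
  rewrite (Hh _ (schwartz_gauss_center y s0)) /regular /integralC => -[].
  have E1 (k : Rn R n -> R[i]) x : complex.Re (k x * Complex (gaussRn s (subRn x y)) 0) =
     complex.Re (k x) * gaussRn s (subRn x y).
    by case: (k x) => a b /=; ring.
  have E2 (k : Rn R n -> R[i]) x : complex.Im (k x * Complex (gaussRn s (subRn x y)) 0) =
     complex.Im (k x) * gaussRn s (subRn x y).
    by case: (k x) => a b /=; ring.
  have R1 k : \int[mu]_x complex.Re (k x * Complex (gaussRn s (subRn x y)) 0) =
      \int[mu]_x (complex.Re (k x) * gaussRn s (subRn x y)).
    by apply: eq_Rintegral => x _; exact: E1.
  have R2 k : \int[mu]_x complex.Im (k x * Complex (gaussRn s (subRn x y)) 0) =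
      \int[mu]_x (complex.Im (k x) * gaussRn s (subRn x y)).
    by apply: eq_Rintegral => x _; exact: E2.
  rewrite !R1 !R2 => e1 e2.
  split; under eq_Rintegral do rewrite mulrBl.
    by rewrite RintegralB ?e1 ?subrr//; exact: integrable_mul_gaussRn_sub.
  by rewrite RintegralB ?e2 ?subrr//; exact: integrable_mul_gaussRn_sub.
have a1 := L2R_average_eq0 (L2RB g1 h1) (fun s y s0 => (key s y s0).1).
have a2 := L2R_average_eq0 (L2RB g2 h2) (fun s y s0 => (key s y s0).2).
near=> x.
have d1 : complex.Re (g x) - complex.Re (h x) = 0 by near: x.
have d2 : complex.Im (g x) - complex.Im (h x) = 0 by near: x.
move/eqP: d1; rewrite subr_eq0 => /eqP d1; move/eqP: d2; rewrite subr_eq0 => /eqP d2.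
by case: (g x) d1 d2 => a b /=; case: (h x) => a' b' /= -> ->.
Unshelve. all: by end_near.
Qed.

End fourier_pairing.

(** * Cells of times *)

Section geometric_cells.
Context {R : realType}.

Lemma powR_exprn (r k : R) j : 0 <= r -> (r ^+ j) `^ k = (r `^ k) ^+ j.
Proof.
move=> r0; elim: j => [|j IH]; first by rewrite !expr0 powR1.
by rewrite !exprS powRM ?exprn_ge0// IH.
Qed.

Lemma sum_telescope (F : nat -> R) J : \sum_(j < J) (F j.+1 - F j) = F J - F 0.
Proof. by rewrite -(big_mkord xpredT (fun j => F j.+1 - F j)) telescope_sumr. Qed.

Lemma powR_gt1 (r k : R) : 1 < r -> 0 < k -> 1 < r `^ k.
Proof.
move=> r1 k0; have r0 : 0 <= r by rewrite ltW// (lt_trans _ r1).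
by have := @gt0_ltr_powR R k k0 1 r; rewrite !nnegrE ler01 powR1 => /(_ isT r0 r1).
Qed.

Lemma sqr_powR_split (k x : R) : 0 < x -> x ^+ 2 = x `^ k * x `^ (2 - k).
Proof.
move=> x0; rewrite -powRD; last by rewrite (gt_eqF x0) implybT.
by rewrite addrC subrK powR_mulrn ?(ltW x0).
Qed.

(* Terms with [r ^ j <= X] are bounded by differences of [F1], the others by
   differences of [F2]; both telescope to [O(X `^ k)]. *)
Lemma cell_sum_bound (r k : R) : 1 < r -> 0 < k -> k < 2 -> exists2 C : R, 0 <= C &
  forall X J, 0 <= X ->
    \sum_(j < J) (r ^+ j) `^ k * Num.min 4 ((X / r ^+ j) ^+ 2) <= C * X `^ k.
Proof.
move=> r1 k0 k2; have r0 : 0 < r by exact: lt_trans r1.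
pose a := r `^ k; pose b := r `^ (2 - k).
have l0 : 0 < 2 - k by rewrite subr_gt0.
have a1 : 1 < a by exact: powR_gt1.
have b1 : 1 < b by exact: powR_gt1.
have a0 : 0 < a by exact: lt_trans a1.
have b0 : 0 < b by exact: lt_trans b1.
(* These invert the increments: [1 - 1/a] is the relative increment of [F1] where [r ^+ j <= X], and
   [1 - 1/b] that of [F2] where [r ^+ j > X]. The 4 is the first entry of the minimum. *)
pose c1 := 4 * a / (a - 1); pose c2 := b / (b - 1).
have c10 : 0 <= c1.
  by apply: divr_ge0; [apply: mulr_ge0 => //; exact: (ltW a0)|rewrite subr_ge0 (ltW a1)].
have c20 : 0 <= c2.
  by apply: divr_ge0; [exact: (ltW b0)|rewrite subr_ge0 (ltW b1)].
exists (c1 + c2) => [|X J X0]; first by rewrite addr_ge0.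
have [->|Xn0] := eqVneq X 0.
  rewrite powR0 ?gt_eqF// mulr0 big1// => j _.
  by rewrite mul0r expr0n /= min_r// mulr0.
have {Xn0}X0 : 0 < X by rewrite lt_neqAle eq_sym Xn0.
have Xk : X `^ k = X ^+ 2 / X `^ (2 - k).
  by rewrite (sqr_powR_split k X0) mulfK ?gt_eqF ?powR_gt0.
(* Dividing by [r] shifts the index, so that the increment at the last [j] with [r ^+ j <= X] is not
   cut off by the minimum. *)
pose F1 j := (Num.min (r ^+ j / r) X) `^ k.
pose F2 j := - (X ^+ 2 / (Num.max (r ^+ j) X) `^ (2 - k)).
have y0 j : 0 < r ^+ j by rewrite exprn_gt0.
have yS j : r ^+ j <= r ^+ j.+1 by rewrite exprS ler_peMl ?(ltW (y0 j)) ?(ltW r1).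
have yr j : r ^+ j / r <= r ^+ j by rewrite ler_pdivrMr// ler_peMr ?(ltW (y0 j)) ?(ltW r1).
have m0 j : 0 < Num.min (r ^+ j / r) X by rewrite lt_min divr_gt0.
have M0 j : 0 < Num.max (r ^+ j) X by rewrite lt_max y0.
have F1le j : F1 j <= F1 j.+1.
  rewrite /F1 ge0_ler_powR ?nnegrE ?(ltW k0) ?(ltW (m0 _))//.
  rewrite exprSr mulfK ?gt_eqF//.
  by rewrite le_min ge_min yr/= ge_min lexx orbT.
have F2le j : F2 j <= F2 j.+1.
  rewrite /F2 lerN2 ler_wpM2l ?sqr_ge0// lef_pV2 ?posrE ?powR_gt0//.
  rewrite ge0_ler_powR ?nnegrE ?(ltW l0) ?(ltW (M0 _))//.
  by rewrite ge_max !le_max yS lexx orbT.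
have step j : (r ^+ j) `^ k * Num.min 4 ((X / r ^+ j) ^+ 2) <=
    c1 * (F1 j.+1 - F1 j) + c2 * (F2 j.+1 - F2 j).
  have yk0 : 0 < (r ^+ j) `^ k by exact: powR_gt0.
  have [yX|Xy] := leP (r ^+ j) X.
    rewrite -[X in X <= _]addr0 lerD//; last first.
      by rewrite mulr_ge0// subr_ge0 F2le.
    have -> : c1 * (F1 j.+1 - F1 j) = (r ^+ j) `^ k * 4.
      rewrite /F1 exprSr mulfK ?gt_eqF//.
      rewrite !min_l ?(le_trans (yr j))// powRM ?invr_ge0 ?(ltW r0) ?(ltW (y0 j))//.
      rewrite -powR_inv1 ?(ltW r0)// -powRrM mulN1r powRN -/a /c1.
      by field; rewrite !gt_eqF ?subr_gt0.
    by rewrite ler_wpM2l ?(ltW yk0)// ge_min lexx.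
  rewrite -[X in X <= _]add0r lerD//; first by rewrite mulr_ge0// subr_ge0 F1le.
  have yl0 : 0 < (r ^+ j) `^ (2 - k) by exact: powR_gt0.
  have -> : c2 * (F2 j.+1 - F2 j) = (r ^+ j) `^ k * (X / r ^+ j) ^+ 2.
    rewrite /F2 !max_l ?(ltW Xy) ?(le_trans (ltW Xy))// (exprS r j).
    rewrite powRM ?(ltW r0) ?(ltW (y0 j))// -/b /c2.
    have yk : (r ^+ j) `^ k = (r ^+ j) ^+ 2 / (r ^+ j) `^ (2 - k).
      by rewrite (sqr_powR_split k (y0 j)) mulfK ?gt_eqF.
    rewrite yk; field.
    by rewrite !gt_eqF ?subr_gt0 ?(y0 j) ?yl0.
  by rewrite ler_wpM2l ?(ltW yk0)// ge_min lexx orbT.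
apply: (le_trans (ler_sum _ (fun (j : 'I_J) _ => step j))).
rewrite big_split/= -!mulr_sumr !sum_telescope mulrDl lerD// ler_wpM2l//.
  rewrite -[X in _ <= X]subr0 lerB ?powR_ge0//.
  by rewrite ge0_ler_powR ?nnegrE ?(ltW k0) ?(ltW (m0 _)) ?(ltW X0)// ge_min lexx orbT.
rewrite /F2 opprK addrC lerBlDr -[X in X <= _]addr0 lerD//; last first.
  by rewrite mulr_ge0 ?sqr_ge0// invr_ge0 powR_ge0.
rewrite Xk ler_wpM2l ?sqr_ge0// lef_pV2 ?posrE ?powR_gt0//.
by rewrite ge0_ler_powR ?nnegrE ?(ltW l0) ?(ltW (M0 _)) ?(ltW X0)// le_max lexx orbT.
Qed.

Lemma sum_by_block (I : finType) (P : pred I) (jf : I -> nat) (F c : nat -> R) :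
  (forall j, 0 <= F j) ->
  (forall j, #|[pred i | P i & jf i == j]|%:R <= c j) ->
  exists J, \sum_(i | P i) F (jf i) <= \sum_(j < J) c j * F j.
Proof.
move=> F0 cP; pose J := \max_i jf i; exists J.+1.
have jE i : (inord (jf i) : 'I_J.+1) = jf i :> nat by rewrite (@inordK J)// ltnS leq_bigmax.
rewrite (partition_big (fun i => inord (jf i) : 'I_J.+1) xpredT)//=.
apply: ler_sum => j _.
rewrite (eq_bigr (fun=> F j)) => [|i /andP[_ /eqP<-]]; last by rewrite jE.
rewrite sumr_const -[X in X <= _]mulr_natl ler_wpM2r//.
apply: le_trans (cP j); rewrite ler_nat; apply: subset_leq_card.
apply/fintype.subsetP => i; rewrite !inE => /andP[-> /eqP <-]; by rewrite jE eqxx.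
Qed.

Lemma exists_dyadic (x : R) : 0 < x -> x <= 1 ->
  exists j, (2 ^+ j.+1)^-1 < x <= (2 ^+ j)^-1.
Proof.
move=> x0 x1.
have ex : exists j, (2 ^+ j.+1)^-1 < x.
  exists (Num.bound x^-1).
  have xi : 0 <= x^-1 by rewrite invr_ge0 ltW.
  rewrite -[ltRHS]invrK ltf_pV2 ?posrE ?invr_gt0 ?exprn_gt0//.
  apply: (lt_le_trans (archi_boundP xi)); rewrite -natrX ler_nat.
  by rewrite (leq_trans (ltnW (ltn_expl _ (ltnSn 1))))// leq_exp2l.
case: (ex_minnP ex) => j jx jmin; exists j; rewrite jx/=.
case: j jx jmin => [|j] jx jmin; first by rewrite expr0 invr1.
by rewrite leNgt; apply/negP => /jmin; rewrite ltnn.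
Qed.

Lemma eq_truncn_dist (x y : R) : 0 <= x -> 0 <= y -> Num.truncn x = Num.truncn y ->
  `|x - y| <= 1.
Proof.
move=> /truncn_itv/andP[x1 x2] /truncn_itv/andP[y1 y2] E.
move: x1 x2 y1 y2; rewrite E -natr1 => x1 x2 y1 y2.
by rewrite ler_norml; apply/andP; split; lra.
Qed.

(* [i] and [p i] lie in the same block [(2^-(j+1), 2^-j]] and in the same interval of
   length [2^-(j(1+k))]; a block meets [O(2^(jk))] such intervals. *)
Lemma cell_representatives (t : nat -> R) (k C : R) :
  0 < k -> k < 2 -> 0 <= C -> (forall i, 0 < t i) -> (forall i, t i <= 1) ->
  (forall j m, (1 <= j)%N -> #|[pred i : 'I_m | (2 ^+ j.+1)^-1 < t i <= (2 ^+ j)^-1]|%:R <=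
     C * ((2 `^ (1 + k)) ^+ j) `^ k) ->
  exists p : nat -> nat, [/\ forall i, p (p i) = p i,
    forall i, t (p i) <= 2 * t i,
    forall i, t i <= 1 / 2 -> t (p i) <= 1 / 2 &
    exists2 D : R, 0 <= D & forall m X, 0 <= X ->
      \sum_(i < m | t i <= 1 / 2) Num.min 4 (((t i - t (p i)) * X) ^+ 2) +
      \sum_(i < m | (t i <= 1 / 2) && (p i == i)) Num.min 4 ((t i * X) ^+ 2) <=
      D * X `^ k].
Proof.
move=> k0 k2 C0 t0 t1 cnt.
pose r : R := 2 `^ (1 + k).
have r1 : 1 < r by apply: powR_gt1; [lra|lra].
have r0 : 0 < r by exact: lt_trans r1.
have y0 j : 0 < r ^+ j by rewrite exprn_gt0.
have /choice[jf jfP] i := exists_dyadic (t0 i) (t1 i).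
(* Within block [j], equal truncations of [t i * r ^+ j] put two times at distance at most
   [r ^- j]. *)
pose cell i := (jf i, Num.truncn (t i * r ^+ jf i)).
have ex i : exists i', cell i' == cell i by exists i.
pose p i := ex_minn (ex i).
have cp i : cell (p i) = cell i by rewrite /p; case: ex_minnP => ? /eqP.
have pm i i' : cell i' = cell i -> (p i <= i')%N.
  by move=> E; rewrite /p; case: ex_minnP => l _; apply; rewrite E.
have peq i i' : cell i' = cell i -> p i' = p i.
  move=> E; apply/eqP; rewrite eqn_leq !pm//.
    by rewrite cp.
  by rewrite cp E.
have jp i : jf (p i) = jf i by have [] := cp i.
(* The restriction to [t i <= 1 / 2] thus removes exactly block 0, on which the counting hypothesis
   is silent. *)
have half i : (t i <= 1 / 2) = (0 < jf i)%N.
  have := jfP i; case: (jf i) => [|j] /andP[h1 h2]; last first.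
    rewrite (le_trans h2)// div1r lef_pV2 ?posrE ?exprn_gt0// exprS ler_peMr//.
    by rewrite exprn_ege1// ler1n.
  by rewrite leNgt div1r -[X in X^-1]expr1 h1.
have dist i : `|t i - t (p i)| <= (r ^+ jf i)^-1.
  rewrite -[X in _ <= X]mul1r ler_pdivlMr// -[X in _ * X](gtr0_norm (y0 _)) -normrM mulrBl.
  apply: eq_truncn_dist; [by rewrite mulr_ge0 ?(ltW (t0 _)) ?(ltW (y0 _))..|].
  by have [ej eq] := cp i; rewrite -eq ej.
(* In block [j] one has [t i * r ^+ j <= r ^+ j / 2 ^+ j = v], so the truncation takes at most
   [truncn v + 1 <= 2 v] values, and two representatives with the same value coincide. *)
have reps j m : #|[pred i : 'I_m | ((t i <= 1 / 2) && (p i == i)) & jf i == j]|%:R <=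
    2 * (2 ^+ j) `^ k.
  set A := [pred i : 'I_m | _]; pose v : R := (2 ^+ j) `^ k.
  have v1 : 1 <= v.
    by rewrite /v powR_exprn// exprn_ege1// (ltW (powR_gt1 (ltr1n R 2 : 1 < 2) k0)).
  have v0 : 0 <= v by exact: le_trans v1.
  pose q (i : 'I_m) : 'I_(Num.truncn v).+1 := inord (Num.truncn (t i * r ^+ j)).
  have qE i : i \in A -> q i = Num.truncn (t i * r ^+ j) :> nat.
    rewrite !inE => /andP[_ /eqP ji]; rewrite /q inordK// ltnS le_truncn//.
    have /andP[_ ti] := jfP i; rewrite ji in ti.
    apply: (le_trans (ler_wpM2r (ltW (y0 j)) ti)).
    have -> : r = 2 * 2 `^ k by rewrite /r powRD ?pnatr_eq0 ?implybT// powRr1.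
    by rewrite exprMn mulrA mulVf ?expf_neq0// mul1r /v powR_exprn.
  have qinj : {in A &, injective q}.
    move=> i l iA lA E; have := iA; have := lA.
    rewrite !inE => /andP[/andP[_ /eqP pl] /eqP jl] /andP[/andP[_ /eqP pii] /eqP ji].
    apply: ord_inj; rewrite -pl -pii; apply: peq.
    by rewrite /cell ji jl -(qE _ iA) -(qE _ lA) E.
  rewrite -(card_in_image qinj) (@le_trans _ _ (Num.truncn v).+1%:R)//.
    by rewrite ler_nat (leq_trans (max_card _))// card_ord.
  rewrite -natr1 mulr_natl mulr2n lerD//.
  by have /andP[] := truncn_itv v0.
exists p; split=> [i|i|i|].
- exact/peq/cp.
- have /andP[_ hp] := jfP (p i); have /andP[hi _] := jfP i.
  apply: (le_trans hp); rewrite jp -ler_pdivrMl//.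
  by apply: le_trans (ltW hi); rewrite exprS invfM.
- by rewrite !half jp.
(* The same geometric sum at two ratios: [r] for the members of the cells, 2 for the
   representatives. *)
have [D1 D10 H1] := cell_sum_bound r1 k0 k2.
have [D2 D20 H2] := cell_sum_bound (ltr1n R 2 : 1 < 2) k0 k2.
exists (C * D1 + 2 * D2) => [|m X X0]; first by rewrite addr_ge0// mulr_ge0.
rewrite mulrDl -!mulrA; apply: lerD.
  have F0 (j : nat) : 0 <= Num.min (4 : R) ((X / r ^+ j) ^+ 2) by rewrite le_min sqr_ge0 andbT.
  pose P := [pred i : 'I_m | t i <= 1 / 2].
  have cP (j : nat) : #|[pred i | P i & jf i == j]|%:R <= C * (r ^+ j) `^ k.
    have [->|j0] := posnP j.
      rewrite (eq_card0 (_ : _ =i pred0)) ?mulr_ge0 ?powR_ge0// => i.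
      by rewrite !inE half; case: (jf i).
    apply: le_trans (cnt _ m j0); rewrite ler_nat; apply: subset_leq_card.
    by apply/fintype.subsetP => i; rewrite !inE => /andP[_ /eqP <-]; exact: jfP.
  have [J HJ] := sum_by_block F0 cP.
  apply: (@le_trans _ _ (\sum_(i < m | P i) Num.min 4 ((X / r ^+ jf i) ^+ 2))).
    apply: ler_sum => i _; apply: le_min2 => //.
    rewrite mulrC !exprMn ler_wpM2l ?sqr_ge0//.
    by rewrite -[X in X <= _]real_normK ?num_real// lerXn2r ?nnegrE ?invr_ge0 ?(ltW (y0 _)).
  apply: (le_trans HJ); under eq_bigr do rewrite -mulrA.
  by rewrite -mulr_sumr ler_wpM2l// H1.
have F0 (j : nat) : 0 <= Num.min (4 : R) ((X / 2 ^+ j) ^+ 2) by rewrite le_min sqr_ge0 andbT.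
pose P := [pred i : 'I_m | (t i <= 1 / 2) && (p i == i)].
have cP (j : nat) : #|[pred i | P i & jf i == j]|%:R <= 2 * (2 ^+ j) `^ k :> R.
  exact: reps.
have [J HJ] := sum_by_block F0 cP.
apply: (@le_trans _ _ (\sum_(i < m | P i) Num.min 4 ((X / 2 ^+ jf i) ^+ 2))).
  apply: ler_sum => i _; apply: le_min2 => //.
  rewrite mulrC !exprMn ler_wpM2l ?sqr_ge0// lerXn2r ?nnegrE ?(ltW (t0 _))//.
  by have /andP[] := jfP i.
apply: (le_trans HJ); under eq_bigr do rewrite -mulrA.
by rewrite -mulr_sumr ler_wpM2l// H2.
Qed.

End geometric_cells.

(** * Series with summable integrals *)

Section series_ae.
Context d (T : measurableType d) (R : realType) (mu : {measure set T -> \bar R}).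

(** The sum of the series is integrable by monotone convergence, hence finite almost everywhere, and
    the terms of a convergent series tend to 0. *)
Lemma ae_cvg0_sum_le (phi : nat -> T -> R) (B : R) :
  (forall k, measurable_fun setT (phi k)) -> (forall k x, 0 <= phi k x) ->
  (forall m, (\sum_(k < m) \int[mu]_x (phi k x)%:E <= B%:E)%E) ->
  {ae mu, forall x, phi k x @[k --> \oo] --> (0 : R)}.
Proof.
move=> mphi phi0 HB.
have mE k : measurable_fun setT (EFin \o phi k) by exact/measurable_EFinP.
have E0 k x : [set: T] x -> (0 <= (EFin \o phi k) x)%E by move=> _; rewrite lee_fin.
pose S x := (\sum_(0 <= k <oo) (phi k x)%:E)%E.
have S0 x : (0 <= S x)%E by apply: nneseries_ge0 => k _ _; rewrite lee_fin.
have iS : mu.-integrable setT S.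
  apply/integrableP; split.
    exact: (ge0_emeasurable_sum (P := xpredT) (fun k x Dx _ => E0 k x Dx) (fun k _ => mE k)).
  under eq_integral do rewrite gee0_abs//.
  rewrite (integral_nneseries mu measurableT mE E0).
  apply: (@le_lt_trans _ _ B%:E); last exact: ltry.
  apply: lime_le.
    by apply: is_cvg_nneseries => k _ _; apply: integral_ge0 => x _; rewrite lee_fin.
  by near=> m; rewrite big_mkord; exact: HB.
apply: filterS (integrable_ae measurableT iS) => x /(_ I) Sx.
apply: cvg_series_cvg_0; apply: nondecreasing_is_cvgn.
  apply/nondecreasing_seqP => k.
  by rewrite /series/= big_nat_recr//= lerDl.
exists (fine (S x)) => _ [k _ <-]; rewrite -lee_fin fineK// /series/= -sumEFin.
by apply: nneseries_lim_ge => i _ _; rewrite lee_fin.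
Unshelve. all: by end_near.
Qed.

End series_ae.

(** * Counting in dyadic blocks, and distances on the unit circle *)

Section dyadic.
Context {R : realType}.

(** [counting] is infinite on infinite sets, so the finite bound forces the block to be finite;
    injectivity of [t] makes distinct indices distinct points of it. *)
Lemma counting_dyadic_block (t : nat -> R) (j : nat) (c : R) m : injective t ->
  (counting (dyadic_block t j) <= c%:E)%E ->
  #|[pred i : 'I_m | (2 ^+ j.+1)^-1 < t i <= (2 ^+ j)^-1]|%:R <= c.
Proof.
move=> tinj; rewrite /counting; case: asboolP => // fin; rewrite lee_fin; apply: le_trans.
set A := [pred i : 'I_m | _]; rewrite ler_nat cardE -(size_map (fun i : 'I_m => t i)).
apply: uniq_leq_size.
  by rewrite map_inj_uniq ?enum_uniq// => i l /tinj/ord_inj.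
move=> _ /mapP[i + ->]; rewrite mem_enum inE => /andP[i1 i2].
rewrite (in_fset_set fin); apply/mem_set; split; first by exists i.
rewrite -opprD natr1 !powRN !powR_mulrn//.
by apply/andP.
Qed.

Lemma powR_le_exponent (k b C : R) j : 0 < k -> b <= k * (1 + k) ->
  C * 2 `^ (b * j%:R) <= Num.max C 0 * ((2 `^ (1 + k)) ^+ j) `^ k.
Proof.
move=> k0 bk; apply: (@le_trans _ _ (Num.max C 0 * 2 `^ (b * j%:R))).
  by rewrite ler_wpM2r ?powR_ge0// le_max lexx.
rewrite ler_wpM2l ?le_max ?lexx ?orbT// -powR_mulrn ?powR_ge0// -!powRrM.
rewrite ler_powR ?ler1n//.
by rewrite (_ : (1 + k) * _ = k * (1 + k) * j%:R) ?ler_wpM2r//; ring.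
Qed.

Lemma normr_sin_le (x : R) : `|sin x| <= `|x|.
Proof.
wlog x0 : x / 0 < x.
  move=> H; have [/H//|x0|<-] := ltrgtP 0 x; last by rewrite sin0 !normr0.
  by rewrite -normrN -sinN -[leRHS]normrN H// oppr_gt0.
have [c _] := @MVT R sin cos 0 x x0 (fun y _ => is_derive_sin y)
  (continuous_subspaceT (@continuous_sin R)).
rewrite sin0 !subr0 => ->; rewrite normrM ler_piMl// ler_norml.
by rewrite cos_geN1 cos_le1.
Qed.

(** The left side is the squared chord [4 sin^2((x - y) / 2)]; use [|sin v| <= 1] and
    [|sin v| <= |v|]. *)
Lemma expi_dist_le (x y : R) :
  (cos x - cos y) ^+ 2 + (sin x - sin y) ^+ 2 <= Num.min 4 ((x - y) ^+ 2).
Proof.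
have -> : (cos x - cos y) ^+ 2 + (sin x - sin y) ^+ 2 = 4 * sin ((x - y) / 2) ^+ 2.
  have -> : 4 * sin ((x - y) / 2) ^+ 2 = 2 - 2 * cos (x - y).
    rewrite -[x - y in RHS](mulfVK (_ : 2 != 0)) ?pnatr_eq0//.
    by rewrite mulr_natr cosD -!expr2 cos2sin2; ring.
  by have := cos2Dsin2 x; have := cos2Dsin2 y; rewrite cosB => h1 h2; lra.
have := normr_sin_le ((x - y) / 2); have := sin_max ((x - y) / 2).
set u := sin _; set v := (x - y) / 2 => h1 h2.
rewrite le_min; apply/andP; split.
  rewrite -[leRHS]mulr1 ler_wpM2l// -real_normK ?num_real//.
  by rewrite expr_le1.
have -> : (x - y) ^+ 2 = 4 * v ^+ 2 by rewrite /v; field.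
rewrite ler_wpM2l// -(real_normK (num_real u)) -(real_normK (num_real v)).
by rewrite lerXn2r ?nnegrE.
Qed.

End dyadic.

(** * Almost everywhere convergence *)

Section multipliers.
Context {R : realType} {n : nat}.
Local Notation mu := (lebesgueRn R n).
Local Notation normc := ComplexField.Normc.normc.
Implicit Types (u v g h : Rn R n -> R[i]).

Definition phase (X : Rn R n -> R) (tau : R) g : Rn R n -> R[i] :=
  fun xi => expi (tau * X xi) * g xi.

Lemma Re_phase X tau g xi : complex.Re (phase X tau g xi) =
  cos (tau * X xi) * complex.Re (g xi) - sin (tau * X xi) * complex.Im (g xi).
Proof. by rewrite /phase; case: (g xi). Qed.

Lemma Im_phase X tau g xi : complex.Im (phase X tau g xi) =
  cos (tau * X xi) * complex.Im (g xi) + sin (tau * X xi) * complex.Re (g xi).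
Proof. by rewrite /phase; case: (g xi). Qed.

Lemma phase0 X g : phase X 0 g = g.
Proof.
apply/funext => xi; rewrite /phase mul0r /expi cos0 sin0.
by case: (g xi) => a b; congr Complex; rewrite ?mul1r ?mul0r ?subr0 ?addr0.
Qed.

Lemma sqr_normc_phase X tau g xi : normc (phase X tau g xi) ^+ 2 = normc (g xi) ^+ 2.
Proof.
rewrite !sqr_normc Re_phase Im_phase; have := cos2Dsin2 (tau * X xi).
set c := cos _; set s := sin _; set p := complex.Re _; set q := complex.Im _ => cs.
transitivity ((c ^+ 2 + s ^+ 2) * (p ^+ 2 + q ^+ 2)); first by ring.
by rewrite cs mul1r.
Qed.

Lemma inL2_phase X tau g : measurable_fun setT X -> inL2 g -> inL2 (phase X tau g).
Proof.
move=> mX [[m1 m2] g2]; split; last by under eq_integral do rewrite sqr_normc_phase.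
have mt : measurable_fun setT (fun x => tau * X x) by exact: measurable_funM.
split.
  rewrite (funext (Re_phase X tau g)).
  by apply: measurable_funB; apply: measurable_funM => //;
    [exact: measurable_fun_cos|exact: measurable_fun_sin].
rewrite (funext (Im_phase X tau g)).
by apply: measurable_funD; apply: measurable_funM => //;
  [exact: measurable_fun_cos|exact: measurable_fun_sin].
Qed.

Lemma measurable_sqr_normc u : Defs.measurableC u ->
  measurable_fun setT (fun x => normc (u x) ^+ 2).
Proof.
move=> [m1 m2].
rewrite (_ : (fun x => _) = fun x => complex.Re (u x) ^+ 2 + complex.Im (u x) ^+ 2).
  by apply: measurable_funD; exact: measurable_funX.
by apply/funext => x; rewrite sqr_normc.
Qed.

(* Weaker than [has_fourier]: the test functions are modulated Gaussians only. *)
Definition L2_fourier u h := heat_pair (fun x => complex.Re (u x)) (fun x => complex.Im (u x))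
    (fun x => complex.Re (h x)) (fun x => complex.Im (h x)).

(** Allows versions of the transform that come from different sources to be replaced by a common
    one. *)
Lemma L2_fourier_ae u h h' : inL2 h -> inL2 h' -> {ae mu, forall x, h x = h' x} ->
  L2_fourier u h -> L2_fourier u h'.
Proof.
move=> /inL2P[h1 h2] /inL2P[h1' h2'] E H s w s0.
have [m1 _] := h1; have [m2 _] := h2; have [m1' _] := h1'; have [m2' _] := h2'.
have mc : measurable_fun setT (fun x : Rn R n => cos (dotRn w x)).
  by apply: measurable_fun_cos; exact: measurable_fun_dotRn.
have ms : measurable_fun setT (fun x : Rn R n => sin (dotRn w x)).
  by apply: measurable_fun_sin; exact: measurable_fun_dotRn.
have aeR (F G : Rn R n -> R) : measurable_fun setT F -> measurable_fun setT G ->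
    {ae mu, forall x, F x = G x} -> \int[mu]_x F x = \int[mu]_x G x.
  move=> mF mG FG; rewrite /Rintegral; congr fine; apply: ae_eq_integral => //.
  - exact/measurable_EFinP.
  - exact/measurable_EFinP.
  - by apply: filterS FG => x -> _.
have mg (p : Rn R n -> R) : measurable_fun setT p ->
    measurable_fun setT (fun x : Rn R n => p x * gaussRn s x).
  by move=> mp; apply: measurable_funM => //; exact: measurable_fun_gaussRn.
have key (p p' k : Rn R n -> R) : measurable_fun setT p -> measurable_fun setT p' ->
    measurable_fun setT k -> {ae mu, forall x, p x = p' x} ->
    \int[mu]_x (p x * gaussRn s x * k x) = \int[mu]_x (p' x * gaussRn s x * k x).
  move=> mp mp' mk pp; apply: aeR.
  - by apply: measurable_funM => //; exact: mg.
  - by apply: measurable_funM => //; exact: mg.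
  - by apply: filterS pp => x ->.
have [-> ->] := H s w s0; rewrite /cos_transform /sin_transform.
have E1 : {ae mu, forall x, complex.Re (h x) = complex.Re (h' x)} by apply: filterS E => x ->.
have E2 : {ae mu, forall x, complex.Im (h x) = complex.Im (h' x)} by apply: filterS E => x ->.
by split; congr (_ _ _); [|congr (- _)| |]; exact: key.
Qed.

(** By linearity the transform of [u - v] is [g] times a difference of two unimodular factors, whose
    squared modulus is bounded by [expi_dist_le]. *)
Lemma L2_fourier_dist_le X u v g (tau sigma : R) : measurable_fun setT X ->
  inL2 u -> inL2 v -> inL2 g ->
  L2_fourier u (phase X tau g) -> L2_fourier v (phase X sigma g) ->
  (\int[mu]_x (normc (u x - v x) ^+ 2)%:E <= (8 / (2 * pi) ^+ n)%:E *
    \int[mu]_x (Num.min 4 (((tau - sigma) * X x) ^+ 2) * normc (g x) ^+ 2)%:E)%E.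
Proof.
move=> mX u2 v2 g2 Hu Hv.
have [u_1 u_2] := inL2P u2; have [v_1 v_2] := inL2P v2.
have [p1 q1] := inL2P (inL2_phase tau mX g2).
have [p2 q2] := inL2P (inL2_phase sigma mX g2).
have H := heat_pairB u_1 u_2 p1 q1 v_1 v_2 p2 q2 Hu Hv.
have := heat_pair_sqr_integral_le (L2RB u_1 v_1) (L2RB u_2 v_2) (L2RB p1 p2) (L2RB q1 q2) H.
have -> : (\int[mu]_x (normc (u x - v x) ^+ 2)%:E = \int[mu]_x
    ((complex.Re (u x) - complex.Re (v x)) ^+ 2 + (complex.Im (u x) - complex.Im (v x)) ^+ 2)%:E)%E.
  by apply: eq_integral => x _; rewrite sqr_normc; case: (u x) => a b; case: (v x).
move=> /le_trans; apply; apply: lee_wpmul2l.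
  by rewrite lee_fin divr_ge0// exprn_ge0// mulr_ge0// pi_ge0.
have [[mp1 _] [mq1 _] [mp2 _] [mq2 _]] := And4 p1 q1 p2 q2.
have [mg _] := g2.
apply: ge0_le_integral => //.
- by move=> x _; rewrite lee_fin addr_ge0// sqr_ge0.
- apply/measurable_EFinP; apply: measurable_funD; apply: measurable_funX;
    exact: measurable_funB.
- apply/measurable_EFinP; apply: measurable_funM; last exact: measurable_sqr_normc.
  apply: measurable_minr => //; apply: measurable_funX; exact: measurable_funM.
move=> x _; rewrite lee_fin !Re_phase !Im_phase mulrBl.
have := expi_dist_le (tau * X x) (sigma * X x).
set c := cos _; set c' := cos _; set s := sin _; set s' := sin _ => hE.
rewrite sqr_normc; set p := complex.Re _; set q := complex.Im _.
apply: le_trans (ler_wpM2r _ hE); last by rewrite addr_ge0 ?sqr_ge0.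
by rewrite le_eqVlt; apply/orP; left; apply/eqP; ring.
Qed.

End multipliers.

(** * Convergence through the representatives of the cells *)

Section pointwise.
Context {R : realType}.
Local Notation normc := ComplexField.Normc.normc.

Lemma sqr_normcB_le (x y z : R[i]) :
  normc (x - z) ^+ 2 <= 2 * normc (x - y) ^+ 2 + 2 * normc (y - z) ^+ 2.
Proof.
rewrite !sqr_normc; case: x => a b; case: y => c d; case: z => e f /=.
rewrite -subr_ge0; set E := _ - _.
have -> : E = (a - c - (c - e)) ^+ 2 + (b - d - (d - f)) ^+ 2 by rewrite /E; ring.
by rewrite addr_ge0 ?sqr_ge0.
Qed.

Lemma cvgC_sqr_normc (z : nat -> R[i]) (l : R[i]) :
  (forall e : R, 0 < e -> \forall k \near \oo, normc (z k - l) ^+ 2 < e) ->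
  (z k : (R[i] : numFieldType)) @[k --> \oo] --> (l : (R[i] : numFieldType)).
Proof.
(* The radius is a positive element of [R[i]], that is, a positive real with vanishing imaginary
   part. *)
move=> H; apply/cvgrPdist_lt => -[e e'].
rewrite ltcE/= => /andP[/eqP e'0 e0].
have e20 : 0 < e ^+ 2 by rewrite exprn_gt0.
apply: filterS (H _ e20) => k hk; rewrite distrC ltcE/= e'0 eqxx/=.
have n0 : 0 <= normc (z k - l) by case: (z k - l) => ? ?; exact: sqrtr_ge0.
by rewrite -(@ltr_pXn2r _ 2)// nnegrE ltW.
Qed.

(** That [p k] tends to infinity follows from monotonicity: once [2 * t k < t N], an index [p k < N]
    would give [t N < t (p k) <= 2 * t k]. So both error terms, at [k] and at [p k], become
    small. *)
Lemma cvg_of_representatives (t : nat -> R) (p : nat -> nat) (u : nat -> R[i]) (l : R[i])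
    (phi : nat -> R) :
  {homo t : i j / (i < j)%N >-> j < i} -> (forall i, 0 < t i) ->
  t k @[k --> \oo] --> (0 : R) ->
  (forall i, t (p i) <= 2 * t i) ->
  phi k @[k --> \oo] --> (0 : R) ->
  (\forall k \near \oo, normc (u k - u (p k)) ^+ 2 <= phi k) ->
  (\forall k \near \oo, normc (u (p k) - l) ^+ 2 <= phi (p k)) ->
  (u k : (R[i] : numFieldType)) @[k --> \oo] --> (l : (R[i] : numFieldType)).
Proof.
move=> tdecr t0 tcvg tp phicvg Hu Hl; apply: cvgC_sqr_normc => e e0.
have e40 : 0 < e / 4 by rewrite divr_gt0.
have /cvgrPdist_lt/(_ _ e40)[N _ HN] := phicvg.
have phi_lt k : (N <= k)%N -> phi k < e / 4.
  by move=> /HN/=; rewrite sub0r normrN; apply: le_lt_trans; exact: ler_norm.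
have tN0 : 0 < t N / 2 by rewrite divr_gt0.
have tk_small : \forall k \near \oo, t k < t N / 2.
  move/cvgrPdist_lt: tcvg => /(_ _ tN0); apply: filterS => k.
  by rewrite sub0r normrN; apply: le_lt_trans; exact: ler_norm.
near=> k.
have pN : (N <= p k)%N.
  rewrite leqNgt; apply/negP => /tdecr; apply/negP; rewrite -leNgt.
  apply: (le_trans (tp k)); rewrite -ler_pdivlMl// mulrC; apply/ltW.
  by near: k.
have kN : phi k < e / 4 by apply: phi_lt; near: k; exact: nbhs_infty_ge.
apply: (le_lt_trans (sqr_normcB_le _ (u (p k)) _)).
have h1 : normc (u k - u (p k)) ^+ 2 <= phi k by near: k.
have h2 : normc (u (p k) - l) ^+ 2 <= phi (p k) by near: k.
have h3 := phi_lt _ pN.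
by move: h1 h2 h3 kN; set A := _ ^+ 2; set B := _ ^+ 2 => h1 h2 h3 kN; lra.
Unshelve. all: by end_near.
Qed.

End pointwise.

Section normRn_measurable.
Context {R : realType} {n : nat}.

Lemma measurable_normRn : measurable_fun setT (normRn : Rn R n -> R).
Proof.
have ms := measurable_realfun.continuous_measurable_fun (@sqrt_continuous R).
have md : measurable_fun setT (fun x : Rn R n => dotRn x x) by exact: measurable_fun_dotRn.
exact: (measurableT_comp ms md).
Qed.

Lemma powR_normRn_le (a s : R) (x : Rn R n) : 0 < a -> 0 < s ->
  (normRn x `^ a) `^ (2 * s / a) <= (1 + normRn x ^+ 2) `^ s.
Proof.
move=> a0 s0; rewrite -powRrM mulrCA divff ?gt_eqF// mulr1 powRrM powR_mulrn ?normRn_ge0//.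
by rewrite ge0_ler_powR ?nnegrE ?addr_ge0 ?sqr_ge0 ?lerDr// ltW.
Qed.

End normRn_measurable.

Local Notation normc := ComplexField.Normc.normc.

Theorem theorem3 (R : realType) (n : nat) (a s b : R) (t : nat -> R)
    (f : Rn R n -> R[i]) (Sf : nat -> Rn R n -> R[i])
    (n_ge1 : (1 <= n)%N) (a_gt1 : 1 < a)
    (s_gt0 : 0 < s) (s_le : s <= 1 / 2) (b_le : b <= 2 * s / (a - s))
    (t_lt1 : t 0%N < 1) (t_decr : forall k, t k.+1 < t k)
    (t_gt0 : forall k, 0 < t k) (t_cvg : t k @[k --> \oo] --> (0 : R))
    (card_A : exists C : R, forall j : nat, (1 <= j)%N ->
       (counting (dyadic_block t j) <= (C * 2 `^ (b * j%:R))%:E)%E)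
    (f_L2 : inL2 f) (f_Hs : sobolev s (regular f))
    (Sf_def : forall k, is_S a (t k) f (Sf k)) :
  {ae lebesgueRn R n, forall x,
    (Sf k x : (R[i] : numFieldType)) @[k --> \oo] --> (f x : (R[i] : numFieldType))}.
Proof.
have a0 : 0 < a by lra.
pose k := 2 * s / a.
have k0 : 0 < k by rewrite divr_gt0// mulr_gt0.
have k2 : k < 2 by rewrite ltr_pdivrMr//; lra.
(* After multiplication by [a - s] the two sides differ by [2s (s/a) (1 - 2s/a)], which is
   nonnegative because [2s <= 1 < a]. *)
have bk : b <= k * (1 + k).
  have as0 : 0 < a - s by lra.
  apply: (le_trans b_le); rewrite ler_pdivrMr// /k.
  have -> : 2 * s / a * (1 + 2 * s / a) * (a - s) = 2 * s + 2 * s * (s / a * (1 - 2 * s / a)).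
    by field; rewrite gt_eqF.
  rewrite lerDl !mulr_ge0 ?invr_ge0 ?(ltW s_gt0) ?(ltW a0)// subr_ge0 ler_pdivrMr//.
  lra.
have tdecr : {homo t : i j / (i < j)%N >-> j < i}.
  move=> i j ij; apply: (@homo_ltn _ t (fun x y => y < x)) ij => // x y z yx zy.
  exact: lt_trans zy yx.
have tinj : injective t.
  by move=> i j E; have [/tdecr||//] := ltngtP i j; [|move=> /tdecr]; rewrite E ltxx.
have t1 i : t i <= 1.
  by case: i => [|i]; [exact: ltW|rewrite (le_trans (ltW (tdecr 0%N i.+1 isT)))// ltW].
have [C HC] := card_A.
have C0 : 0 <= Num.max C 0 by rewrite le_max lexx orbT.
have cnt j m : (1 <= j)%N -> #|[pred i : 'I_m | (2 ^+ j.+1)^-1 < t i <= (2 ^+ j)^-1]|%:R <=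
    Num.max C 0 * ((2 `^ (1 + k)) ^+ j) `^ k.
  move=> j1; apply: le_trans (powR_le_exponent _ j k0 bk).
  by apply: counting_dyadic_block => //; exact: HC.
have [p [pp tp ph [D D0 HD]]] := cell_representatives k0 k2 C0 t_gt0 t1 cnt.
have [_ [g [mg fg g_s]]] := f_Hs.
pose mu := lebesgueRn R n.
pose X (xi : Rn R n) : R := normRn xi `^ a.
have mX : measurable_fun setT X.
  exact: (measurableT_comp (measurable_powR a) measurable_normRn).
(* A weight at least 1 turns the Sobolev condition into square integrability of [g], which
   uniqueness of the transform requires. *)
have w1 (xi : Rn R n) : 1 <= (1 + normRn xi ^+ 2) `^ s :> R.
  have h : 1 <= 1 + normRn xi ^+ 2 :> R by rewrite lerDl sqr_ge0.
  have := @ge0_ler_powR R s (ltW s_gt0) 1 (1 + normRn xi ^+ 2).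
  by rewrite !nnegrE ler01 (le_trans ler01 h) powR1 => /(_ isT isT h).
have mN : measurable_fun setT (fun xi : Rn R n => normc (g xi) ^+ 2).
  exact: measurable_sqr_normc.
have mW : measurable_fun setT
    (fun xi : Rn R n => (1 + normRn xi ^+ 2) `^ s * normc (g xi) ^+ 2).
  apply: measurable_funM => //.
  apply: (measurableT_comp (measurable_powR s)); apply: measurable_funD => //.
  exact: measurable_funX measurable_normRn.
have g2 : inL2 g.
  split=> //; apply: le_lt_trans g_s; apply: ge0_le_integral => //.
  - by move=> x _; rewrite lee_fin sqr_ge0.
  - exact/measurable_EFinP.
  - exact/measurable_EFinP.
  - by move=> x _; rewrite lee_fin ler_peMl// sqr_ge0.
(* [h] is the version of the transform of [f] supplied with [Sf i]; it is exchanged for the [g] of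
   the Sobolev condition. *)
have Fu i : L2_fourier (Sf i) (phase X (t i) g).
  have [ui [h [h2 fh Fh]]] := Sf_def i.
  apply: (@L2_fourier_ae _ _ _ (phase X (t i) h)); [exact: inL2_phase..| |].
    apply: filterS (has_fourier_unique h2 g2 fh fg) => x hg.
    by rewrite /phase hg.
  by apply: heat_pair_fourier => //; exact: inL2_phase.
(* Regarding [f] as the value at time 0 lets the same distance estimate treat [Sf i - f]. *)
have Ff : L2_fourier f (phase X 0 g) by rewrite phase0; exact: heat_pair_fourier.
have u2 i : inL2 (Sf i) by have [] := Sf_def i.
pose P i := t i <= 1 / 2.
pose Q i := P i && (p i == i).
(* Both series of squares are carried by one sequence: a term whose condition fails is 0, and [V] is
   the matching multiplier. *)
pose phi i x := (if P i then normc (Sf i x - Sf (p i) x) ^+ 2 else 0) +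
  (if Q i then normc (Sf i x - f x) ^+ 2 else 0).
pose V i x := ((if P i then Num.min 4 (((t i - t (p i)) * X x) ^+ 2) else 0) +
  (if Q i then Num.min 4 ((t i * X x) ^+ 2) else 0)) * normc (g x) ^+ 2.
have mdist (u v : Rn R n -> R[i]) : inL2 u -> inL2 v ->
    measurable_fun setT (fun x => normc (u x - v x) ^+ 2).
  move=> [[mu1 mu2] _] [[mv1 mv2] _].
  apply: (@measurable_sqr_normc _ _ (fun x => u x - v x)); split.
    rewrite (_ : (fun x => _) = fun x => complex.Re (u x) - complex.Re (v x)).
      exact: measurable_funB.
    by apply/funext => x; case: (u x) => ? ?; case: (v x).
  rewrite (_ : (fun x => _) = fun x => complex.Im (u x) - complex.Im (v x)).
    exact: measurable_funB.
  by apply/funext => x; case: (u x) => ? ?; case: (v x).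
have mphi i : measurable_fun setT (phi i).
  by apply: measurable_funD; [case: (P i)|case: (Q i)] => //; exact: mdist.
have mmin c : measurable_fun setT (fun x => Num.min 4 ((c * X x) ^+ 2) : R).
  by apply: measurable_minr => //; apply: measurable_funX; exact: measurable_funM.
have mV i : measurable_fun setT (V i).
  apply: measurable_funM => //.
  by apply: measurable_funD; [case: (P i)|case: (Q i)] => //; exact: mmin.
have phi0 i x : 0 <= phi i x.
  by rewrite /phi addr_ge0//; case: ifP => // _; exact: sqr_ge0.
pose K : R := 8 / (2 * pi) ^+ n.
pose B := fine (K%:E * (D%:E * \int[mu]_xi
   ((1 + normRn xi ^+ 2) `^ s * normc (g xi) ^+ 2)%:E))%E.
have phiB m : (\sum_(i < m) \int[mu]_x (phi i x)%:E <= B%:E)%E.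
  have part (c : bool) u v (tau sigma : R) : inL2 u -> inL2 v ->
      L2_fourier u (phase X tau g) -> L2_fourier v (phase X sigma g) ->
      (\int[mu]_x (if c then normc (u x - v x) ^+ 2 else 0)%:E <= K%:E *
       \int[mu]_x ((if c then Num.min 4 (((tau - sigma) * X x) ^+ 2) else 0) *
         normc (g x) ^+ 2)%:E)%E.
    case: c => uL vL uF vF; first exact: L2_fourier_dist_le.
    rewrite !integral0_eq// => [|x _]; first by rewrite mule0.
    by rewrite mul0r.
  have min0 c x : 0 <= Num.min 4 ((c * X x) ^+ 2) :> R by rewrite le_min sqr_ge0 andbT.
  have if0 (c : bool) (y : R) : 0 <= y -> 0 <= (if c then y else 0) by case: c.
  have mif (c : bool) (F : Rn R n -> R) : measurable_fun setT F ->
      measurable_fun setT (fun x => if c then F x else 0).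
    by case: c.
  have V0 i x : 0 <= V i x.
    by rewrite /V mulr_ge0 ?sqr_ge0// addr_ge0// if0.
  have intphi i : (\int[mu]_x (phi i x)%:E <= K%:E * \int[mu]_x (V i x)%:E)%E.
    have p1 := part (P i) _ _ _ _ (u2 i) (u2 (p i)) (Fu i) (Fu (p i)).
    have := part (Q i) _ _ _ _ (u2 i) f_L2 (Fu i) Ff.
    rewrite subr0 => p2.
    have -> : (\int[mu]_x (phi i x)%:E =
       \int[mu]_x (if P i then normc (Sf i x - Sf (p i) x) ^+ 2 else 0)%:E +
       \int[mu]_x (if Q i then normc (Sf i x - f x) ^+ 2 else 0)%:E)%E.
      rewrite -ge0_integralD//.
      - by move=> x _; rewrite lee_fin if0// sqr_ge0.
      - by apply/measurable_EFinP; apply: mif; exact: mdist.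
      - by move=> x _; rewrite lee_fin if0// sqr_ge0.
      - by apply/measurable_EFinP; apply: mif; exact: mdist.
    have -> : (\int[mu]_x (V i x)%:E =
       \int[mu]_x ((if P i then Num.min 4 (((t i - t (p i)) * X x) ^+ 2) else 0) *
         normc (g x) ^+ 2)%:E +
       \int[mu]_x ((if Q i then Num.min 4 ((t i * X x) ^+ 2) else 0) *
         normc (g x) ^+ 2)%:E)%E.
      rewrite -ge0_integralD//.
      - by apply: eq_integral => x _; rewrite /V mulrDl.
      - by move=> x _; rewrite lee_fin mulr_ge0 ?sqr_ge0// if0.
      - by apply/measurable_EFinP; apply: measurable_funM => //; exact: mif.
      - by move=> x _; rewrite lee_fin mulr_ge0 ?sqr_ge0// if0.
      - by apply/measurable_EFinP; apply: measurable_funM => //; exact: mif.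
    rewrite ge0_muleDr; first exact: leeD.
    - by apply: integral_ge0 => x _; rewrite lee_fin mulr_ge0 ?sqr_ge0// if0.
    - by apply: integral_ge0 => x _; rewrite lee_fin mulr_ge0 ?sqr_ge0// if0.
  apply: (@le_trans _ _ (\sum_(i < m) K%:E * \int[mu]_x (V i x)%:E)%E).
    by apply: lee_sum => i _; exact: intphi.
  have mVE i : measurable_fun setT (fun x => (V i x)%:E) by exact/measurable_EFinP.
  have V0E i x : [set: Rn R n] x -> (0 <= (V i x)%:E)%E by rewrite lee_fin.
  rewrite -ge0_sume_distrr => [|i _]; last by apply: integral_ge0 => x _; exact: V0E.
  have Wge0 : (0 <= \int[mu]_xi ((1 + normRn xi ^+ 2) `^ s * normc (g xi) ^+ 2)%:E)%E.
    by apply: integral_ge0 => x _; rewrite lee_fin mulr_ge0 ?powR_ge0 ?sqr_ge0.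
  rewrite /B fineK; last first.
    by rewrite !fin_numM// ge0_fin_numE.
  apply: lee_wpmul2l.
    by rewrite lee_fin divr_ge0// exprn_ge0// mulr_ge0// pi_ge0.
  have mWE : measurable_fun setT (fun xi : Rn R n =>
      ((1 + normRn xi ^+ 2) `^ s * normc (g xi) ^+ 2)%:E) by exact/measurable_EFinP.
  have -> : (\sum_(i < m) \int[mu]_x (V i x)%:E = \int[mu]_x (\sum_(i < m) (V i x)%:E))%E.
    by rewrite (ge0_integral_sum mu measurableT (fun i : 'I_m => mVE i) (fun i : 'I_m => V0E i)).
  rewrite -ge0_integralZl//; last first.
    by move=> x _; rewrite lee_fin mulr_ge0 ?powR_ge0 ?sqr_ge0.
  apply: ge0_le_integral => //.
  - by move=> x _; apply: sume_ge0 => i _; exact: V0E.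
  - exact: emeasurable_sum.
  - exact: measurable_funeM.
  move=> x _; rewrite sumEFin -EFinM lee_fin /V -mulr_suml [leRHS]mulrA.
  apply: ler_wpM2r; first exact: sqr_ge0.
  rewrite big_split/= -!big_mkcond/=.
  apply: (le_trans (HD m (X x) (powR_ge0 _ _))).
  by rewrite ler_wpM2l// powR_normRn_le.
apply: filterS (ae_cvg0_sum_le mphi phi0 phiB) => x phix.
have t_half : \forall i \near \oo, P i.
  have h : 0 < 1 / 2 :> R by rewrite divr_gt0.
  move/cvgrPdist_lt: t_cvg => /(_ _ h); apply: filterS => i.
  by rewrite sub0r normrN => /ltW; apply: le_trans; exact: ler_norm.
apply: (cvg_of_representatives tdecr t_gt0 t_cvg tp phix).
  apply: filterS t_half => i Pi; rewrite /phi Pi lerDl.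
  by case: ifP => // _; exact: sqr_ge0.
(* The representative [p i] is its own representative and stays below [1 / 2], so the second summand
   of [phi (p i)] is present. *)
apply: filterS t_half => i Pi; have Pp : P (p i) := ph _ Pi.
by rewrite /phi /Q Pp pp eqxx/= lerDr sqr_ge0.
Qed.
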